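(* (a) For any $\frac23\le\alpha\le1$, there exists a finitely generated $3$-step solvable group $\Delta$ such that for any $p\in[1,2]$, $$\alpha_p^\ast(\Delta)=\alpha_p^{\#}(\Delta)=\alpha.$$ (b) There exists a finitely generated $3$-step solvable group $\Delta_1$ such that for all $q\in(2,\infty)$, $$\alpha_q^\ast(\Delta_1)\ge\frac{3q-4}{4q-5}>\alpha_2^\ast(\Delta_1)=\frac23.$$
   Context: $L_p=L_p([0,1])$ with Lebesgue measure. For a finitely generated group $G$ with word metric $|\cdot|_G$ and a map $\Psi:G\to\mathfrak X$ into a Banach space, the compression function is $\rho_\Psi(t)=\inf\{\|\Psi(x)-\Psi(y)\|_{\mathfrak X}:|x^{-1}y|_G\ge t\}$ and the compression exponent is $\alpha_{\mathfrak X}(\Psi)=\sup\{\alpha\ge0:\exists c>0,\ \rho_\Psi(t)\ge ct^\alpha\ \forall t\ge1\}$. Then $\alpha_{\mathfrak X}^\ast(G)=\sup\{\alpha_{\mathfrak X}(\Psi):\Psi:G\to\mathfrak X\text{ Lipschitz}\}$, and $\alpha_{\mathfrak X}^{\#}(G)$ is the same supremum restricted to $G$-equivariant Lipschitz maps, i.e. maps of the form $\Psi(g)=\tau(g)v$ for some action $\tau$ of $G$ on $\mathfrak X$ by affine isometries and some $v\in\mathfrak X$. Write $\alpha_p^\ast=\alpha_{L_p}^\ast$, $\alpha_p^{\#}=\alpha_{L_p}^{\#}$. $3$-step solvable means the third derived subgroup is trivial. *)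

(* Defs.v *)
From HB Require Import structures.
From mathcomp Require Import all_boot all_order all_algebra.
From mathcomp Require Import all_classical all_reals all_analysis.
From mathcomp Require Import measurable_realfun ess_sup_inf.
Set Implicit Arguments.
Unset Strict Implicit.
Unset Printing Implicit Defensive.
Import Order.TTheory GRing.Theory Num.Theory.
Import numFieldNormedType.Exports.
Local Open Scope classical_set_scope.
Local Open Scope ring_scope.

(* The library's LspaceType (classes of measurable functions modulo a.e.
   equality, with finite p-norm) comes without algebraic structure; this section
   makes it a normed space over R, with the operations induced by those of
   representatives and the norm given by Lnorm. *)
Section LspaceNormed.
Context d (T : measurableType d) (R : realType).
Variables (mu : {measure set T -> \bar R}) (p : \bar R) (p1 : (1 <= p)%E).
Local Notation lfun := (LfunType mu p1).
Local Notation lspace := (LspaceType mu p1).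
Local Notation nm f := (fine (Lnorm mu p (EFin \o f))).

HB.instance Definition _ := gen_eqMixin lspace.
HB.instance Definition _ := gen_choiceMixin lspace.

Lemma Lnorm_ae_eq (f g : T -> R) :
  measurable_fun [set: T] f -> measurable_fun [set: T] g ->
  f = g %[ae mu] -> Lnorm mu p (EFin \o f) = Lnorm mu p (EFin \o g).
Proof.
move=> mf mg fg; rewrite unlock /Lnorm.
have mE (h : T -> R) (r : R) : measurable_fun [set: T] h ->
    measurable_fun [set: T] ((fun x => (`|(EFin \o h) x| `^ r)%E) : T -> \bar R).
  move=> mh.
  apply/measurable_EFinP; apply: (measurableT_comp (measurable_powR _)) => //.
  exact: measurableT_comp.
case: p p1 => [r r1||//].
- congr (_ `^ _)%E; apply: ae_eq_integral => //; try exact: mE.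
  by apply: filterS fg => x /= /(_ I) ->.
- move=> _; case: ifP => // _; apply: eq_ess_sup.
  by apply: filterS fg => x /= /(_ I) ->.
Qed.

Lemma Lspace_repr_Lfun (F : lspace) : (F : T -> R) \in Lfun mu p.
Proof.
apply/andP; split; rewrite inE /=; last exact: Lebesgue_finite.
exact: (@measurable_funPT _ _ _ (measurableTypeR R)
  (repr (F : {mfun_ mu, T >-> measurableTypeR R}))).
Qed.

Definition Lspace_repr (F : lspace) : lfun := Lfun_Sub p1 (Lspace_repr_Lfun F).

Let mfunR (g : {mfun T >-> R}) : {mfun T >-> measurableTypeR R} :=
  MeasurableFun.Pack (MeasurableFun.Class
    (@isMeasurableFun.Build d _ T (measurableTypeR R) g (measurable_funPT g))).

Section Class.
Variable f : lfun.

Let c : {mfun_ mu, T >-> measurableTypeR R} :=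
  \pi_({mfun_ mu, T >-> measurableTypeR R})%qT
    (mfunR f).

Lemma class_ae : (c : T -> R) = f %[ae mu].
Proof.
by have /eqmodP/asboolP := reprK c.
Qed.

Lemma class_finite : finite_norm mu p (c : T -> R).
Proof.
rewrite /finite_norm (_ : Lnorm _ _ _ = Lnorm mu p (EFin \o f)).
  exact: Lfunction_finite.
apply: Lnorm_ae_eq class_ae; last exact: measurable_funPT.
exact: (@measurable_funPT _ _ _ (measurableTypeR R) (repr c)).
Qed.

Definition Lspace_class : lspace :=
  LebesgueSpace.Pack (LebesgueSpace.Class
    (isFinLebesgue.Build d T R mu p p1 c class_finite)).
End Class.

Lemma Lspace_classE (f : lfun) : (Lspace_repr (Lspace_class f) : T -> R) = f %[ae mu].
Proof. exact: class_ae. Qed.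

Lemma Lspace_eqP (F G : lspace) :
  (Lspace_repr F : T -> R) = Lspace_repr G %[ae mu] -> F = G.
Proof.
move=> FG.
have E : (F : {mfun_ mu, T >-> measurableTypeR R}) = G.
  rewrite -[LHS]reprK -[RHS]reprK.
  apply/eqmodP/asboolP; exact: FG.
case: F G E {FG} => [F [[HF]]] [G [[HG]]] /= E.
by subst G; rewrite (Prop_irrelevance HF HG).
Qed.

Lemma Lspace_class_eq (f g : lfun) :
  (f : T -> R) = g %[ae mu] -> Lspace_class f = Lspace_class g.
Proof.
move=> fg; apply: Lspace_eqP.
by apply: filterS3 fg (Lspace_classE f) (Lspace_classE g)
  => x fg fE gE xT; rewrite fE// gE// fg.
Qed.

Lemma Lspace_reprK (F : lspace) : Lspace_class (Lspace_repr F) = F.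
Proof. exact/Lspace_eqP/Lspace_classE. Qed.

Definition Lspace_zero : lspace := Lspace_class 0.
Definition Lspace_opp (F : lspace) : lspace := Lspace_class (- Lspace_repr F).
Definition Lspace_add (F G : lspace) : lspace :=
  Lspace_class (Lspace_repr F + Lspace_repr G).
Definition Lspace_scale (a : R) (F : lspace) : lspace :=
  Lspace_class (a *: Lspace_repr F).
Definition Lspace_norm (F : lspace) : R := nm F.

Let lfunDE (f g : lfun) x : (f + g : lfun) x = f x + g x. Proof. by []. Qed.
Let lfunNE (f : lfun) x : (- f : lfun) x = - f x. Proof. by []. Qed.
Let lfunZE a (f : lfun) x : (a *: f : lfun) x = a * f x. Proof. by []. Qed.

Lemma Lspace_addE (f g : lfun) :
  Lspace_add (Lspace_class f) (Lspace_class g) = Lspace_class (f + g).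
Proof.
apply: Lspace_class_eq.
by apply: filterS2 (Lspace_classE f) (Lspace_classE g) => x fE gE xT;
  rewrite !lfunDE fE// gE.
Qed.

Lemma Lspace_oppE (f : lfun) :
  Lspace_opp (Lspace_class f) = Lspace_class (- f).
Proof.
apply: Lspace_class_eq.
by apply: filterS (Lspace_classE f) => x fE xT; rewrite !lfunNE fE.
Qed.

Lemma Lspace_scaleE (a : R) (f : lfun) :
  Lspace_scale a (Lspace_class f) = Lspace_class (a *: f).
Proof.
apply: Lspace_class_eq.
by apply: filterS (Lspace_classE f) => x fE xT; rewrite !lfunZE fE.
Qed.

Lemma Lspace_normE (f : lfun) : Lspace_norm (Lspace_class f) = nm f.
Proof.
congr fine; apply: Lnorm_ae_eq (Lspace_classE f); exact: measurable_funPT.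
Qed.

Lemma Lspace_addA : associative Lspace_add.
Proof.
move=> F G H; rewrite -(Lspace_reprK F) -(Lspace_reprK G) -(Lspace_reprK H).
by rewrite !Lspace_addE addrA.
Qed.

Lemma Lspace_addC : commutative Lspace_add.
Proof. by move=> F G; rewrite /Lspace_add addrC. Qed.

Lemma Lspace_add0 : left_id Lspace_zero Lspace_add.
Proof.
by move=> F; rewrite -(Lspace_reprK F) Lspace_addE add0r.
Qed.

Lemma Lspace_addN : left_inverse Lspace_zero Lspace_opp Lspace_add.
Proof.
by move=> F; rewrite -(Lspace_reprK F) Lspace_oppE Lspace_addE addNr.
Qed.

HB.instance Definition _ := GRing.isZmodule.Build lspace
  Lspace_addA Lspace_addC Lspace_add0 Lspace_addN.

Let addE : (+%R : lspace -> lspace -> lspace) = Lspace_add. Proof. by []. Qed.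

Lemma Lspace_scaleA (a b : R) (F : lspace) :
  Lspace_scale a (Lspace_scale b F) = Lspace_scale (a * b) F.
Proof. by rewrite -(Lspace_reprK F) !Lspace_scaleE scalerA. Qed.

Lemma Lspace_scale1 : left_id 1 Lspace_scale.
Proof. by move=> F; rewrite -(Lspace_reprK F) Lspace_scaleE scale1r. Qed.

Lemma Lspace_scaleDr : right_distributive Lspace_scale +%R.
Proof.
move=> a F G; rewrite addE -(Lspace_reprK F) -(Lspace_reprK G).
by rewrite !(Lspace_addE, Lspace_scaleE) scalerDr.
Qed.

Lemma Lspace_scaleDl F : {morph Lspace_scale^~ F : a b / a + b}.
Proof.
move=> a b; rewrite addE -(Lspace_reprK F).
by rewrite !(Lspace_addE, Lspace_scaleE) scalerDl.
Qed.

HB.instance Definition _ := GRing.Zmodule_isLmodule.Build R lspace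
  Lspace_scaleA Lspace_scale1 Lspace_scaleDr Lspace_scaleDl.

Lemma Lspace_normD (F G : lspace) :
  Lspace_norm (F + G) <= Lspace_norm F + Lspace_norm G.
Proof.
rewrite addE -(Lspace_reprK F) -(Lspace_reprK G) Lspace_addE !Lspace_normE.
exact: ler_LnormD.
Qed.

Lemma Lspace_normZ (a : R) (F : lspace) :
  Lspace_norm (a *: F) = `|a| * Lspace_norm F.
Proof.
rewrite (_ : a *: F = Lspace_scale a F)// -(Lspace_reprK F) Lspace_scaleE.
rewrite !Lspace_normE.
have := LnormZ (Lspace_repr F) a => /(congr1 fine).
by rewrite -(finite_norm_fine (Lspace_repr F)) -EFinM.
Qed.

Lemma Lspace_norm0 (F : lspace) : Lspace_norm F = 0 -> F = 0.
Proof.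
rewrite -{2}(Lspace_reprK F) => /(@fine_Lnormr_eq0 _ _ _ _ _ _ (Lspace_repr F)) F0.
rewrite -[RHS]/(Lspace_class 0); apply: Lspace_class_eq.
by apply: filterS F0 => x /[apply].
Qed.

HB.instance Definition _ := @Lmodule_isNormed.Build R lspace
  Lspace_norm Lspace_normD Lspace_normZ Lspace_norm0.

End LspaceNormed.

(* L_p([0,1]) is the L_p space of Lebesgue measure on R restricted to [0,1]: the
   values of the functions outside [0,1] are irrelevant, being on a null set. *)
Definition lebesgue01 (R : realType) : {measure set (measurableTypeR R) -> \bar R} :=
  mrestr (@lebesgue_measure R) (measurable_itv `[0, 1]).

Definition Lp01 (R : realType) (p : R) (p1 : 1 <= p) : normedModType R :=
  LspaceType (lebesgue01 R) (etrans (lee_fin 1 p) p1).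

Lemma le1_2 (R : realType) : 1 <= 2 :> R.
Proof. by rewrite ler1n. Qed.

Section Groups.
Variable G : groupType.

Definition generated_subgroup (A : set G) : set G :=
  smallest [set H : set G | group_closed (mem H)] A.

Definition generates (S : seq G) : Prop :=
  generated_subgroup [set` S] = [set: G].

Definition finitely_generated : Prop := exists S : seq G, generates S.

Definition derived_subgroup (H : set G) : set G :=
  generated_subgroup [set commg x y | x in H & y in H].

Definition derived_series (n : nat) : set G := iter n derived_subgroup [set: G].

Definition three_step_solvable : Prop := derived_series 3 = [set 1%g].

Definition words (S : seq G) (x : G) : set (seq G) :=
  [set w | (forall s, s \in w -> s \in S \/ s^-1%g \in S) /\
           (\prod_(s <- w) s)%g = x].

(* The infimum is attained whenever S generates G. *)
Definition word_length (R : realType) (S : seq G) (x : G) : R :=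
  inf [set (size w)%:R | w in words S x].

End Groups.

Section Compression.
Variables (R : realType) (G : groupType) (S : seq G) (X : normedModType R).
Implicit Type Psi : G -> X.

Definition word_lipschitz Psi : Prop :=
  exists L : R, forall x y : G,
    `|Psi x - Psi y| <= L * word_length R S (x^-1 * y)%g.

(* The infimum over the empty set is +oo. *)
Definition compression_function Psi (t : R) : \bar R :=
  ereal_inf [set r | exists x y : G,
    t <= word_length R S (x^-1 * y)%g /\ r = (`|Psi x - Psi y|)%:E].

(* When no exponent is admissible the supremum is -oo, instead of 0 for the
   supremum of the empty subset of [0, +oo]; the suprema over Psi below are the
   same with both conventions as soon as they are positive. *)
Definition compression_exponent Psi : \bar R :=
  ereal_sup [set a%:E | a in [set a : R | 0 <= a /\
    exists c : R, 0 < c /\ forall t : R, 1 <= t ->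
      ((c * t `^ a)%:E <= compression_function Psi t)%E]].

Definition affine_isometry (f : X -> X) : Prop :=
  (exists (L : {linear X -> X}) (b : X), forall x, f x = L x + b) /\
  (forall x y, `|f x - f y| = `|x - y|).

Definition affine_isometric_action (tau : G -> X -> X) : Prop :=
  [/\ forall v, tau 1%g v = v,
      forall g h v, tau (g * h)%g v = tau g (tau h v)
    & forall g, affine_isometry (tau g)].

Definition equivariant_map Psi : Prop :=
  exists (tau : G -> X -> X) (v : X),
    affine_isometric_action tau /\ forall g, Psi g = tau g v.

Definition alpha_star : \bar R :=
  ereal_sup [set compression_exponent Psi | Psi in [set Psi | word_lipschitz Psi]].

Definition alpha_sharp : \bar R :=
  ereal_sup [set compression_exponent Psi | Psi in
    [set Psi | word_lipschitz Psi /\ equivariant_map Psi]].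

End Compression.

(* Main.v *)
(** For 0 <= theta <= 1/2 let Delta be generated by a cursor step tau on the integers
    and two switches a, b, acting on lamps indexed by a level s and an integer x.
    The lamp at (s, x) lives in a dihedral group with rotations of order 4 m, where
    m ~ 4^(theta s); the switch a reflects the lamps at the cursor and b those at
    distance k = 2 * 4^s ahead of it, so a rotation of a lamp costs a walk of length
    about k. Turning n <= k / 2 neighbouring lamps of level s at once still costs
    O(k), whereas turning one lamp by half a turn costs about k m.

    Upper bound for p <= 2: the rotations of m^2 neighbouring lamps form a discrete
    torus; the metric cotype 2 inequality on it, obtained from smoothing over subset
    sums for real functions and p = 2, then for p <= 2 by subordination and in L_p by
    integration, bounds the image of a half turn by O(k). Comparing with its length
    k m gives the exponent 1 / (1 + theta).

    Lower bound: if v is the radius of the range visited by g, then the length of g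
    is at most about v times the largest m with k <= v, that is v^(1 + theta). An
    equivariant embedding, made of slowly varying weights along the rays of cosets of
    the subgroups of elements supported on a half line, recovers v up to an
    arbitrarily small loss in the exponent.

    For q > 2 and theta = 1/2 one adds the cosine and sine of the angles of all the
    lamps, interpolated along the moves of the cursor. A step of the cursor moves k
    angles of level s by O(1 / (k m)) each, so the l_q sum is Lipschitz with weights
    about k m k^(-1/q), and by the power mean inequality over the windows of length
    4^s it detects the total rotation. The two bounds balance at
    (3q - 4) / (4q - 5). *)
Require Import Defs.
From HB Require Import structures.
From mathcomp Require Import all_boot all_order all_algebra.
From mathcomp Require Import all_classical all_reals all_analysis.
From mathcomp Require Import measurable_realfun.
From mathcomp Require Import lra zify.
Set Implicit Arguments.
Unset Strict Implicit.
Unset Printing Implicit Defensive.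
Import Order.TTheory GRing.Theory Num.Theory.
Import numFieldNormedType.Exports.
Local Open Scope ring_scope.

(** * Word lengths, and their independence of the finite generating set *)

Section Words.
Local Open Scope classical_set_scope.
Local Open Scope group_scope.
Variable G : groupType.
Implicit Types (S : seq G) (x y : G) (n : nat).

(** The restriction [theta <= 1/2] comes from the cotype inequality: its factor [m ^ 2] is cancelled
    only by a sum over [m ^ 2] directions, so that many lamps must fit into a window of length
    [4 ^ s], the longest on which alternating the two switches is shown to isolate level [s]. Its
    increments are along subset sums because turning any subset of a window by one double step costs
    one pair of sweeps.

    A switch of [b] also rotates lamps by one step, so the raw rotation says little about the path.
    The rotation modulo the reflection carried by [b] is used instead: it changes only when [a] is
    switched at [x] while the parity of [b] at [x - kk s] is odd. Hence a rotated lamp forces the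
    cursor to have visited both sites, levels with [kk s >= 2 v] are absent from elements of range
    [v], and the logarithmically many remaining ones cost only a factor [v ^ e].

    For [q > 2] the scale [z = 4 ^ s] is unknown. The angles bound the total rotation better at
    large [z], the lamp size [m ^ 2 <= z] better at small [z]; eliminating [z] between the two
    produces the exponent. *)

Definition shorter S n x := exists2 w, words S x w & (size w <= n)%N.

Lemma shorter1 S n : shorter S n 1.
Proof. by exists [::] => //; split => //; rewrite big_nil. Qed.

Lemma shorterM S m n x y :
  shorter S m x -> shorter S n y -> shorter S (m + n) (x * y).
Proof.
move=> [w [wS wx] wm] [v [vS vy] vn]; exists (w ++ v).
  split; last by rewrite big_cat /= wx vy.
  by move=> s; rewrite mem_cat => /orP[/wS|/vS].
by rewrite size_cat leq_add.
Qed.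

Lemma shorterV S n x : shorter S n x -> shorter S n x^-1.
Proof.
move=> [w [wS <-] wn]; exists (rev [seq s^-1 | s <- w]); last first.
  by rewrite size_rev size_map.
split.
  move=> s; rewrite mem_rev => /mapP[t /wS + ->]; rewrite invgK; tauto.
elim: w {wS wn} => [|s w IH] /=; first by rewrite !big_nil invg1.
by rewrite rev_cons -cats1 big_cat /= IH big_seq1 big_cons invgM.
Qed.

Lemma shorter_gen S s : s \in S -> shorter S 1 s.
Proof.
move=> sS; exists [:: s] => //; split; last by rewrite big_seq1.
by move=> t; rewrite inE => /eqP->; left.
Qed.

Lemma shorter_le S m n x : (m <= n)%N -> shorter S m x -> shorter S n x.
Proof. by move=> mn [w ww wm]; exists w => //; exact: leq_trans mn. Qed.

Lemma shorter_ind S (P : G -> Prop) : P 1 ->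
  (forall x s, P x -> s \in S -> P (x * s) /\ P (x * s^-1)) ->
  forall n x, shorter S n x -> P x.
Proof.
move=> P1 PS n x [w [wS <-] _]; elim/last_ind: w wS => [|w s IH] wS.
  by rewrite big_nil.
rewrite -cats1 big_cat big_seq1.
have Pw : P (\prod_(s <- w) s).
  by apply: IH => t tw; apply: wS; rewrite mem_rcons inE tw orbT.
have /wS[sS|sS] : s \in rcons w s by rewrite mem_rcons inE eqxx.
  by case: (PS _ _ Pw sS).
by case: (PS _ _ Pw sS) => _; rewrite invgK.
Qed.

Lemma generates_shorter S x : generates S -> exists n, shorter S n x.
Proof.
move=> gS; have : generated_subgroup [set` S] x by rewrite gS.
move=> /(_ [set y | exists n, shorter S n y]); apply; split; last first.
  by move=> s sS; exists 1%N; exact: shorter_gen.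
split; first by rewrite inE; exists 0; exact: shorter1.
move=> y z; rewrite !inE => -[m ym] [n zn].
by exists (m + n)%N; apply: shorterM => //; exact: shorterV.
Qed.

Lemma shorter_generates S : (forall x, exists n, shorter S n x) -> generates S.
Proof.
move=> h; rewrite /generates -subTset => x _.
move=> H [] /[dup] Hg [H1 _] SH; have HM := group_closedM Hg.
have HV := group_closedV Hg.
have [n xn] := h x; suff : x \in mem H by rewrite inE.
move: n x xn; apply: (@shorter_ind S (fun y => y \in mem H)) => // y s yH sS.
have sH : s \in mem H by rewrite inE; exact: SH.
by split; apply: HM => //; exact: HV.
Qed.

Variable R : realType.
Local Notation len S := (word_length R S).

(** The infimum runs over natural numbers, and generation makes their set nonempty. Estimates are
    made on [shorter] and come back to real lengths through this minimum. *)
Lemma word_lengthP S x : generates S -> exists n,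
  [/\ len S x = n%:R, shorter S n x & forall m, shorter S m x -> (n <= m)%N].
Proof.
move=> gS; have [n0 xn0] := generates_shorter x gS.
pose P := fun n => `[< shorter S n x >].
have exP : exists n, P n by exists n0; exact/asboolP.
case: (ex_minnP exP) => n /asboolP xn nmin; exists n.
have nmin' m : shorter S m x -> (n <= m)%N by move=> xm; apply/nmin/asboolP.
split => //.
have [w wx wn] := xn.
have wn' : size w = n by apply/eqP; rewrite eqn_leq wn nmin'//; exists w.
apply/eqP; rewrite eq_le; apply/andP; split.
  apply: ge_inf; last by exists w => //; rewrite wn'.
  by exists 0%R => _ [v _ <-]; exact: ler0n.
apply: lb_le_inf; first by exists (size w)%:R; exists w.
by move=> _ [v vx <-]; rewrite ler_nat; apply: nmin'; exists v.
Qed.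

Lemma word_length_le S n x : generates S -> shorter S n x -> (len S x <= n%:R)%R.
Proof. by move=> gS xn; have [k [-> _ km]] := word_lengthP x gS; rewrite ler_nat km. Qed.

Lemma word_length_ge1 S x : generates S -> x != 1 -> (1 <= len S x)%R.
Proof.
move=> gS x1; have [[|n] [-> xn _]] := word_lengthP x gS; last by rewrite ler1n.
case: xn => -[|//] [_ x1' _]; move: x1; rewrite -x1' big_nil eqxx //.
Qed.

Lemma word_length1 S : generates S -> len S 1 = 0%R.
Proof.
move=> gS; apply/eqP; have [k [-> _ km]] := word_lengthP 1 gS.
by rewrite pnatr_eq0 -leqn0; apply: km; exact: shorter1.
Qed.

Lemma shorter_trans S T : (forall s, s \in S -> exists n, shorter T n s) ->
  exists K, forall n x, shorter S n x -> shorter T (K * n) x.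
Proof.
move=> ST; have [K SK] : exists K, forall s, s \in S -> shorter T K s.
  elim: S ST => [|s S IH] ST; first by exists 0.
  have [t|K SK] := IH; first by move=> tS; apply: ST; rewrite inE tS orbT.
  have [|n sn] := ST s; first by rewrite inE eqxx.
  exists (maxn n K) => t; rewrite inE => /orP[/eqP->|/SK].
    by apply: shorter_le sn; rewrite leq_maxl.
  by apply: shorter_le; rewrite leq_maxr.
exists K => n x [w [wS <-] wn].
apply: (@shorter_le _ (K * size w)); first by rewrite leq_mul2l wn orbT.
elim: w wS {wn} => [|s w IH] wS; first by rewrite big_nil; exact: shorter1.
rewrite big_cons mulnS; apply: shorterM; last first.
  by apply: IH => t tw; apply: wS; rewrite inE tw orbT.
have /wS[/SK//|/SK/shorterV] : s \in s :: w by rewrite inE eqxx.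
by rewrite invgK.
Qed.

Lemma word_length_bilip S T : generates S -> generates T ->
  exists2 C : R, (0 < C)%R & forall x, (len T x <= C * len S x)%R.
Proof.
move=> gS gT; have [s _|K hK] := @shorter_trans S T; first exact: generates_shorter.
(* [K] may be 0, and the constant has to be positive. *)
exists (K.+1%:R)%R => // x; have [n [-> xn _]] := word_lengthP x gS.
rewrite -natrM; apply: word_length_le => //; apply: shorter_le (hK _ _ xn).
by rewrite leq_mul2r leqnSn orbT.
Qed.

End Words.

(** * Compression exponents from estimates in one word metric *)

Section Compression.
Local Open Scope classical_set_scope.
Variables (R : realType) (G : groupType) (S S0 : seq G) (X : normedModType R).
Hypotheses (gS : generates S) (gS0 : generates S0).
Implicit Types (Psi : G -> X) (x y : G).
Local Notation len := (word_length R S0).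

Lemma step_lipschitz Psi (K : R) : 0 <= K ->
  (forall x s, s \in S0 -> `|Psi (x * s)%g - Psi x| <= K) ->
  forall x y, `|Psi x - Psi y| <= K * len (x^-1 * y)%g.
Proof.
move=> K0 HK x y; have [n [-> [w [wS wxy] wn] _]] := word_lengthP R (x^-1 * y)%g gS0.
have -> : y = (x * \prod_(s <- w) s)%g by rewrite wxy mulVKg.
apply: (@le_trans _ _ (K * (size w)%:R)); last by rewrite ler_wpM2l// ler_nat.
elim: w wS {wxy wn} x => [|s w IH] wS x; first by rewrite big_nil mulg1 subrr normr0 mulr0.
rewrite big_cons mulgA /= -natr1 mulrDr mulr1.
rewrite -(subrKA (Psi (x * s)%g)) addrC; apply: (le_trans (ler_normD _ _)).
apply: lerD; first by apply: IH => t tw; apply: wS; rewrite inE tw orbT.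
have /wS[sS|sS] : s \in s :: w by rewrite inE eqxx.
  by rewrite distrC; exact: HK.
by have := HK (x * s)%g _ sS; rewrite mulgK.
Qed.

Lemma step_word_lipschitz Psi (K : R) :
  (forall x s, s \in S0 -> `|Psi (x * s)%g - Psi x| <= K) -> word_lipschitz S Psi.
Proof.
move=> HK; have [C C0 CS] := word_length_bilip R gS gS0.
(* [K] may be negative when [S0] is empty. *)
exists (Num.max K 0 * C) => x y.
have K0 : 0 <= Num.max K 0 by rewrite le_max lexx orbT.
apply: (le_trans (@step_lipschitz Psi _ K0 _ x y)).
  by move=> z s sS; apply: (le_trans (HK z s sS)); rewrite le_max lexx.
by rewrite -mulrA ler_wpM2l.
Qed.

Lemma le_compression_exponent Psi (a c : R) : 0 <= a -> 0 < c ->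
  (forall x y, x != y -> c * (len (x^-1 * y)%g) `^ a <= `|Psi x - Psi y|) ->
  (a%:E <= compression_exponent S Psi)%E.
Proof.
move=> a0 c0 Hc; have [C C0 CS] := word_length_bilip R gS0 gS.
apply: ereal_sup_ubound; exists a => //; split => //.
exists (c * (C `^ a)^-1); split; first by rewrite mulr_gt0// invr_gt0 powR_gt0.
move=> t t1; apply: le_ereal_inf_tmp => _ [x [y [txy ->]]]; rewrite lee_fin.
have xy : x != y.
  apply/eqP => xy; move: txy; rewrite xy mulVg word_length1// => t0.
  by have := lt_le_trans ltr01 (le_trans t1 t0); rewrite ltxx.
apply: le_trans (Hc x y xy).
rewrite -mulrA ler_pM2l// mulrC ler_pdivrMr ?powR_gt0//.
have l0 : 0 <= len (x^-1 * y)%g.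
  by have [n [-> _ _]] := word_lengthP R (x^-1 * y)%g gS0; exact: ler0n.
rewrite -powRM//; last exact: ltW.
apply: ge0_ler_powR => //; rewrite ?nnegrE.
- exact: le_trans t1.
- by rewrite mulr_ge0// ltW.
- by apply: (le_trans txy); rewrite mulrC; exact: CS.
Qed.

(** Passing from [S] to the convenient generators [S0] only changes the constants [L] and [c], so an
    upper bound on exponents becomes a statement on real numbers about one word metric. *)
Lemma alpha_star_le (b : R) :
  (forall Psi (L : R), (forall x y, `|Psi x - Psi y| <= L * len (x^-1 * y)%g) ->
    forall a c : R, 0 <= a -> 0 < c ->
    (forall x y, x != y -> c * (len (x^-1 * y)%g) `^ a <= `|Psi x - Psi y|) ->
    a <= b) ->
  (alpha_star S X <= b%:E)%E.
Proof.
move=> H; apply: ge_ereal_sup => _ [Psi [L HL] <-].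
apply: ge_ereal_sup => _ [a [a0 [c [c0 Hc]]] <-]; rewrite lee_fin.
have [C C0 CS] := word_length_bilip R gS0 gS.
have [D D0 DS] := word_length_bilip R gS gS0.
apply: (H Psi (Num.max L 0 * C) _ a (c * (D `^ a)^-1)) => //.
- move=> x y; apply: (le_trans (HL x y)).
  apply: (@le_trans _ _ (Num.max L 0 * word_length R S (x^-1 * y)%g)).
    apply: ler_wpM2r; last by rewrite le_max lexx.
    by have [n [-> _ _]] := word_lengthP R (x^-1 * y)%g gS; exact: ler0n.
  by rewrite -mulrA ler_wpM2l// le_max lexx orbT.
- by rewrite mulr_gt0// invr_gt0 powR_gt0.
- move=> x y xy.
  have xy1 : (x^-1 * y)%g != 1%g by rewrite mulg_eq1 eqg_inv.
  have l1 := word_length_ge1 R gS xy1.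
  (* The compression function is taken at [t] equal to the distance of [x] and [y] itself. *)
  have := Hc _ l1; set t := word_length _ _ _ => Ht.
  have : ((c * t `^ a)%:E <= (`|Psi x - Psi y|)%:E)%E.
    by apply: (le_trans Ht); apply: ereal_inf_lbound; exists x, y.
  rewrite lee_fin; apply: le_trans.
  rewrite -mulrA ler_pM2l// mulrC ler_pdivrMr ?powR_gt0//.
  have t0 : 0 <= t by exact: le_trans l1.
  have l0 : 0 <= len (x^-1 * y)%g.
    by have [n [-> _ _]] := word_lengthP R (x^-1 * y)%g gS0; exact: ler0n.
  rewrite -powRM//; last exact: ltW.
  apply: ge0_ler_powR => //; rewrite ?nnegrE.
    by rewrite mulr_ge0// ltW.
  by rewrite mulrC; exact: DS.
Qed.

Lemma alpha_sharp_le_star : (alpha_sharp S X <= alpha_star S X)%E.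
Proof.
by apply: ge_ereal_sup => _ [Psi [HL _] <-]; apply: ereal_sup_ubound; exists Psi.
Qed.

(** The supremum need not be attained: it suffices to reach every exponent below [b], by a map that
    may depend on it. [P] is equivariance for [alpha_sharp] and [setT] for [alpha_star]. *)
Lemma le_alpha (P : set (G -> X)) (b : R) : 0 < b ->
  (forall a, 0 <= a -> a < b -> exists (Psi : G -> X), P Psi /\
    (exists K : R, forall x s, s \in S0 -> `|Psi (x * s)%g - Psi x| <= K) /\
    exists2 c : R, 0 < c &
      forall x y, x != y -> c * (len (x^-1 * y)%g) `^ a <= `|Psi x - Psi y|) ->
  (b%:E <= ereal_sup [set compression_exponent S Psi | Psi in
     [set Psi | word_lipschitz S Psi /\ P Psi]])%E.
Proof.
move=> b0 H; apply/lee_addgt0Pr => e e0.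
(* Admissible exponents are nonnegative, so when [b - e] is not positive the exponent 0 takes its
   place. *)
have [ae|ae] := leP (b - e) 0.
  have [Psi [PPsi [[K HK] [c c0 Hc]]]] := H 0 (lexx _) b0.
  have h0 := le_compression_exponent (lexx _) c0 Hc.
  apply: (@le_trans _ _ (0%:E + e%:E)%E); first by rewrite -EFinD lee_fin add0r -subr_le0.
  rewrite leeD2r//; apply: (le_trans h0); apply: ereal_sup_ubound.
  by exists Psi => //; split => //; exact: step_word_lipschitz HK.
have [|Psi [PPsi [[K HK] [c c0 Hc]]]] := H (b - e) (ltW ae).
  by rewrite ltrBlDr ltrDl.
rewrite -leeBlDr// -EFinB.
apply: (le_trans (le_compression_exponent (ltW ae) c0 Hc)); apply: ereal_sup_ubound.
by exists Psi => //; split => //; exact: step_word_lipschitz HK.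
Qed.

End Compression.

(** * Metric cotype 2 for real functions on a finite abelian group *)

Section Cotype.
Variables (R : realType) (V : finZmodType).
Implicit Types (F H : V -> R) (e v : V) (r : seq V).

Let nrm F : R := \sum_x F x ^+ 2.
Let avg e F : V -> R := fun x => (F x + F (x + e)) / 2.
Let avgs r F : V -> R := foldl (fun F e => avg e F) F r.

Fixpoint subset_sums r : seq V :=
  if r is e :: r' then subset_sums r' ++ [seq v + e | v <- subset_sums r'] else [:: 0].

Lemma size_subset_sums r : size (subset_sums r) = (2 ^ size r)%N.
Proof. by elim: r => //= e r IH; rewrite size_cat size_map IH expnS mul2n addnn. Qed.

Let avgsE r F x : avgs r F x = 2^-1 ^+ size r * \sum_(v <- subset_sums r) F (x + v).
Proof.
elim: r F => [|e r IH] F /=; first by rewrite big_seq1 addr0 mul1r.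
rewrite -/(avgs r _) IH big_cat big_map /= -big_split /= exprSr -mulrA; congr (_ * _).
rewrite mulr_sumr; apply: eq_bigr => v _.
by rewrite /avg mulrC -!addrA.
Qed.

Let sum_shift F v : \sum_x F (x + v) = \sum_x F x.
Proof. by rewrite [RHS](reindex_inj (addIr v)). Qed.

Let sumB F H : \sum_x (F x - H x) = \sum_x F x - \sum_x H x.
Proof. by rewrite big_split /= sumrN. Qed.

Let parallelogram e F :
  nrm F = nrm (avg e F) + 4^-1 * nrm (fun x => F (x + e) - F x).
Proof.
rewrite /nrm mulr_sumr -big_split /=.
transitivity (\sum_x (2^-1 * F x ^+ 2 + 2^-1 * F (x + e) ^+ 2)).
  rewrite big_split /= -!mulr_sumr (sum_shift (fun x => F x ^+ 2)).
  lra.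
by apply: eq_bigr => x _; rewrite /avg; lra.
Qed.

Let nrm_ge0 F : 0 <= nrm F. Proof. by apply: sumr_ge0 => x _; exact: sqr_ge0. Qed.

Let nrm_avgs_le r F : nrm (avgs r F) <= nrm F.
Proof.
elim: r F => [//|e r IH] F /=; apply: (le_trans (IH _)).
by rewrite [leRHS](parallelogram e) lerDl mulr_ge0// invr_ge0.
Qed.

Let avgs_diff r F e :
  (fun x => avgs r F (x + e) - avgs r F x) = avgs r (fun x => F (x + e) - F x).
Proof.
apply/funext => x; rewrite !avgsE -mulrBr -sumrB; congr (_ * _).
by apply: eq_bigr => v _; rewrite addrAC.
Qed.

(** By [parallelogram], averaging along [e] loses a quarter of the squared increment along [e]. The
    later averages commute with translations and are contractions, so they do not enlarge that
    increment, and the losses telescope. *)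
Let nrm_diff_avgs r F :
  \sum_(e <- r) nrm (fun x => avgs r F (x + e) - avgs r F x)
    <= 4 * (nrm F - nrm (avgs r F)).
Proof.
elim: r F => [|e r IH] F; first by rewrite big_nil /= subrr mulr0.
rewrite big_cons [nrm F](parallelogram e) /= -/(avgs r _).
have := IH (avg e F).
have : nrm (fun x => avgs r (avg e F) (x + e) - avgs r (avg e F) x)
    <= nrm (fun x => F (x + e) - F x); last by lra.
by rewrite -[avgs r (avg e F)]/(avgs (e :: r) F) avgs_diff; exact: nrm_avgs_le.
Qed.

Let sqr_sum_le n (a : nat -> R) :
  (\sum_(i < n) a i) ^+ 2 <= n%:R * \sum_(i < n) a i ^+ 2.
Proof.
elim: n => [|n IH]; first by rewrite !big_ord0 expr0n mul0r.
rewrite !big_ord_recr /=; set s := \sum_(i < n) a i in IH *.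
set q := \sum_(i < n) _ in IH *.
case: n @s @q IH => [|n] s q IH.
  by rewrite /s /q !big_ord0 !add0r mul1r.
have q0 : 0 <= q by apply: sumr_ge0 => i _; exact: sqr_ge0.
rewrite -[n.+2%:R]natr1; set N : R := n.+1%:R in IH *.
have N0 : 0 < N by rewrite ltr0n.
have : 2 * s * a n.+1 <= q + N * a n.+1 ^+ 2; last by nra.
rewrite -(ler_pM2l N0); have := sqr_ge0 (s - N * a n.+1); nra.
Qed.

Let nrm_iter m e F :
  nrm (fun x => F (x + e *+ m) - F x) <= m%:R ^+ 2 * nrm (fun x => F (x + e) - F x).
Proof.
have tele x : F (x + e *+ m) - F x = \sum_(i < m) (F (x + e *+ i + e) - F (x + e *+ i)).
  elim: m => [|m IH]; first by rewrite big_ord0 mulr0n addr0 subrr.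
  by rewrite big_ord_recr /= -IH mulrSr addrA; lra.
apply: (@le_trans _ _ (\sum_x m%:R *
    \sum_(i < m) (F (x + e *+ i + e) - F (x + e *+ i)) ^+ 2)).
  apply: ler_sum => x _; rewrite tele.
  exact: (@sqr_sum_le m (fun i => F (x + e *+ i + e) - F (x + e *+ i))).
rewrite -mulr_sumr exchange_big /= (expr2 m%:R) -mulrA ler_wpM2l//.
under eq_bigr do rewrite (sum_shift (fun x => (F (x + e) - F x) ^+ 2)).
by rewrite sumr_const card_ord -[X in X <= _]mulr_natl.
Qed.

(** With [H] the iterated average, both sides expand to [2 * nrm F] minus twice the inner product of
    [F] and [H]. *)
Let two_sided r F :
  nrm F - nrm (avgs r F) + nrm (fun x => F x - avgs r F x) =
  2^-1 ^+ size r * \sum_(v <- subset_sums r) nrm (fun x => F (x + v) - F x).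
Proof.
have -> : \sum_(v <- subset_sums r) nrm (fun x => F (x + v) - F x) =
    \sum_(v <- subset_sums r) (2 * nrm F - 2 * \sum_x F x * F (x + v)).
  apply: eq_bigr => v _; rewrite /nrm.
  transitivity (\sum_x (F (x + v) ^+ 2 + (F x ^+ 2 - 2 * (F x * F (x + v))))).
    by apply: eq_bigr => x _; lra.
  rewrite big_split /= (sum_shift (fun x => F x ^+ 2)) sumB -mulr_sumr; lra.
have cst (c : R) : \sum_(v <- subset_sums r) c = 2 ^+ size r * c.
  by rewrite big_const_seq count_predT iter_addr_0 size_subset_sums -natrX mulr_natl.
rewrite big_split /= sumrN cst mulrBr (mulrA (2^-1 ^+ _)) -exprMn mulVf ?pnatr_eq0// expr1n mul1r.
rewrite -mulr_sumr exchange_big /= [X in _ = _ - X]mulrCA.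
have -> : 2^-1 ^+ size r * \sum_i \sum_(v <- subset_sums r) F i * F (i + v) =
    \sum_x F x * avgs r F x.
  by rewrite mulr_sumr; apply: eq_bigr => x _; rewrite avgsE -mulr_sumr mulrCA.
have -> : nrm (fun x => F x - avgs r F x) =
    nrm F + nrm (avgs r F) - 2 * \sum_x F x * avgs r F x.
  rewrite /nrm mulr_sumr -big_split /= -sumrB; apply: eq_bigr => x _; lra.
lra.
Qed.

(* Smoothing over subset sums: Pythagoras splits [F] into its average, whose
   increments telescope along the list, and the error, which is a summand of
   the right-hand side. *)
Lemma cotype2 (m : nat) r F : (size r <= m ^ 2)%N ->
  \sum_(e <- r) \sum_x (F (x + e *+ m) - F x) ^+ 2 <=
  8 * m%:R ^+ 2 * (2^-1 ^+ size r *
    \sum_(v <- subset_sums r) \sum_x (F (x + v) - F x) ^+ 2).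
Proof.
move=> rm; rewrite -(two_sided r F); set H := avgs r F.
pose E := fun x => F x - H x.
have step e : nrm (fun x => F (x + e *+ m) - F x) <=
    2 * m%:R ^+ 2 * nrm (fun x => H (x + e) - H x) + 8 * nrm E.
  apply: (@le_trans _ _ (2 * nrm (fun x => H (x + e *+ m) - H x) +
      4 * (nrm E + nrm E))).
    have -> : nrm E + nrm E = \sum_x E (x + e *+ m) ^+ 2 + nrm E.
      by rewrite (sum_shift (fun x => E x ^+ 2)).
    rewrite /nrm -big_split /= !mulr_sumr -big_split /=; apply: ler_sum => x _.
    rewrite /E; set a := F (x + _); set b := F x; set c := H (x + _); set d := H x.
    have := sqr_ge0 ((c - d) - ((a - c) - (b - d))).
    have := sqr_ge0 ((a - c) + (b - d)); nra.
  have := nrm_iter m e H; lra.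
apply: (@le_trans _ _ (\sum_(e <- r)
   (2 * m%:R ^+ 2 * nrm (fun x => H (x + e) - H x) + 8 * nrm E))).
  by apply: ler_sum => e _; exact: step.
rewrite big_split /= -mulr_sumr big_const_seq count_predT iter_addr_0 -mulr_natr.
have := nrm_diff_avgs r F; rewrite -/H => h1.
(* This is where the number of directions matters: the error contributes [8 * size r] times its
   norm, against the [8 * m ^ 2] of the telescoped increments of [H]. *)
have h2 : (size r)%:R <= m%:R ^+ 2 :> R by rewrite -natrX ler_nat.
have h3 := nrm_ge0 E.
have h4 : 0 <= m%:R ^+ 2 :> R by exact: sqr_ge0.
have := ler_wpM2l h4 h1; have := ler_wpM2l h3 h2; rewrite -/E; lra.
Qed.

End Cotype.

(** * From exponent 2 to exponents below 2, by sums of chords at dyadic scales *)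

Section Snowflake.
Variable R : realType.
Implicit Types (t u p : R).

Lemma norm_sin_le u : `|sin u| <= `|u|.
Proof.
wlog u0 : u / 0 <= u => [H|].
  have [/H//|/ltW u0] := leP 0 u.
  by rewrite -normrN -sinN -[leRHS]normrN; apply: H; rewrite oppr_ge0.
have [c _] := @MVT_segment R sin cos 0 u u0 (fun x _ => is_derive_sin x)
  (continuous_subspaceT (@continuous_sin R)).
rewrite sin0 !subr0 => ->; rewrite normrM ler_piMl//; exact: cos_max.
Qed.

Lemma chord_le_sqr u : 2 - 2 * cos u <= u ^+ 2.
Proof.
have -> : cos u = cos ((u / 2) *+ 2) by rewrite -mulr_natr divfK.
rewrite cos_mulr2n cos2sin2.
have : sin (u / 2) ^+ 2 <= (u / 2) ^+ 2.
  by rewrite -real_normK ?num_real// -[leRHS]real_normK ?num_real// lerXn2r ?nnegrE// norm_sin_le.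
by rewrite expr_div_n; lra.
Qed.

Lemma chord_le4 u : 2 - 2 * cos u <= 4.
Proof. have := cos_geN1 u; lra. Qed.

Lemma chord_ge0 u : 0 <= 2 - 2 * cos u.
Proof. have := cos_le1 u; lra. Qed.

Lemma cos1_lt1 : cos 1 < 1 :> R.
Proof.
have := pi_ge2 R => pi2.
by rewrite -{2}cos0 ltr_cos ?ltr01// in_itv /= ?lexx ?ler01 ?pi_ge0//=; lra.
Qed.

Lemma chord_ge_cos1 u : 1 <= u <= 2 -> 2 - 2 * cos 1 <= 2 - 2 * cos u.
Proof.
have := pi_ge2 R => pi2 /andP[u1 u2].
suff : cos u <= cos 1 by lra.
rewrite leNgt ltr_cos -?leNgt// in_itv /=; apply/andP; split; lra.
Qed.

(** Up to the index where [a] and [b] cross the terms are dominated by a growing geometric series,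
    beyond it by a decaying one; each sums to at most [B / (1 - rho)]. *)
Lemma sum_min_geometric (a b : nat -> R) (rho B : R) (n : nat) :
  0 < rho < 1 -> (forall i, 0 <= a i) -> (forall i, 0 <= b i) ->
  (forall i, a i <= rho * a i.+1) -> (forall i, b i.+1 <= rho * b i) ->
  (forall i, Num.min (a i) (b i) <= B) ->
  \sum_(i < n) Num.min (a i) (b i) <= 2 * B / (1 - rho).
Proof.
move=> /andP[r0 r1] a0 b0 Ha Hb HB.
have rr : 0 < 1 - rho by lra.
have B0 : 0 <= B by apply: le_trans (HB 0%N); rewrite le_min a0 b0.
case: n => [|n]; first by rewrite big_ord0 divr_ge0 ?mulr_ge0// ltW.
rewrite ler_pdivlMr//.
(* The invariant has two phases: before the crossing the last term controls the partial sum, after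
   it [rho * b n] keeps room for the geometric tail still to come. *)
have : if a n <= b n then (\sum_(i < n.+1) Num.min (a i) (b i)) * (1 - rho) <= a n
  else (\sum_(i < n.+1) Num.min (a i) (b i)) * (1 - rho) <= 2 * B - rho * b n.
  elim: n => [|n IH].
    rewrite big_ord_recr big_ord0 /= add0r.
    have := HB 0%N; rewrite /Num.min; case: ltgtP => h; have := a0 0%N; have := b0 0%N; nra.
  rewrite big_ord_recr /= mulrDl; set s := \sum_(i < _) _ in IH *.
  have An := Ha n; have Bn := Hb n; have Hn := HB n; have Hn1 := HB n.+1.
  have an0 := a0 n; have bn0 := b0 n; have an1 := a0 n.+1; have bn1 := b0 n.+1.
  case: (leP (a n.+1) (b n.+1)) IH Hn1 => h1; case: (leP (a n) (b n)) Hn => h0 Hn IH Hn1.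
  - nra.
  - nra.
  - nra.
  - nra.
have An := HB n; have bn0 := b0 n.
case: (leP (a n) (b n)) An => h0 An; first by lra.
by move=> h; apply: (le_trans h); nra.
Qed.

Section Kernel.
Variables (p : R) (p1 : 1 <= p) (p2 : p < 2).
Let scale N i : R := 2 ^+ i / 2 ^+ N.
(** A truncated dyadic version of the formula expressing [|t| ^ p], up to a constant, as the
    integral over [s > 0] of [(1 - cos (s t)) / s ^ (1 + p)]. The scales run from [2 ^ -N]
    upwards. *)
Let kernel N n t : R :=
  \sum_(i < n) (scale N i `^ p)^-1 * (2 - 2 * cos (scale N i * t)).

Let scale_gt0 N i : 0 < scale N i.
Proof. by rewrite divr_gt0// exprn_gt0. Qed.

Let scaleS N i : scale N i.+1 = 2 * scale N i.
Proof. by rewrite /scale exprS mulrA. Qed.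

Let p_neq0 : p != 0.
Proof. by rewrite gt_eqF// (lt_le_trans ltr01). Qed.

Let pow2p_ge2 : 2 <= 2 `^ p :> R.
Proof. by apply: le1r_powR => //; rewrite ler1n. Qed.

Lemma pow2p_lt4 : 2 `^ p < 4 :> R.
Proof.
have <- : 2 `^ 2 = 4 :> R by rewrite powR_mulrn// expr2 -natrM.
by rewrite lt_neqAle ler_powR ?ler1n ?(ltW p2)// andbT; apply/eqP => /(congr1 (@ln R));
  rewrite !ln_powR => /mulIf; have l2 : ln 2 != 0 :> R by [rewrite gt_eqF// ln_gt0// ltr1n];
  move=> /(_ l2) E; move: p2; rewrite E ltxx.
Qed.

(** A squared chord is at most [u ^ 2] and at most 4. Weighted, the first bound grows by
    [4 / 2 ^ p > 1] per scale because [p < 2], the second decays by [2 ^ -p]; the ratio [2 ^ p / 4]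
    serves both because [p >= 1]. *)
Lemma kernel_le N n t : kernel N n t <= 8 / (1 - 2 `^ p / 4) * `|t| `^ p.
Proof.
have r1 : 0 < 2 `^ p / 4 < 1 by have := pow2p_ge2; have := pow2p_lt4; lra.
pose a i := (scale N i `^ p)^-1 * (scale N i * t) ^+ 2.
pose b i := (scale N i `^ p)^-1 * 4.
have sp i : 0 < (scale N i `^ p)^-1 by rewrite invr_gt0 powR_gt0.
have spS i : (scale N i.+1 `^ p)^-1 = (2 `^ p)^-1 * (scale N i `^ p)^-1.
  by rewrite scaleS powRM ?(ltW (scale_gt0 _ _))// invfM.
have pp : 0 < 2 `^ p :> R by rewrite powR_gt0.
apply: (@le_trans _ _ (\sum_(i < n) Num.min (a i) (b i))).
  apply: ler_sum => i _; rewrite le_min /a /b !ler_pM2l// chord_le_sqr.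
  exact: chord_le4.
have -> : 8 / (1 - 2 `^ p / 4) * `|t| `^ p = 2 * (4 * `|t| `^ p) / (1 - 2 `^ p / 4).
  by rewrite mulrAC mulrA -natrM.
apply: sum_min_geometric => //.
- by move=> i; rewrite mulr_ge0 ?sqr_ge0// ltW.
- by move=> i; rewrite mulr_ge0// ltW.
- move=> i; rewrite /a spS scaleS.
  have -> : (2 * scale N i * t) ^+ 2 = 4 * (scale N i * t) ^+ 2 by lra.
  set u := (scale N i * t) ^+ 2; set w := (_ `^ p)^-1; set v := 2 `^ p in pp *.
  have -> : v / 4 * (v^-1 * w * (4 * u)) = (v * v^-1) * (w * u) by lra.
  by rewrite divff ?gt_eqF// mul1r.
- move=> i; rewrite /b spS -mulrA ler_wpM2r//; first by rewrite mulr_ge0// ltW.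
  by rewrite -[leLHS]mul1r ler_pdivrMr//; have := pow2p_ge2; nra.
- move=> i; have [t0|t0] := eqVneq t 0.
    by rewrite /a t0 normr0 powR0// !mulr0 ge_min expr2 !mulr0 lexx.
  have nt : 0 < `|t| by rewrite normr_gt0.
  set s := scale N i; have s0 : 0 < s by exact: scale_gt0.
  have E : (s `^ p)^-1 * (s * `|t|) `^ p = `|t| `^ p.
    by rewrite powRM ?ltW// mulrA mulVf ?mul1r// gt_eqF// powR_gt0.
  have [h|h] := leP (s * `|t|) 1; rewrite ge_min; apply/orP; [left|right].
    rewrite /a -/s -real_normK ?num_real// normrM (gtr0_norm s0).
    apply: (@le_trans _ _ (`|t| `^ p)); last by rewrite ler_peMl ?powR_ge0// ler1n.
    rewrite -E ler_pM2l; last by rewrite invr_gt0 powR_gt0.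
    rewrite -powR_mulrn; last by rewrite mulr_ge0// ltW.
    by apply: ger_powR; [rewrite mulr_gt0|exact: ltW].
  rewrite /b -/s mulrC ler_pM2l// -E ler_peMr ?invr_ge0 ?powR_ge0//.
  by apply: (le_trans (ltW h)); apply: le1r_powR => //; exact: ltW.
Qed.

(** All terms are nonnegative, and a single one suffices: the scale that brings [|t|] into the
    interval from 1 to 2. *)
Lemma kernel_ge N n t i : (i < n)%N -> 1 <= scale N i * `|t| <= 2 ->
  (2 - 2 * cos 1) / 4 * `|t| `^ p <= kernel N n t.
Proof.
move=> ni /andP[h1 h2]; set s := scale N i in h1 h2.
have s0 : 0 < s by exact: scale_gt0.
rewrite /kernel (bigD1 (Ordinal ni))//=.
apply: (@le_trans _ _ ((s `^ p)^-1 * (2 - 2 * cos (s * t)))); last first.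
  rewrite lerDl sumr_ge0// => j _; rewrite mulr_ge0 ?chord_ge0// invr_ge0 powR_ge0//.
have -> : cos (s * t) = cos (s * `|t|).
  by rewrite -[in RHS](gtr0_norm s0) -normrM cos_norm.
apply: (@le_trans _ _ ((s `^ p)^-1 * (2 - 2 * cos 1))); last first.
  by rewrite ler_wpM2l ?invr_ge0 ?powR_ge0// chord_ge_cos1// h1.
have W4 : s `^ p * `|t| `^ p <= 4.
  rewrite -powRM ?(ltW s0)//; apply: (@le_trans _ _ (2 `^ p)); last exact: ltW pow2p_lt4.
  by rewrite ge0_ler_powR ?nnegrE ?(le_trans _ h1)// (le_trans _ p1).
rewrite [leRHS]mulrC ler_pdivlMr ?powR_gt0//.
have := chord_ge0 1; set A := 2 - 2 * cos 1; nra.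
Qed.

Lemma dyadic_scale N t : 2 ^- N <= `|t| <= 2 ^+ N ->
  exists2 i, (i < N.*2.+1)%N & 1 <= scale N i * `|t| <= 2.
Proof.
move=> /andP[h1 h2]; have e2 : 0 < 2 ^+ N :> R by rewrite exprn_gt0.
have ex : exists i, 1 <= scale N i * `|t|.
  exists N.*2; rewrite /scale -addnn exprD mulfK ?gt_eqF//.
  by rewrite mulrC -ler_pdivrMr// mul1r.
case: (ex_minnP ex) => i hi imin; exists i.
  rewrite ltnS; apply: imin; rewrite /scale -addnn exprD mulfK ?gt_eqF//.
  by rewrite mulrC -ler_pdivrMr// mul1r.
rewrite hi /=; case: i hi imin => [|i] hi imin.
  rewrite /scale expr0 div1r mulrC ler_pdivrMr//; apply: (le_trans h2).
  by rewrite ler_peMl ?(ltW e2)// ler1n.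
rewrite scaleS -mulrA -[leRHS]mulr1 ler_pM2l// leNgt; apply/negP => /ltW /imin.
by rewrite ltnn.
Qed.

End Kernel.

Lemma powR2_sqr t : `|t| `^ 2 = t ^+ 2.
Proof. by rewrite powR_mulrn// real_normK ?num_real. Qed.

Section Cotype_p.
Variable V : finZmodType.

Lemma chord_cosB (F : V -> R) s x y :
  (cos (s * F x) - cos (s * F y)) ^+ 2 + (sin (s * F x) - sin (s * F y)) ^+ 2 =
  2 - 2 * cos (s * (F x - F y)).
Proof.
rewrite mulrBr cosB; set a := s * F x; set b := s * F y.
have := cos2Dsin2 a; have := cos2Dsin2 b; nra.
Qed.

End Cotype_p.

(* For [p < 2] the kernel [|t| ^ p] is comparable with a positive combination of
   the kernels [2 - 2 cos (2 ^ i t)], each of which is the square of a distance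
   in the plane. *)
Lemma cotype_p p : 1 <= p <= 2 -> exists2 C : R, 0 < C &
  forall (V : finZmodType) (m : nat) (r : seq V) (F : V -> R), (size r <= m ^ 2)%N ->
  \sum_(e <- r) \sum_x `|F (x + e *+ m) - F x| `^ p <=
  C * m%:R ^+ 2 * (2^-1 ^+ size r *
    \sum_(v <- subset_sums r) \sum_x `|F (x + v) - F x| `^ p).
Proof.
move=> /andP[p1]; rewrite le_eqVlt => /orP[/eqP->|p2].
  exists 8 => // V m r F rm; under eq_bigr do under eq_bigr do rewrite powR2_sqr.
  under [in leRHS]eq_bigr do under eq_bigr do rewrite powR2_sqr.
  exact: cotype2.
pose c : R := (2 - 2 * cos 1) / 4.
have c0 : 0 < c by have := cos1_lt1; rewrite /c; lra.
pose D : R := 8 / (1 - 2 `^ p / 4).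
have D0 : 0 < D by rewrite divr_gt0//; have := pow2p_lt4 p2; lra.
exists (c^-1 * (8 * D)); first by rewrite mulr_gt0 ?invr_gt0// mulr_gt0.
move=> V m r F rm.
(* [B] dominates all differences of values of [F] and their inverses, so finitely many scales see
   every nonzero difference. [N] depends on [F], but the constants [c] and [D] do not. *)
pose B : R := \sum_x \sum_y (`|F x - F y| + `|F x - F y|^-1).
have HB x y : `|F x - F y| + `|F x - F y|^-1 <= B.
  have h (a b : V) : 0 <= `|F a - F b| + `|F a - F b|^-1 by rewrite addr_ge0// invr_ge0.
  rewrite /B (bigD1 x)//= (bigD1 y)//= -addrA lerDl addr_ge0//; apply: sumr_ge0 => z _ //.
  exact: sumr_ge0.
have [N BN] : exists N, B <= 2 ^+ N.
  exists (Num.truncn B).+1; apply: (le_trans (ltW (truncnS_gt B))).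
  by rewrite -natrX ler_nat ltnW// ltn_expl.
pose K t := \sum_(i < N.*2.+1) (((2 ^+ i / 2 ^+ N) `^ p)^-1 *
   (2 - 2 * cos ((2 ^+ i / 2 ^+ N) * t))) : R.
have Kge x y : c * `|F x - F y| `^ p <= K (F x - F y).
  have [->|xy] := eqVneq (F x) (F y).
    rewrite /K subrr normr0 powR0 ?gt_eqF ?(lt_le_trans ltr01)// mulr0 sumr_ge0// => i _.
  have t0 : 0 < `|F x - F y| by rewrite normr_gt0 subr_eq0.
  have [|i iN hi] := @dyadic_scale N (F x - F y); last exact: kernel_ge hi.
  have := HB x y; have : 0 < `|F x - F y|^-1 by rewrite invr_gt0.
  move=> ti hB; apply/andP; split; last by lra.
  rewrite -[leRHS]invrK lef_pV2 ?posrE ?exprn_gt0//; lra.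
have Kle t : K t <= D * `|t| `^ p by exact: kernel_le.
have KQ : \sum_(e <- r) \sum_x K (F (x + e *+ m) - F x) <=
  8 * m%:R ^+ 2 * (2^-1 ^+ size r *
    \sum_(v <- subset_sums r) \sum_x K (F (x + v) - F x)).
  rewrite /K; under eq_bigr do rewrite exchange_big.
  rewrite exchange_big /= [in leRHS](eq_bigr (fun v =>
    \sum_(i < N.*2.+1) \sum_x ((2 ^+ i / 2 ^+ N) `^ p)^-1 *
     (2 - 2 * cos (2 ^+ i / 2 ^+ N * (F (x + v) - F x))))); last first.
    by move=> v _; rewrite exchange_big.
  rewrite [in leRHS]exchange_big /= !mulr_sumr; apply: ler_sum => i _.
  set s := 2 ^+ i / 2 ^+ N; set w := (s `^ p)^-1.
  have w0 : 0 <= w by rewrite invr_ge0 powR_ge0.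
  under eq_bigr do rewrite -mulr_sumr.
  under [in leRHS]eq_bigr do rewrite -mulr_sumr.
  rewrite -!mulr_sumr [X in _ <= _ * X]mulrCA [leRHS]mulrCA ler_wpM2l//.
  have split_chord (u : V) : \sum_x (2 - 2 * cos (s * (F (x + u) - F x))) =
      \sum_x (cos (s * F (x + u)) - cos (s * F x)) ^+ 2 +
      \sum_x (sin (s * F (x + u)) - sin (s * F x)) ^+ 2.
    by rewrite -big_split /=; apply: eq_bigr => x _; rewrite (chord_cosB F).
  under eq_bigr do rewrite split_chord.
  under [in leRHS]eq_bigr do rewrite split_chord.
  rewrite !big_split /= !mulrDr lerD//.
    exact: (@cotype2 R V m r (fun x => cos (s * F x))).
  exact: (@cotype2 R V m r (fun x => sin (s * F x))).
rewrite -[c^-1 * _ * _]mulrA -[c^-1 * _ * _]mulrA ler_pdivlMl// mulr_sumr.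
apply: (@le_trans _ _ (\sum_(e <- r) \sum_x K (F (x + e *+ m) - F x))).
  by apply: ler_sum => e _; rewrite mulr_sumr; apply: ler_sum => x _.
apply: (le_trans KQ).
have hS : \sum_(v <- subset_sums r) \sum_x K (F (x + v) - F x) <=
    D * \sum_(v <- subset_sums r) \sum_x `|F (x + v) - F x| `^ p.
  rewrite mulr_sumr; apply: ler_sum => v _.
  by rewrite mulr_sumr; apply: ler_sum => x _.
have : 0 <= 8 * m%:R ^+ 2 * 2^-1 ^+ size r :> R.
  by rewrite mulr_ge0 ?mulr_ge0 ?sqr_ge0 ?exprn_ge0 ?invr_ge0.
by move=> /ler_wpM2l /(_ _ _ hS); lra.
Qed.

End Snowflake.

(** * Computing norms in L_p through representatives *)

Section Lp01_functions.
Variables (R : realType) (p : R) (p1 : 1 <= p).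
Local Notation mu := (lebesgue01 R).
Local Notation X := (Lp01 p1).
Local Notation p1E := (etrans (lee_fin 1 p) p1).
Local Notation mfun_R f := (measurable_fun [set: measurableTypeR R] (f : measurableTypeR R -> measurableTypeR R)).
Implicit Types (f g : R -> R).

Definition pint f : \bar R := (\int[mu]_x (`|f x| `^ p)%:E)%E.

Definition is_Lp f := mfun_R f /\ (pint f < +oo)%E.

Let p0 : p != 0. Proof. by rewrite gt_eqF// (lt_le_trans ltr01). Qed.

Lemma measurable_norm_powR f : mfun_R f ->
  measurable_fun [set: measurableTypeR R] (fun x : measurableTypeR R => `|f x| `^ p).
Proof.
move=> mf; apply: (measurableT_comp (measurable_powR _)) => //.
exact: measurableT_comp.
Qed.

Lemma pintE f : pint f = (Lnorm mu p%:E (EFin \o f) `^ p)%E.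
Proof. by rewrite (@poweR_Lnorm _ _ _ mu (EFin \o f) p p0). Qed.

Lemma is_LpP f : is_Lp f <-> f \in Lfun mu p%:E.
Proof.
split => [[mf If]|].
  apply/andP; split; rewrite inE //=.
  rewrite /finite_norm; move: If; rewrite pintE.
  have := Lnorm_ge0 mu p%:E (EFin \o f); case: (Lnorm _ _ _) => [r|//|//].
    by move=> _ _; rewrite ltry.
  by move=> _; rewrite poweRyr//.
move=> /andP[]; rewrite inE /= inE /= /finite_norm => mf If; split => //.
rewrite pintE; have := Lnorm_ge0 mu p%:E (EFin \o f).
by case: (Lnorm _ _ _) If => [r|//|//] _ _; rewrite poweR_EFin ltry.
Qed.

(** Made total by the value 0 off L_p, so that formulas need not carry proofs of integrability. *)
Definition to_Lp f : X :=
  if pselect (f \in Lfun mu p%:E) is left h then Lspace_class (Lfun_Sub p1E h) else 0.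

Lemma to_LpE f (h : f \in Lfun mu p%:E) : to_Lp f = Lspace_class (Lfun_Sub p1E h).
Proof.
rewrite /to_Lp; case: pselect => [h'|//].
by rewrite (Prop_irrelevance h h').
Qed.

Lemma norm_to_Lp f : is_Lp f -> (`|to_Lp f| `^ p)%:E = pint f.
Proof.
move=> /is_LpP h; rewrite to_LpE [in LHS]/Num.norm /= Lspace_normE.
by rewrite -poweR_EFin finite_norm_fine pintE.
Qed.

Let repr_is_Lp (F : X) : (Lspace_repr F : R -> R) \in Lfun mu p%:E.
Proof. exact: LfunP. Qed.

Lemma is_Lp_repr (F : X) : is_Lp (Lspace_repr F).
Proof. exact/is_LpP/repr_is_Lp. Qed.

Lemma to_Lp_repr (F : X) : to_Lp (Lspace_repr F) = F.
Proof.
rewrite (to_LpE (repr_is_Lp F)) -[RHS]Lspace_reprK; congr Lspace_class.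
by apply/LfuneqP => x.
Qed.

Lemma to_LpD f g : is_Lp f -> is_Lp g ->
  is_Lp (f \+ g) /\ to_Lp (f \+ g) = to_Lp f + to_Lp g.
Proof.
move=> /is_LpP hf /is_LpP hg.
have hfg : f \+ g \in Lfun mu p%:E.
  exact: (LfunP (Lfun_Sub p1E hf + Lfun_Sub p1E hg)).
split; first exact/is_LpP.
rewrite (to_LpE hf) (to_LpE hg) (to_LpE hfg).
transitivity (Lspace_add (Lspace_class (Lfun_Sub p1E hf)) (Lspace_class (Lfun_Sub p1E hg))) => //.
by rewrite Lspace_addE; congr Lspace_class; apply/LfuneqP => x.
Qed.

Lemma to_LpZ a f : is_Lp f ->
  is_Lp (fun x => a * f x) /\ to_Lp (fun x => a * f x) = a *: to_Lp f.
Proof.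
move=> /is_LpP hf; have haf : (fun x => a * f x) \in Lfun mu p%:E.
  exact: (LfunP (a *: Lfun_Sub p1E hf)).
split; first exact/is_LpP.
rewrite (to_LpE hf) (to_LpE haf).
transitivity (Lspace_scale a (Lspace_class (Lfun_Sub p1E hf))) => //.
by rewrite Lspace_scaleE; congr Lspace_class; apply/LfuneqP => x.
Qed.

Lemma to_LpB f g : is_Lp f -> is_Lp g ->
  is_Lp (f \- g) /\ to_Lp (f \- g) = to_Lp f - to_Lp g.
Proof.
move=> hf hg; have [hNg NgE] := to_LpZ (-1) hg; have [h E] := to_LpD hf hNg.
have fE : f \- g = f \+ (fun x => -1 * g x) by apply/funext => x /=; rewrite mulN1r.
by rewrite fE; split => //; rewrite E NgE scaleN1r.
Qed.

Lemma norm_Lp_eq (F : X) : (`|F| `^ p)%:E = pint (Lspace_repr F).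
Proof. by rewrite -[in LHS](to_Lp_repr F) norm_to_Lp//; exact: is_Lp_repr. Qed.

Lemma norm_LpB (F G : X) :
  (`|F - G| `^ p)%:E = pint (fun x => Lspace_repr F x - Lspace_repr G x).
Proof.
have [h E] := to_LpB (is_Lp_repr F) (is_Lp_repr G).
by rewrite -[in LHS](to_Lp_repr F) -[in LHS](to_Lp_repr G) -E norm_to_Lp.
Qed.

Lemma is_Lp0 : is_Lp (fun=> 0).
Proof.
split; first exact: measurable_cst.
by rewrite /pint integral0_eq// => x _; rewrite normr0 powR0.
Qed.

Lemma to_Lp_eq f g : is_Lp f -> is_Lp g -> pint (f \- g) = 0%E -> to_Lp f = to_Lp g.
Proof.
move=> hf hg fg0; have [h E] := to_LpB hf hg.
apply/eqP; rewrite -subr_eq0 -normr_eq0 -E.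
have := norm_to_Lp h; rewrite fg0 => -[/eqP]; rewrite powR_eq0.
by case/andP.
Qed.

End Lp01_functions.

(** * The cotype inequality for functions with values in L_p *)

Section Cotype_Lp.
Variables (R : realType).

Lemma cotype_Lp (p : R) (p1 : 1 <= p) : p <= 2 -> exists2 C : R, 0 < C &
  forall (V : finZmodType) (m : nat) (r : seq V) (F : V -> Lp01 p1), (size r <= m ^ 2)%N ->
  \sum_(e <- r) \sum_x `|F (x + e *+ m) - F x| `^ p <=
  C * m%:R ^+ 2 * (2^-1 ^+ size r *
    \sum_(v <- subset_sums r) \sum_x `|F (x + v) - F x| `^ p).
Proof.
move=> p2; have [|C C0 HC] := @cotype_p R p; first by rewrite p1.
exists C => // V m r F rm.
have EFinI (a b : R) : (a%:E <= b%:E)%E -> a <= b by rewrite lee_fin.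
have EFin_le (a b : R) : a <= b -> (a%:E <= b%:E)%E by rewrite lee_fin.
have mF x y : measurable_fun [set: measurableTypeR R]
    (fun w : measurableTypeR R => (`|Lspace_repr (F x) w - Lspace_repr (F y) w| `^ p)%:E).
  have [[mfg _] _] := to_LpB p1 (is_Lp_repr (F x)) (is_Lp_repr (F y)).
  apply/measurable_EFinP.
  exact: (@measurable_norm_powR R p (Lspace_repr (F x) \- Lspace_repr (F y)) mfg).
have sumE (s : seq V) (u : V -> V) :
    (\sum_(e <- s) \sum_x `|F (x + u e) - F x| `^ p)%:E =
    (\int[lebesgue01 R]_w (\sum_(e <- s) \sum_x
       `|Lspace_repr (F (x + u e)) w - Lspace_repr (F x) w| `^ p)%:E)%E.
  under eq_integral do rewrite -sumEFin.
  under eq_integral do under eq_bigr do rewrite -sumEFin.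
  rewrite ge0_integral_sum//; first last.
    by move=> e w _; apply: sume_ge0 => x _; exact/EFin_le/powR_ge0.
    by move=> e; exact: emeasurable_sum.
  rewrite -sumEFin; apply: eq_bigr => e _.
  rewrite ge0_integral_sum//.
  by rewrite -sumEFin; apply: eq_bigr => x _; rewrite norm_LpB.
apply: EFinI; rewrite [X in (_ <= (X)%:E)%E]mulrA [X in (_ <= X)%E]EFinM !sumE.
have msum (s : seq V) (u : V -> V) : measurable_fun [set: measurableTypeR R]
   (fun w : measurableTypeR R => (\sum_(e <- s) \sum_x
       `|Lspace_repr (F (x + u e)) w - Lspace_repr (F x) w| `^ p)%:E).
  under eq_fun do rewrite -sumEFin.
  under eq_fun do under eq_bigr do rewrite -sumEFin.
  by apply: emeasurable_sum => e; exact: emeasurable_sum.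
have sum0 (s : seq V) (u : V -> V) w : (0 <= (\sum_(e <- s) \sum_x
       `|Lspace_repr (F (x + u e)) w - Lspace_repr (F x) w| `^ p)%:E)%E.
  by apply: EFin_le; do 2 apply: sumr_ge0 => ? _; exact: powR_ge0.
have c0 : 0 <= C * m%:R ^+ 2 * 2^-1 ^+ size r.
  by rewrite !mulr_ge0 ?exprn_ge0 ?invr_ge0// ltW.
rewrite -ge0_integralZl//.
apply: ge0_le_integral => //.
- by apply: measurable_funeM.
- move=> w _; rewrite -EFinM; apply: EFin_le; rewrite -[leRHS]mulrA.
  exact: (HC V m r (fun x => Lspace_repr (F x) w) rm).
Qed.

End Cotype_Lp.

(** * Dyadic blocks: l_p inside L_p, and isometries permuting its coordinates *)

Section Blocks.
Local Open Scope classical_set_scope.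
Variables (R : realType).
Local Notation T := (measurableTypeR R).
Local Notation leb := (@lebesgue_measure R).

(** Cutting the half-open unit interval into dyadic blocks makes L_p an l_p-sum of copies of one
    space: permutations of the blocks act by linear isometries, and functions constant on the blocks
    form a copy of l_p. *)
Definition blk (i : nat) : set T := `]2 ^- i.+1, 2 ^- i]%classic.
Definition blocks : set T := \bigcup_i blk i.
Definition bidx (x : R) : nat := xget 0%N [set i | blk i x].
(** The factor of the dilation carrying [blk i] onto [blk j], see [scale_blk]. *)
Definition ratio (i j : nat) : R := 2 ^+ i / 2 ^+ j.

Lemma ratio_gt0 i j : 0 < ratio i j.
Proof. by rewrite divr_gt0// exprn_gt0. Qed.

Lemma ratio_trans i j k : ratio i j * ratio j k = ratio i k.
Proof. by rewrite /ratio mulrA divfK// gt_eqF// exprn_gt0. Qed.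

Lemma ratio_id i : ratio i i = 1.
Proof. by rewrite /ratio divff// gt_eqF// exprn_gt0. Qed.

Lemma blkP i (x : R) : blk i x <-> 2 ^- i.+1 < x <= 2 ^- i.
Proof. by rewrite /blk /= in_itv. Qed.

Lemma measurable_blk i : measurable (blk i).
Proof. exact: measurable_itv. Qed.

Lemma measurable_blocks : measurable blocks.
Proof. by apply: bigcup_measurable => i _; exact: measurable_blk. Qed.

Lemma blk_inj i j x : blk i x -> blk j x -> i = j.
Proof.
wlog : i j / (i <= j)%N => [H|]; first by case: (leqP i j) => [/H//|/ltnW/H] h /h /[apply].
rewrite leq_eqVlt => /orP[/eqP//|ij] /blkP/andP[h1 _] /blkP/andP[_ h2].
have := lt_le_trans h1 h2; rewrite ltf_pV2 ?posrE ?exprn_gt0//.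
by rewrite ltr_eXn2l ?ltr1n// ltnS leqNgt ij.
Qed.

Lemma bidxE i x : blk i x -> bidx x = i.
Proof.
by move=> ix; rewrite /bidx; case: xgetP => [j _ /= jx|/(_ i)//]; exact: blk_inj jx ix.
Qed.

Lemma trivIset_blk : trivIset [set: nat] blk.
Proof. by move=> i j _ _ [x [/blk_inj]]; apply. Qed.

Lemma blocksE : blocks = `]0, 1]%classic.
Proof.
apply/seteqP; split => x.
  move=> [i _ /blkP/andP[h1 h2]]; rewrite /= in_itv /=; apply/andP; split.
    by apply: lt_trans h1; rewrite invr_gt0 exprn_gt0.
  by apply: (le_trans h2); rewrite invf_le1 ?exprn_gt0// exprn_ege1// ler1n.
rewrite /= in_itv /= => /andP[x0 x1].
have ex : exists i, 2 ^- i.+1 < x.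
  exists (Num.truncn x^-1).+1; rewrite -[ltRHS]invrK ltf_pV2 ?posrE ?exprn_gt0 ?invr_gt0//.
  apply: (lt_le_trans (truncnS_gt _)); rewrite -natrX ler_nat.
  by apply: (leq_trans (ltnW (ltn_expl _ (ltnSn 1)))); rewrite leq_exp2l.
case: (ex_minnP ex) => i hi imin; exists i => //; apply/blkP; rewrite hi /=.
case: i hi imin => [|i] hi imin; first by rewrite expr0 invr1.
by rewrite leNgt; apply/negP => /imin; rewrite ltnn.
Qed.

Lemma scale_blk i j x : blk (i) (ratio j i * x) <-> blk j x.
Proof.
rewrite !blkP; have c0 := ratio_gt0 j i.
have E k : 2 ^- (k + i) = ratio j i * 2 ^- (k + j) :> R.
  rewrite /ratio !exprD !invfM; set u := 2 ^+ j; set v := u^-1.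
  have uv : u * v = 1 by rewrite divff// gt_eqF// exprn_gt0.
  set w := (2 ^+ k)^-1; set z := (2 ^+ i)^-1.
  by have -> : u * z * (w * v) = (u * v) * (w * z) by [lra]; rewrite uv mul1r.
have := E 0%N; have := E 1%N; rewrite !add0n !add1n => -> ->.
by rewrite ltr_pM2l// ler_pM2l.
Qed.

(** Lebesgue measure equals [c] times its image under multiplication by [c], since both agree on
    half-open intervals; the rest is integration against a pushforward. *)
Lemma integral_blk_scale (h : T -> \bar R) i j : measurable_fun setT h ->
  (forall x, 0 <= h x)%E ->
  (\int[leb]_(x in blk j) ((ratio j i)%:E * h (ratio j i * x)%R) =
   \int[leb]_(x in blk i) h x)%E.
Proof.
move=> mh h0; set c := ratio j i; have c0 : 0 < c := ratio_gt0 _ _.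
have mc : measurable_fun [set: T] (fun x : T => c * x : T).
  exact: measurable_funM.
pose nu0 := mscale (NngNum (ltW c0)) (pushforward leb (fun x : T => c * x : T)).
pose nu := nu0 mc.
have nuE A : measurable A -> leb A = nu A.
  apply: lebesgue_measure_unique => _ [[a b]] _ <-.
  change (leb `]a, b]%classic = c%:E * leb ((fun x : T => (c * x)%R : T) @^-1` `]a, b]%classic))%E.
  rewrite (_ : _ @^-1` _ = `]a / c, b / c]%classic); last first.
    apply/seteqP; split => x /=; rewrite !in_itv /= ltr_pdivrMr// ler_pdivlMr//.
      by rewrite ![_ * c]mulrC.
    by rewrite ![_ * c]mulrC.
  rewrite !lebesgue_measure_itv /= !lte_fin ltr_pM2r ?invr_gt0//.
  case: ifP => _; last by rewrite mule0.
  by rewrite -!EFinB -EFinM -mulrBl mulrC divfK// gt_eqF.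
transitivity (\int[nu]_(x in blk i) h x)%E; last first.
  by apply: eq_measure_integral => A mA _; exact/esym/nuE.
rewrite ge0_integral_mscale//; first last.
- exact: measurable_funTS.
- exact: measurable_blk.
rewrite ge0_integral_pushforward//; first last.
- exact: measurable_funTS.
- exact: measurable_blk.
have -> : (fun x : T => c * x : T) @^-1` blk i = blk j.
  by apply/funext => x; apply/propext; exact: scale_blk.
rewrite ge0_integralZl//.
- exact: measurable_blk.
- by apply: measurable_funTS; exact: measurableT_comp.
- by rewrite lee_fin ltW.
Qed.

Section Lp.
Variables (p : R) (p1 : 1 <= p).
Implicit Types (f g : R -> R) (a : nat -> R).
Local Notation mfun_R f := (measurable_fun [set: measurableTypeR R] (f : measurableTypeR R -> measurableTypeR R)).

Let p0 : p != 0. Proof. by rewrite gt_eqF// (lt_le_trans ltr01). Qed.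

Lemma pint_blocks f : mfun_R f ->
  pint p f = (\sum_(i <oo) \int[leb]_(x in blk i) (`|f x| `^ p)%:E)%E.
Proof.
move=> mf; have mfp : measurable_fun [set: T] (fun x : T => (`|f x| `^ p)%:E).
  by apply/measurable_EFinP; exact: measurable_norm_powR.
have f0 (x : T) : (0 <= (`|f x| `^ p)%:E)%E by rewrite lee_fin powR_ge0.
rewrite /pint (@ge0_negligible_integral _ _ _ (lebesgue01 R) setT (~` blocks))//; last 2 first.
- exact: measurableC measurable_blocks.
- change (leb (~` blocks `&` `[0%R, 1%R]%classic) = 0)%E.
  have -> : ~` blocks `&` `[0, 1]%classic = [set (0 : R)].
    rewrite blocksE; apply/seteqP; split => x /=.
      rewrite !in_itv /= => -[h /andP[h0 h1]]; apply/eqP; rewrite eq_le h0 andbT leNgt.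
      by apply/negP => x0; apply: h; rewrite x0.
    by move=> ->; rewrite !in_itv /= ltxx lexx ler01.
  exact: lebesgue_measure_set1.
rewrite setTD setCK.
transitivity (\int[leb]_(x in blocks) (`|f x| `^ p)%:E)%E.
  apply: eq_measure_integral => A mA AU.
  change (leb (A `&` `[0%R, 1%R]%classic) = leb A)%E; congr (leb _); apply/setIidl.
  apply: (subset_trans AU); rewrite blocksE => x /=; rewrite !in_itv /=.
  by move=> /andP[/ltW-> ->].
rewrite ge0_integral_bigcup//.
- exact: measurable_blk.
- exact: measurable_funTS.
- exact: trivIset_blk.
Qed.

(** Block [i] receives what [f] does on block [s i], dilated and multiplied by the Jacobian to the
    power [1 / p], which makes the operation isometric for bijective [s]. *)
Definition pull (s : nat -> nat) f : R -> R :=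
  (fun x => ratio (bidx x) (s (bidx x)) `^ p^-1 * f (ratio (bidx x) (s (bidx x)) * x)) \_ blocks.

Lemma pullE s f i x : blk i x -> pull s f x = ratio i (s i) `^ p^-1 * f (ratio i (s i) * x).
Proof.
by move=> ix; rewrite /pull patchE ifT ?(bidxE ix)// inE; exists i.
Qed.

Lemma pull_out s f x : ~ blocks x -> pull s f x = 0.
Proof. by move=> nx; rewrite /pull patchE ifF//; apply/negP; rewrite inE. Qed.

(** Block [i] has length [2 ^ -(i + 1)]; the factor normalizes its contribution to the [p]-th power
    of the norm to [|a i| ^ p]. *)
Definition steps a : R -> R :=
  (fun x => a (bidx x) * ratio (bidx x).+1 0 `^ p^-1) \_ blocks.

Lemma stepsE a i x : blk i x -> steps a x = a i * ratio i.+1 0 `^ p^-1.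
Proof. by move=> ix; rewrite /steps patchE ifT ?(bidxE ix)// inE; exists i. Qed.

Lemma steps_out a x : ~ blocks x -> steps a x = 0.
Proof. by move=> nx; rewrite /steps patchE ifF//; apply/negP; rewrite inE. Qed.

Lemma measurable_pull s f : mfun_R f -> mfun_R (pull s f).
Proof.
move=> mf; apply/(measurable_restrictT _ measurable_blocks).
apply/measurable_fun_bigcup => [i|i]; first exact: measurable_blk.
apply: (@eq_measurable_fun _ _ _ _ _
    (fun x : T => ratio i (s i) `^ p^-1 * f (ratio i (s i) * x))).
  by move=> x /[!inE] ix; rewrite (bidxE ix).
apply: measurable_funTS; apply: measurable_funM => //.
by apply: measurableT_comp => //; exact: measurable_funM.
Qed.

Lemma measurable_steps a : mfun_R (steps a).
Proof.
apply/(measurable_restrictT _ measurable_blocks).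
apply/measurable_fun_bigcup => [i|i]; first exact: measurable_blk.
apply: (@eq_measurable_fun _ _ _ _ _ (fun=> a i * ratio i.+1 0 `^ p^-1)).
  by move=> x /[!inE] ix; rewrite (bidxE ix).
exact: measurable_cst.
Qed.

Lemma pint_pull s f : bijective s -> mfun_R f -> pint p (pull s f) = pint p f.
Proof.
move=> bs mf; rewrite (pint_blocks (measurable_pull s mf)) (pint_blocks mf).
have mfp : measurable_fun [set: T] (fun x : T => (`|f x| `^ p)%:E).
  by apply/measurable_EFinP; exact: measurable_norm_powR.
have E g : (\sum_(i <oo) \int[leb]_(x in blk i) (`|g x| `^ p)%:E =
    \esum_(i in [set: nat]) \int[leb]_(x in blk i) (`|g x| `^ p)%:E)%E.
  by apply: nneseries_esumT => i; apply: integral_ge0 => x _; rewrite lee_fin powR_ge0.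
rewrite !E.
rewrite [RHS](@reindex_esum _ _ _ [set: nat] _ s); last first.
  by have := bs; rewrite -setTT_bijective.
apply: eq_esum => i _.
rewrite -(@integral_blk_scale (fun x => (`|f x| `^ p)%:E) (s i) i)//.
apply: eq_integral => x /[!inE] ix; rewrite (pullE _ _ ix).
rewrite normrM (ger0_norm (powR_ge0 _ _)) powRM ?powR_ge0// -powRrM mulVf//.
by rewrite powRr1 ?(ltW (ratio_gt0 _ _)).
Qed.

Lemma pint_steps a : pint p (steps a) = (\sum_(i <oo) (`|a i| `^ p)%:E)%E.
Proof.
rewrite pint_blocks; last exact: measurable_steps.
apply: eq_eseriesr => i _.
transitivity (\int[leb]_(x in blk i) (cst (`|a i| `^ p * ratio i.+1 0)%:E x))%E.
  apply: eq_integral => x /[!inE] ix; rewrite (stepsE _ ix) /=; congr EFin.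
  rewrite normrM (ger0_norm (powR_ge0 _ _)) powRM ?powR_ge0// -powRrM mulVf//.
  by rewrite powRr1// (ltW (ratio_gt0 _ _)).
rewrite integral_cst; last exact: measurable_blk.
have lE : leb (blk i) = (2 ^- i - 2 ^- i.+1)%:E.
  rewrite /blk (@lebesgue_measure_itv R) /= lte_fin ltf_pV2 ?posrE ?exprn_gt0//.
  by rewrite ltr_eXn2l ?ltr1n// ltnSn -EFinB.
transitivity ((`|a i| `^ p * ratio i.+1 0)%:E * (2 ^- i - 2 ^- i.+1)%:E)%E.
  by congr (_ * _)%E.
rewrite -EFinM /ratio expr0 divr1; congr EFin.
have e0 : 2 ^+ i != 0 :> R by rewrite gt_eqF// exprn_gt0.
rewrite exprS invfM; set u := 2 ^+ i in e0 *; have : u * u^-1 = 1 by rewrite divff.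
move=> uv; transitivity (`|a i| `^ p * (u * u^-1)); last by rewrite uv mulr1.
lra.
Qed.

Lemma pull_comp s t f : pull s (pull t f) = pull (t \o s) f.
Proof.
apply/funext => x; have [[i _ ix]|nx] := pselect (blocks x); last by rewrite !pull_out.
have six : blk (s i) (ratio i (s i) * x) by apply/scale_blk.
rewrite (pullE s _ ix) (pullE _ _ six) (pullE _ _ ix) mulrA -powRM ?(ltW (ratio_gt0 _ _))//.
by rewrite ratio_trans mulrA [ratio _ _ * ratio _ _]mulrC ratio_trans.
Qed.

Lemma pull_steps s a : pull s (steps a) = steps (a \o s).
Proof.
apply/funext => x; have [[i _ ix]|nx] := pselect (blocks x); last first.
  by rewrite pull_out// steps_out.
have six : blk (s i) (ratio i (s i) * x) by apply/scale_blk.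
rewrite (pullE _ _ ix) (stepsE _ six) (stepsE _ ix) mulrCA; congr (_ * _).
by rewrite -powRM ?(ltW (ratio_gt0 _ _))// /ratio exprS [in RHS]exprS expr0 !divr1
  mulrA mulrAC divfK ?gt_eqF ?exprn_gt0// mulrC.
Qed.

Lemma stepsB a b : steps a \- steps b = steps (fun i => a i - b i).
Proof.
apply/funext => x; have [[i _ ix]|nx] := pselect (blocks x); last first.
  by rewrite /= !steps_out// subrr.
by rewrite /= !(stepsE _ ix) mulrBl.
Qed.

Lemma stepsD a b : steps a \+ steps b = steps (fun i => a i + b i).
Proof.
apply/funext => x; have [[i _ ix]|nx] := pselect (blocks x); last first.
  by rewrite /= !steps_out// addr0.
by rewrite /= !(stepsE _ ix) mulrDl.
Qed.

Lemma is_Lp_steps a : (\sum_(i <oo) (`|a i| `^ p)%:E < +oo)%E -> is_Lp p (steps a).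
Proof. by move=> h; split; [exact: measurable_steps|rewrite pint_steps]. Qed.

Lemma is_Lp_pull s f : bijective s -> is_Lp p f -> is_Lp p (pull s f).
Proof.
by move=> bs [mf If]; split; [exact: measurable_pull|rewrite pint_pull].
Qed.

End Lp.
End Blocks.

(** * Realizing l_p distances, also equivariantly, in L_p *)

Section Embedding.
Local Open Scope classical_set_scope.
Variables (R : realType) (p : R) (p1 : 1 <= p) (G : groupType).
Local Notation X := (Lp01 p1).
Implicit Types (psi : G -> nat -> R) (g h : G).

Definition lp_dist (a b : nat -> R) : \bar R := (\sum_(i <oo) (`|a i - b i| `^ p)%:E)%E.

Let is_Lp_diff a b : (lp_dist a b < +oo)%E -> is_Lp p (steps p (fun i => a i - b i)).
Proof. exact: is_Lp_steps. Qed.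

(** The sequences [psi g] may fail to be in l_p, only their differences are; subtracting [psi 1]
    brings them all into the space. *)
Lemma lp_embedding psi : (forall g, (lp_dist (psi g) (psi 1%g) < +oo)%E) ->
  exists Psi : G -> X, forall g h,
    (`|Psi g - Psi h| `^ p)%:E = lp_dist (psi g) (psi h).
Proof.
move=> fin; pose D g := steps p (fun i => psi g i - psi 1%g i).
exists (fun g => to_Lp p1 (D g)) => g h.
have [hB E] := to_LpB p1 (is_Lp_diff (fin g)) (is_Lp_diff (fin h)).
rewrite -E norm_to_Lp// stepsB pint_steps//.
by apply: eq_eseriesr => i _; rewrite opprB addrA subrK.
Qed.

Section Isometry.
Variables (s : nat -> nat) (bs : bijective s).

Definition pull_Lp (F : X) : X := to_Lp p1 (pull p s (Lspace_repr F)).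

Let pull_is_Lp (F : X) : is_Lp p (pull p s (Lspace_repr F)).
Proof. exact: (is_Lp_pull p1 bs (is_Lp_repr F)). Qed.

Lemma pull_to_Lp f : is_Lp p f -> pull_Lp (to_Lp p1 f) = to_Lp p1 (pull p s f).
Proof.
move=> hf; apply: to_Lp_eq; [exact: pull_is_Lp|exact: is_Lp_pull|].
have [hB E] := to_LpB p1 (is_Lp_repr (to_Lp p1 f)) hf.
have -> : pull p s (Lspace_repr (to_Lp p1 f)) \- pull p s f =
    pull p s ((Lspace_repr (to_Lp p1 f) : R -> R) \- f).
  apply/funext => x; have [[i _ ix]|nx] := pselect (blocks x); last first.
    by rewrite /= !pull_out// subrr.
  by rewrite /= !(pullE _ _ _ ix) mulrBr.
rewrite pint_pull//; last by case: hB.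
by rewrite -(norm_to_Lp p1 hB) E to_Lp_repr subrr normr0 powR0// gt_eqF// (lt_le_trans ltr01).
Qed.

Lemma pull_Lp_scalable a : {morph pull_Lp : F / a *: F >-> a *: F}.
Proof.
move=> F; rewrite -{1}(to_Lp_repr F).
have [h E] := to_LpZ p1 a (is_Lp_repr F); rewrite -E pull_to_Lp//.
have [h' E'] := to_LpZ p1 a (pull_is_Lp F); rewrite -E'; congr to_Lp.
apply/funext => x; have [[i _ ix]|nx] := pselect (blocks x); last first.
  by rewrite !pull_out// mulr0.
by rewrite !(pullE _ _ _ ix) mulrCA.
Qed.

Lemma pull_Lp_additive : {morph pull_Lp : F H / F + H}.
Proof.
move=> F H; rewrite -{1}(to_Lp_repr F) -{1}(to_Lp_repr H).
have [h E] := to_LpD p1 (is_Lp_repr F) (is_Lp_repr H); rewrite -E pull_to_Lp//.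
have [h' E'] := to_LpD p1 (pull_is_Lp F) (pull_is_Lp H); rewrite -E'; congr to_Lp.
apply/funext => x; have [[i _ ix]|nx] := pselect (blocks x); last first.
  by rewrite /= !pull_out// addr0.
by rewrite /= !(pullE _ _ _ ix) mulrDr.
Qed.

Lemma pull_Lp_linear : linear pull_Lp.
Proof. by move=> a F H; rewrite pull_Lp_additive pull_Lp_scalable. Qed.

Lemma norm_pull_Lp (F : X) : `|pull_Lp F| = `|F|.
Proof.
apply: (@powR_injective R p); rewrite ?nnegrE ?(lt_le_trans ltr01)//.
have [mF _] := is_Lp_repr F.
have := norm_to_Lp p1 (pull_is_Lp F); rewrite (pint_pull p1 bs mF).
by rewrite -norm_Lp_eq => -[].
Qed.

End Isometry.

Lemma pull_Lp_comp s t (F : X) : bijective s -> bijective t ->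
  pull_Lp s (pull_Lp t F) = pull_Lp (t \o s) F.
Proof.
move=> bs bt.
transitivity (to_Lp p1 (pull p s (pull p t (Lspace_repr F)))); last by rewrite pull_comp.
exact: (pull_to_Lp bs (is_Lp_pull p1 bt (is_Lp_repr F))).
Qed.

(** The permutations act linearly and isometrically, and [phi \o act g^-1 - phi] is a cocycle for
    them: formally a coboundary, of a [phi] that may lie outside l_p. The map is the orbit of 0
    under the resulting affine action. *)
Lemma lp_equivariant_embedding (act : G -> nat -> nat) (phi : nat -> R) :
  act 1%g =1 id -> (forall g h i, act (g * h)%g i = act g (act h i)) ->
  (forall g, (lp_dist (phi \o act g) phi < +oo)%E) ->
  exists2 Psi : G -> X, equivariant_map Psi & forall g h,
    (`|Psi g - Psi h| `^ p)%:E = lp_dist (phi \o act g^-1%g) (phi \o act h^-1%g).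
Proof.
move=> act1 actM fin.
have actb g : bijective (act g).
  by exists (act g^-1%g) => i; rewrite -actM ?mulVg ?mulgV act1.
pose b g : X := to_Lp p1 (steps p (fun i => phi (act g^-1%g i) - phi i)).
have Lb g : is_Lp p (steps p (fun i => phi (act g^-1%g i) - phi i)).
  exact: is_Lp_diff (fin g^-1%g).
pose tau g (F : X) : X := pull_Lp (act g^-1%g) F + b g.
have b1 : b 1%g = 0.
  apply: etrans (_ : to_Lp p1 (fun=> 0) = 0).
    apply: to_Lp_eq => //; first exact: is_Lp0.
    rewrite (_ : _ \- _ = fun=> 0); first by case: (is_Lp0 p1) => _ _; rewrite /pint integral0_eq// => x _; rewrite normr0 powR0// gt_eqF// (lt_le_trans ltr01).
    apply/funext => x /=; rewrite subr0 invg1.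
    have [[i _ ix]|nx] := pselect (blocks x); last by rewrite steps_out.
    by rewrite (stepsE _ _ ix) act1 subrr mul0r.
  have [_ E] := to_LpB p1 (is_Lp0 p1) (is_Lp0 p1).
  by have := E; rewrite subrr => <-; congr to_Lp; apply/funext => x /=; rewrite subr0.
have bM g h : b (g * h)%g = pull_Lp (act g^-1%g) (b h) + b g.
  rewrite /b pull_to_Lp// pull_steps.
  have Lh : is_Lp p (steps p ((fun i => phi (act h^-1%g i) - phi i) \o act g^-1%g)).
    by rewrite -pull_steps; exact: is_Lp_pull.
  have [_ <-] := to_LpD p1 Lh (Lb g); rewrite stepsD; congr to_Lp; congr steps.
  by apply/funext => i /=; rewrite addrA subrK invgM actM.
have tauA : affine_isometric_action tau.
  split=> [F|g h F|g].
  - rewrite /tau b1 addr0 invg1 /pull_Lp -[RHS](to_Lp_repr F).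
    have bid : bijective (act 1%g) by exact: actb.
    apply: to_Lp_eq; [exact: (is_Lp_pull p1 bid (is_Lp_repr F))|exact: is_Lp_repr|].
    (* [pull] erases values off the blocks, so even the identity permutation gives back [F] only
       almost everywhere. *)
    rewrite pint_blocks; last first.
      apply: measurable_funB; last by case: (is_Lp_repr F).
      by case: (is_Lp_pull p1 bid (is_Lp_repr F)).
    rewrite eseries0// => i _ _; rewrite integral0_eq// => x ix.
    by rewrite /= (pullE _ _ _ ix) act1 ratio_id powR1 !mul1r subrr normr0 powR0// gt_eqF// (lt_le_trans ltr01).
  - rewrite /tau bM (pull_Lp_additive (actb g^-1%g)) -[RHS]addrA; congr (_ + _).
    rewrite (pull_Lp_comp F (actb g^-1%g) (actb h^-1%g)); congr (pull_Lp _ F).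
    by apply/funext => i /=; rewrite invgM actM.
  - split.
      pose L := GRing.isLinear.Build R X X _ _ (pull_Lp_linear (actb g^-1%g)).
      pose LL : {linear X -> X} := HB.pack (pull_Lp (act g^-1%g)) L.
      by exists LL, (b g).
    move=> F H; rewrite /tau opprD addrACA subrr addr0.
    rewrite -[- pull_Lp _ H]scaleN1r -pull_Lp_scalable// -pull_Lp_additive//.
    by rewrite scaleN1r norm_pull_Lp.
exists (fun g => tau g 0); first by exists tau, 0.
move=> g h; have tau0 k : tau k 0 = b k.
  by rewrite /tau -[in LHS](scale0r 0) pull_Lp_scalable// scale0r add0r.
rewrite !tau0; have [hB E] := to_LpB p1 (Lb g) (Lb h).
rewrite -E norm_to_Lp// stepsB pint_steps//.
by apply: eq_eseriesr => i _; rewrite opprB addrA subrK.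
Qed.

End Embedding.

(** * The lamp groups *)

Section LampGroup.
Variable m : nat -> nat.

(** The factor 2 keeps [kk s] at distance at least [4 ^ s] from every other [kk t], see [kk_gap]. *)
Definition kk (s : nat) : nat := 2 * 4 ^ s.
(* [pos] is the position of a cursor moving along the integers. The lamp of level
   [s] at [x] is an element of the dihedral group of the [4 m s]-gon, the product
   of the rotation [lc s x] by the reflection with the parity of [la x] and
   [lb (x - kk s)]: at the cursor [z], the generator [a] reflects the lamps at
   [z] and [b] those at [z + kk s], for all the levels [s] at once. *)
Record lamp := Lamp {
  pos : int;
  la : int -> bool;
  lb : int -> bool;
  lc : forall s : nat, int -> 'Z_(4 * m s) }.

Definition sgn (g : lamp) (s : nat) (x : int) : 'Z_(4 * m s) :=
  (-1) ^+ (la g x (+) lb g (x - (kk s)%:Z)).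

Definition lamp_mul (g h : lamp) : lamp := Lamp (pos g + pos h)
  (fun x => la g x (+) la h (x - pos g)) (fun x => lb g x (+) lb h (x - pos g))
  (fun s x => lc g s x + sgn g s x * lc h s (x - pos g)).

Definition lamp_one : lamp := Lamp 0 (fun=> false) (fun=> false) (fun _ _ => 0).

Definition lamp_inv (g : lamp) : lamp := Lamp (- pos g)
  (fun x => la g (x + pos g)) (fun x => lb g (x + pos g))
  (fun s x => - (sgn g s (x + pos g) * lc g s (x + pos g))).

Lemma lamp_eq (g h : lamp) : pos g = pos h -> la g =1 la h -> lb g =1 lb h ->
  (forall s x, lc g s x = lc h s x) -> g = h.
Proof.
case: g h => [z A B c] [z' A' B' c'] /= -> /funext -> /funext -> E.
by congr Lamp; apply: functional_extensionality_dep => s; apply/funext => x; exact: E.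
Qed.

Lemma sgn_mul g h s x : sgn (lamp_mul g h) s x = sgn g s x * sgn h s (x - pos g).
Proof. by rewrite /sgn /= addrAC -signr_addb addbACA. Qed.

Lemma sgn_sqr g s x : sgn g s x * sgn g s x = 1.
Proof. by rewrite /sgn -expr2 sqrr_sign. Qed.

Fact lamp_mulA : associative lamp_mul.
Proof.
move=> g h f; apply: lamp_eq => [|x|x|s x] /=.
- by rewrite addrA.
- by rewrite addbA opprD addrA.
- by rewrite addbA opprD addrA.
- by rewrite sgn_mul mulrDr addrA mulrA opprD addrA.
Qed.

Fact lamp_mul1g : left_id lamp_one lamp_mul.
Proof.
move=> g; apply: lamp_eq => [|x|x|s x] /=; rewrite ?add0r ?subr0 //.
by rewrite /sgn /= expr0 mul1r.
Qed.

Fact lamp_mulg1 : right_id lamp_one lamp_mul.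
Proof.
by move=> g; apply: lamp_eq => [|x|x|s x] /=; rewrite ?addr0 ?addbF ?mulr0 ?addr0.
Qed.

Fact lamp_mulgV : right_inverse lamp_one lamp_inv lamp_mul.
Proof.
move=> g; apply: lamp_eq => [|x|x|s x] /=; rewrite ?subrr ?subrK ?addbb //.
by rewrite mulrN mulrA sgn_sqr mul1r subrr.
Qed.

Fact lamp_mulVg : left_inverse lamp_one lamp_inv lamp_mul.
Proof.
move=> g; apply: lamp_eq => [|x|x|s x] /=; rewrite ?addNr ?opprK ?addbb //.
by rewrite {2}/sgn /= addrAC -/(sgn g s _) addNr.
Qed.

HB.instance Definition _ := gen_eqMixin lamp.
HB.instance Definition _ := gen_choiceMixin lamp.
HB.instance Definition _ := isGroup.Build lamp
  lamp_mulA lamp_mul1g lamp_mulg1 lamp_mulVg lamp_mulgV.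

Definition lamp_tau : lamp := Lamp 1 (fun=> false) (fun=> false) (fun _ _ => 0).
Definition lamp_a : lamp := Lamp 0 (fun x => x == 0) (fun=> false) (fun _ _ => 0).
(** Its reflection is composed with a rotation by one, so that the product of an [a]-reflection and
    a [b]-reflection of the same lamp rotates it by one step. *)
Definition lamp_b : lamp :=
  Lamp 0 (fun=> false) (fun x => x == 0) (fun s x => (x == (kk s)%:Z)%:R).

Definition lamp_gens : seq lamp := [:: lamp_tau; lamp_a; lamp_b].

(** [lamp] allows arbitrary supports, so it is uncountable; the finitely generated group is the
    subgroup of the products of the three generators. *)
Definition in_Delta (g : lamp) : bool := `[< exists n, shorter lamp_gens n g >].

Fact in_Delta_closed : group_closed in_Delta.
Proof.
split; first by apply/asboolP; exists 0%N; exact: shorter1.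
move=> g h /asboolP[n gn] /asboolP[k hk]; apply/asboolP; exists (n + k)%N.
by apply: shorterM => //; exact: shorterV.
Qed.

Record Delta := MkDelta { Delta_val :> lamp; Delta_valP : in_Delta Delta_val }.
HB.instance Definition _ := [isSub for Delta_val].
HB.instance Definition _ := [Choice of Delta by <:].
HB.instance Definition _ := SubChoice_isSubGroup.Build lamp in_Delta Delta in_Delta_closed.

Lemma gens_in_Delta g : g \in lamp_gens -> in_Delta g.
Proof. by move=> gS; apply/asboolP; exists 1%N; exact: shorter_gen. Qed.

Definition Dtau : Delta := MkDelta (@gens_in_Delta lamp_tau (mem_head _ _)).
Lemma lamp_a_gen : lamp_a \in lamp_gens. Proof. by rewrite !inE eqxx orbT. Qed.
Lemma lamp_b_gen : lamp_b \in lamp_gens. Proof. by rewrite !inE eqxx !orbT. Qed.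
Definition Da : Delta := MkDelta (gens_in_Delta lamp_a_gen).
Definition Db : Delta := MkDelta (gens_in_Delta lamp_b_gen).
Definition Dgens : seq Delta := [:: Dtau; Da; Db].

Definition reach n (w : lamp) := exists2 y : Delta, Delta_val y = w & shorter Dgens n y.

Lemma valDM (x y : Delta) : Delta_val (x * y)%g = (Delta_val x * Delta_val y)%g.
Proof. exact: (valM x y). Qed.

Lemma valDV (x : Delta) : Delta_val (x^-1)%g = (Delta_val x)^-1%g.
Proof. exact: (@gmulfV _ _ (\val : Delta -> lamp)). Qed.

Lemma valD1 : Delta_val 1%g = 1%g.
Proof. exact: val1. Qed.

Lemma reach1 n : reach n 1%g.
Proof. by exists 1%g; [exact: valD1|exact: shorter1]. Qed.

Lemma reachM n k g h : reach n g -> reach k h -> reach (n + k) (g * h)%g.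
Proof.
by move=> [x <- xn] [y <- yk]; exists (x * y)%g; [exact: valDM|exact: shorterM].
Qed.

Lemma reachV n g : reach n g -> reach n g^-1%g.
Proof. by move=> [x <- xn]; exists x^-1%g; [exact: valDV|exact: shorterV]. Qed.

Lemma reach_le n k g : (n <= k)%N -> reach n g -> reach k g.
Proof. by move=> nk [x xg xn]; exists x => //; exact: shorter_le xn. Qed.

Lemma reach_tau : reach 1 lamp_tau.
Proof. by exists Dtau => //; apply: shorter_gen; rewrite inE eqxx. Qed.

Lemma reach_a : reach 1 lamp_a.
Proof. by exists Da => //; apply: shorter_gen; rewrite !inE eqxx orbT. Qed.

Lemma reach_b : reach 1 lamp_b.
Proof. by exists Db => //; apply: shorter_gen; rewrite !inE eqxx !orbT. Qed.

Lemma generates_Dgens : generates Dgens.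
Proof.
apply: shorter_generates => -[g gD].
suff [n [y yg yn]] : exists n, reach n g.
  by exists n; rewrite (_ : MkDelta gD = y)//; exact: val_inj.
have /asboolP[k gk] := gD.
apply: (@shorter_ind _ lamp_gens (fun g => exists n, reach n g) _ _ k g gk).
  by exists 0%N; exact: reach1.
move=> x s [n xn] sS; have rs : reach 1 s.
  by move: sS; rewrite !inE => /or3P[]/eqP->; [exact: reach_tau|exact: reach_a|exact: reach_b].
by split; exists (n + 1)%N; apply: reachM => //; exact: reachV.
Qed.

Lemma finitely_generated_Delta : finitely_generated Delta.
Proof. by exists Dgens; exact: generates_Dgens. Qed.

End LampGroup.

(** * Solvability *)

Section Derived.
Local Open Scope classical_set_scope.

Lemma derived_subgroup_sub (G : groupType) (H B : set G) : group_closed (mem B) ->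
  (forall x y, H x -> H y -> B (commg x y)) -> derived_subgroup H `<=` B.
Proof. by move=> Bg HB; apply: smallest_sub => // _ [x Hx [y Hy <-]]; exact: HB. Qed.

Lemma derived_subgroup1 (G : groupType) (H : set G) : derived_subgroup H 1%g.
Proof. by move=> B [[+ _] _]; rewrite inE. Qed.

Variable m : nat -> nat.
Local Notation lamp := (lamp m).
Local Notation Delta := (Delta m).
Implicit Types g h : lamp.

Lemma posM g h : pos (g * h)%g = pos g + pos h. Proof. by []. Qed.
Lemma posV g : pos (g^-1)%g = - pos g. Proof. by []. Qed.
Lemma laM g h x : la (g * h)%g x = la g x (+) la h (x - pos g). Proof. by []. Qed.
Lemma laV g x : la (g^-1)%g x = la g (x + pos g). Proof. by []. Qed.
Lemma lbM g h x : lb (g * h)%g x = lb g x (+) lb h (x - pos g). Proof. by []. Qed.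
Lemma lbV g x : lb (g^-1)%g x = lb g (x + pos g). Proof. by []. Qed.
Lemma lcM g h s x : lc (g * h)%g s x = lc g s x + sgn g s x * lc h s (x - pos g).
Proof. by []. Qed.

(** The cursor position and then the parities of the two switches are killed by taking commutators;
    what is left consists of rotations, which commute. *)
Lemma three_step_solvable_Delta : three_step_solvable Delta.
Proof.
pose K1 : set Delta := [set x | pos (Delta_val x) = 0].
pose K2 : set Delta := [set x | [/\ pos (Delta_val x) = 0,
  (forall t, la (Delta_val x) t = false) & forall t, lb (Delta_val x) t = false]].
have K1g : group_closed (mem K1).
  split; first by rewrite inE; exact: (congr1 (@pos m) (valD1 m)).
  by move=> x y; rewrite !inE /K1 /mkset valDM valDV posM posV => -> ->; rewrite subrr.
have K2g : group_closed (mem K2).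
  split; first by rewrite inE /K2 /mkset; rewrite (valD1 m).
  move=> x y; rewrite !inE /K2 /mkset valDM valDV => -[x0 xa xb] [y0 ya yb].
  by split=> [|t|t]; rewrite ?posM ?posV ?laM ?laV ?lbM ?lbV ?x0 ?y0 ?xa ?ya ?xb ?yb// subrr.
have K3g : group_closed (mem [set 1%g : Delta]).
  split; first by rewrite inE.
  by move=> x y; rewrite !inE /= => -> ->; rewrite divg1.
have D1 : @derived_series Delta 1 `<=` K1.
  apply: derived_subgroup_sub => // x y _ _.
  by rewrite /K1 /mkset /commg /conjg !valDM !valDV !posM !posV; lia.
have D2 : @derived_series Delta 2 `<=` K2.
  apply: derived_subgroup_sub => // x y /D1 x0 /D1 y0.
  rewrite /K2 /mkset /commg /conjg !valDM !valDV.
  rewrite /K1 /= in x0 y0.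
  split=> [|t|t]; rewrite ?(posM, posV, laM, lbM, laV, lbV, x0, y0, oppr0, addr0, subr0)//.
    by case: (la _ t); case: (la _ t).
  by case: (lb _ t); case: (lb _ t).
apply/seteqP; split; last by move=> _ ->; exact: derived_subgroup1.
apply: derived_subgroup_sub => // x y /D2 [x0 xa xb] /D2 [y0 ya yb].
apply/eqP/commgP; apply: val_inj; change (Delta_val (x * y)%g = Delta_val (y * x)%g); rewrite !valDM.
apply: lamp_eq => [|t|t|s t]; rewrite ?(posM, laM, lbM, lcM, x0, y0, xa, ya, xb, yb)//.
by rewrite /sgn !(xa, ya, xb, yb) expr0 !mul1r !subr0 addrC.
Qed.

End Derived.

(** * Rotations modulo the [b]-reflection, and the visited range *)

Section Invariants.
Variable m : nat -> nat.
Local Notation lamp := (lamp m).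
Local Notation tau := (lamp_tau m).
Local Notation A := (lamp_a m).
Local Notation B := (lamp_b m).
Implicit Types g h : lamp.

(* [lh g s x] is the rotation part of the coset of the lamp of [g] at [x] modulo
   the reflection carried by [b]. *)
Definition lh g s x : 'Z_(4 * m s) :=
  lc g s x - (-1) ^+ la g x * (lb g (x - (kk s)%:Z))%:R.

Lemma lamp_aV : (A^-1)%g = A.
Proof.
apply: lamp_eq => [|x|x|s x] //=; rewrite ?addr0 ?oppr0//.
by rewrite mulr0 oppr0.
Qed.

Lemma lamp_bV : (B^-1)%g = B.
Proof.
apply: lamp_eq => [|x|x|s x] //=; rewrite ?addr0 ?oppr0//.
rewrite /sgn /= subr_eq0; case: eqP => _ /=; last by rewrite mulr0 oppr0.
by rewrite mulr1 opprK.
Qed.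

Lemma lh_tau g s x : lh (g * tau)%g s x = lh g s x.
Proof. by rewrite /lh lcM laM lbM /= mulr0 addr0 !addbF. Qed.

Lemma lh_tauV g s x : lh (g * tau^-1)%g s x = lh g s x.
Proof. by rewrite /lh lcM laM lbM /= mulr0 oppr0 mulr0 addr0 !addbF. Qed.

Lemma lh_b g s x : lh (g * B)%g s x = lh g s x.
Proof.
rewrite /lh lcM laM lbM /= addbF /sgn.
have -> : (x - (kk s)%:Z - pos g == 0) = (x - pos g == (kk s)%:Z).
  by apply/eqP/eqP; lia.
case: (x - pos g == _) => /=; last by rewrite mulr0 addr0 addbF.
rewrite mulr1 signr_addb; case: (lb g _) => /=; rewrite ?expr0 ?expr1 ?mulr1 ?mulr0 ?subr0.
  by rewrite mulrN1.
by rewrite addrK.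
Qed.

(** Among the generators only [a] changes [lh], by two steps, and only if [b] is on at [x - kk s]:
    the cursor has to meet both sites. This is the source of [rng] and of [lh_even]. *)
Lemma lh_a g s x : lh (g * A)%g s x =
  lh g s x + (2 * ((-1) ^+ la g x * ((x == pos g) && lb g (x - (kk s)%:Z))%:R)).
Proof.
rewrite /lh lcM laM lbM /= mulr0 addr0 addbF subr_eq0.
case: (x == pos g) => /=; last by rewrite addbF !mulr0 addr0.
rewrite signr_addb expr1 mulrN1 mulNr opprK -addrA; congr (_ + _).
by rewrite mulr_natl mulr2n addrA addNr add0r.
Qed.

(** Grows by one with each generator. The supports are bounded strictly, so that [rng 0] leaves only
    the identity; the last clause asks that both switch sites of a rotated lamp lie in the range,
    which rules out levels with [kk s >= 2 v]. *)
Definition rng (v : nat) g := [/\ - v%:Z <= pos g <= v%:Z,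
  forall x, (v%:Z <= x) || (x <= - v%:Z) -> la g x = false /\ lb g x = false &
  forall s x, (v%:Z <= x) || (x <= (kk s)%:Z - v%:Z) -> lh g s x = 0].

Definition lh_even g := forall s x, exists J : int, lh g s x = (2 * J)%:~R.

Lemma rng_tau v g : rng v g -> rng v.+1 (g * tau)%g.
Proof.
move=> [h1 h2 h3]; split=> [|x hx|s x hx].
- by rewrite posM /=; lia.
- by rewrite laM lbM /= !addbF; apply: h2; lia.
- by rewrite lh_tau; apply: h3; lia.
Qed.

Lemma rng_tauV v g : rng v g -> rng v.+1 (g * tau^-1)%g.
Proof.
move=> [h1 h2 h3]; split=> [|x hx|s x hx].
- by rewrite posM /=; lia.
- by rewrite laM lbM /= !addbF; apply: h2; lia.
- by rewrite lh_tauV; apply: h3; lia.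
Qed.

Lemma rng_a v g : rng v g -> rng v.+1 (g * A)%g.
Proof.
move=> [h1 h2 h3]; split=> [|x hx|s x hx].
- by rewrite posM /=; lia.
- rewrite laM lbM /= addbF; have [|-> ->] := h2 x; first by lia.
  by split => //=; apply/negbTE/eqP; lia.
- rewrite lh_a (h3 s x); last by lia.
  rewrite add0r; have [xg|] := eqVneq x (pos g); last by rewrite !mulr0.
  have [|_ ->] := h2 (x - (kk s)%:Z); last by rewrite andbF !mulr0.
  by lia.
Qed.

Lemma rng_b v g : rng v g -> rng v.+1 (g * B)%g.
Proof.
move=> [h1 h2 h3]; split=> [|x hx|s x hx].
- by rewrite posM /=; lia.
- rewrite laM lbM /= addbF; have [|-> ->] := h2 x; first by lia.
  by split => //=; apply/negbTE/eqP; lia.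
- by rewrite lh_b; apply: h3; lia.
Qed.

Lemma lh_even_a g : lh_even g -> lh_even (g * A)%g.
Proof.
move=> ev s x; have [J hJ] := ev s x; rewrite lh_a hJ.
exists (J + (-1) ^+ la g x * ((x == pos g) && lb g (x - (kk s)%:Z))%:R).
rewrite mulrDr intrD; congr (_ + _); rewrite !intrM; congr (_ * (_ * _)) => //.
  by rewrite rmorph_sign.
by case: (_ && _).
Qed.

Lemma Delta_rng (g : Delta m) : (exists v, rng v g) /\ lh_even g.
Proof.
case: g => g /= /asboolP[n gn].
pose P (h : lamp) := (exists v, rng v h) /\ lh_even h.
apply: (@shorter_ind _ (lamp_gens m) P _ _ n g gn).
  split; last by move=> s x; exists 0; rewrite mulr0 /lh /= mulr0 subrr.
  by exists 0%N; split=> // s x _; rewrite /lh /= mulr0 subrr.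
move=> x s [[v xv] ev]; rewrite !inE => /or3P[]/eqP->; rewrite ?lamp_aV ?lamp_bV.
- split; split; [by exists v.+1; exact: rng_tau| |by exists v.+1; exact: rng_tauV|].
    by move=> t y; rewrite lh_tau; exact: ev.
  by move=> t y; rewrite lh_tauV; exact: ev.
- have Pa : P (x * A)%g by split; [exists v.+1; exact: rng_a|exact: lh_even_a].
  by [].
- have Pb : P (x * B)%g.
    by split; [exists v.+1; exact: rng_b|move=> t y; rewrite lh_b; exact: ev].
  by [].
Qed.

Lemma rng0 g : rng 0 g -> g = 1%g.
Proof.
move=> [h1 h2 h3]; have ab x : la g x = false /\ lb g x = false by apply: h2; lia.
apply: lamp_eq => [|x|x|s x]; first by rewrite /=; lia.
- by case: (ab x).
- by case: (ab x).
- have : lh g s x = 0 by apply: h3; lia.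
  by rewrite /lh (ab x).1 (ab _).2 mulr0 subr0.
Qed.

End Invariants.

(** * Upper bounds for word length by sweeping the cursor *)

Section Length.
Variable m : nat -> nat.
Local Notation lamp := (lamp m).
Local Notation tau := (lamp_tau m).
Local Notation A := (lamp_a m).
Local Notation B := (lamp_b m).
Implicit Types (g h : lamp) (P : int -> bool) (J : int -> int) (s n : nat) (z x : int).

Definition shift z : lamp := Lamp z (fun=> false) (fun=> false) (fun _ _ => 0).
Definition aset P : lamp := Lamp 0 P (fun=> false) (fun _ _ => 0).
Definition bset P : lamp :=
  Lamp 0 (fun=> false) P (fun s x => (P (x - (kk s)%:Z))%:R).
(** The factor 2 reflects [lh_even]: once all parities are restored, only even rotations occur. *)
Definition rots s J : lamp :=
  Lamp 0 (fun=> false) (fun=> false) (fun t x => if t == s then (2 * J x)%:~R else 0).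

Lemma sgn1 g s x : la g x = false -> lb g (x - (kk s)%:Z) = false -> sgn g s x = 1.
Proof. by rewrite /sgn => -> ->. Qed.

Lemma shiftM z z' : (shift z * shift z')%g = shift (z + z').
Proof. by apply: lamp_eq => //= s x; rewrite mulr0 addr0. Qed.

Lemma shiftV z : (shift z)^-1%g = shift (- z).
Proof. by apply: lamp_eq => //= s x; rewrite mulr0 oppr0. Qed.

Lemma reach_shift z : reach `|z|%N (shift z).
Proof.
suff pos n : reach n (shift n).
  case: z => n; first exact: pos.
  by rewrite NegzE -shiftV; apply: reachV; rewrite abszN; exact: pos.
elim: n => [|n IH]; first exact: reach1.
have -> : shift n.+1 = (shift n * tau)%g.
  by rewrite (shiftM n 1); congr shift; lia.
by rewrite -addn1; apply: reachM => //; exact: reach_tau.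
Qed.

Lemma reach_conj z n g : reach n g ->
  reach (`|z| + n + `|z|) (shift z * g * shift (- z))%g.
Proof.
move=> gn; apply: reachM; last by rewrite -shiftV; apply: reachV; exact: reach_shift.
by apply: reachM => //; exact: reach_shift.
Qed.

Let cut n P x := P x && (0 <= x < n%:Z).

Lemma cutS n P x : cut n.+1 P x = cut n P x (+) (P n && (x == n)).
Proof.
rewrite /cut; have [->|xn] := eqVneq x n; first by rewrite ltxx andbF andbF addFb andbT; lia.
by rewrite andbF addbF; congr (_ && _); lia.
Qed.

Lemma reach_sweep_a n P : reach (2 * n) (aset (cut n P) * shift n)%g.
Proof.
elim: n => [|n IH].
  rewrite (_ : (_ * _)%g = 1%g); first exact: reach1.
  by apply: lamp_eq => [|x|x|s x] //=; rewrite /cut ?mulr0 ?addr0//; lia.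
have -> : (aset (cut n.+1 P) * shift n.+1 =
  (aset (cut n P) * shift n) * ((if P n then A else 1) * tau))%g.
  apply: lamp_eq => [|x|x|s x].
  - by rewrite !posM /=; case: ifP => _ /=; lia.
  - rewrite !laM /= cutS !addbF add0r; case: (P n) => //=; rewrite ?addbF//.
    by rewrite subr_eq0.
  - by rewrite !lbM /=; case: ifP.
  - by rewrite !lcM /=; case: ifP => _ /=; rewrite !(mulr0, addr0).
rewrite mulnS addnC; apply: reachM => //.
apply: (@reachM _ 1 1); last exact: reach_tau.
by case: ifP => _; [exact: reach_a|exact: reach1].
Qed.

Lemma reach_sweep_b n P : reach (2 * n) (bset (cut n P) * shift n)%g.
Proof.
elim: n => [|n IH].
  rewrite (_ : (_ * _)%g = 1%g); first exact: reach1.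
  apply: lamp_eq => [|x|x|s x] //=; rewrite /cut ?mulr0 ?addr0//; first by lia.
  by rewrite (_ : _ && _ = false)//; lia.
have -> : (bset (cut n.+1 P) * shift n.+1 =
  (bset (cut n P) * shift n) * ((if P n then B else 1) * tau))%g.
  apply: lamp_eq => [|x|x|s x].
  - by rewrite !posM /=; case: ifP => _ /=; lia.
  - by rewrite !laM /=; case: ifP.
  - rewrite !lbM /= cutS !addbF add0r; case: (P n) => //=; rewrite ?addbF//.
    by rewrite subr_eq0.
  - rewrite !lcM /= !mulr0 !addr0 !add0r cutS.
    have xk : (x - (kk s)%:Z == n) = (x - n%:Z == (kk s)%:Z) by apply/eqP/eqP; lia.
    rewrite xk; case: (P n) => /=; last by rewrite !mulr0 !addbF !addr0.
    have [xn|] := eqVneq (x - n%:Z) (kk s)%:Z; last first.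
      by rewrite mulr0 addr0 addbF.
    have cF : cut n P (x - (kk s)%:Z) = false.
      by rewrite /cut; apply/negbTE/negP => /andP[_]; lia.
    by rewrite cF /= add0r /sgn laM lbM /= addbF cF expr0 mulr1.
rewrite mulnS addnC; apply: reachM => //.
apply: (@reachM _ 1 1); last exact: reach_tau.
by case: ifP => _; [exact: reach_b|exact: reach1].
Qed.

Lemma reach_aset n P : (forall x, P x -> 0 <= x < n%:Z) -> reach (3 * n) (aset P).
Proof.
move=> Pn; have -> : aset P = (aset (cut n P) * shift n * shift (- n%:Z))%g.
  rewrite -mulgA shiftM subrr; apply: lamp_eq => [|x|x|s x] //=; last by rewrite mulr0 addr0.
  by rewrite addbF /cut; case Px: (P x) => //=; rewrite Pn.
rewrite [(3 * n)%N]mulSn addnC; apply: reachM; first exact: reach_sweep_a.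
by rewrite -shiftV; apply: reachV; exact: reach_shift.
Qed.

Lemma reach_bset n P : (forall x, P x -> 0 <= x < n%:Z) -> reach (3 * n) (bset P).
Proof.
move=> Pn; have E x : cut n P x = P x by rewrite /cut; case Px: (P x) => //=; rewrite Pn.
have -> : bset P = (bset (cut n P) * shift n * shift (- n%:Z))%g.
  rewrite -mulgA shiftM subrr; apply: lamp_eq => [|x|x|s x] //=; rewrite ?addbF ?E//.
  by rewrite mulr0 addr0.
rewrite [(3 * n)%N]mulSn addnC; apply: reachM; first exact: reach_sweep_b.
by rewrite -shiftV; apply: reachV; exact: reach_shift.
Qed.

Lemma aset_conj z P : aset P = (shift z * aset (fun x => P (x + z)) * shift (- z))%g.
Proof.
apply: lamp_eq => [|x|x|s x]; rewrite ?(posM, laM, lbM, lcM) /=.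
- by lia.
- by rewrite addbF subrK.
- by [].
- by rewrite !mulr0 !addr0.
Qed.

Lemma bset_conj z P : bset P = (shift z * bset (fun x => P (x + z)) * shift (- z))%g.
Proof.
apply: lamp_eq => [|x|x|s x]; rewrite ?(posM, laM, lbM, lcM) /=.
- by lia.
- by [].
- by rewrite addbF subrK.
- by rewrite mulr0 addr0 add0r sgn1// mul1r; congr (P _)%:R; lia.
Qed.

Lemma rotsM s J J' : (rots s J * rots s J')%g = rots s (fun x => J x + J' x).
Proof.
apply: lamp_eq => //= t x; rewrite sgn1// mul1r subr0; case: ifP => _; last by rewrite addr0.
by rewrite mulrDr intrD.
Qed.

Lemma rotsV s J : (rots s J)^-1%g = rots s (fun x => - J x).
Proof.
apply: lamp_eq => //= t x; rewrite sgn1// mul1r addr0; case: ifP => _; last by rewrite oppr0.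
by rewrite mulrN intrN.
Qed.

Lemma rots_conj z s J : rots s J = (shift z * rots s (fun x => J (x + z)) * shift (- z))%g.
Proof.
apply: lamp_eq => [|x|x|t x]; rewrite ?(posM, laM, lbM, lcM) //=; first by lia.
by rewrite mulr0 addr0 add0r sgn1// mul1r subrK.
Qed.

Lemma eq_rots s J J' : J =1 J' -> rots s J = rots s J'.
Proof. by move=> /funext ->. Qed.

Lemma kk_gap s t : s != t -> (4 ^ s)%N%:Z <= `|(kk s)%:Z - (kk t)%:Z|.
Proof.
have aux a b : (a < b)%N -> (kk a + 4 ^ b <= kk b)%N /\ (4 ^ a <= 4 ^ b)%N.
  move=> ab; have := @leq_pexp2l 4 a.+1 b isT ab; rewrite expnS /kk.
  by move: (4 ^ a)%N (4 ^ b)%N => u v; lia.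
rewrite neq_ltn => /orP[]/aux; lia.
Qed.

(* Alternating [a] and [b] on a window shorter than the gaps between the [kk s]
   moves the lamps of the single level [s]. *)
Lemma bset_aset_sqr s P u : (forall x, P x -> u <= x < u + (4 ^ s)%N%:Z) ->
  ((bset (fun x => P (x + (kk s)%:Z)) * aset P) * (bset (fun x => P (x + (kk s)%:Z)) * aset P))%g =
  rots s (fun x => (P x)%:Z).
Proof.
move=> Pw; apply: lamp_eq => [|x|x|t x]; first by rewrite !posM.
- by rewrite !laM /= !subr0 addbb.
- by rewrite !lbM /= !subr0 addbF addbb.
rewrite !lcM ?posM /= !mulr0 !addr0 /sgn ?laM ?lbM /= ?subr0 ?addbF ?addFb.
set b := P _; have bE : b = P (x - (kk t)%:Z + (kk s)%:Z) by [].
have [ts|ts] := eqVneq t s.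
  have -> : b = P x by rewrite bE ts subrK.
  by case: (P x); rewrite //= ?expr0 ?mulr1 ?mul1r ?mulr0 ?addr0// -natrD.
case Px: (P x); case Eb: b => //=; rewrite ?expr0 ?expr1 ?mulr0 ?addr0 ?mulr1 ?subrr//.
have := Pw _ Px; have : P (x - (kk t)%:Z + (kk s)%:Z) by rewrite -bE Eb.
by move=> /Pw; have := kk_gap ts; have := kk_gap (introN eqP (fun e => negP ts (introT eqP (esym e)))); lia.
Qed.

Lemma reach_rots_ind s P : (forall x, P x -> 0 <= x < (4 ^ s)%N%:Z) ->
  reach (20 * 4 ^ s) (rots s (fun x => (P x)%:Z)).
Proof.
move=> Pw; rewrite -(@bset_aset_sqr s P 0); last by move=> x /Pw; rewrite add0r.
(* Travelling to [- kk s] and back takes [4 * 4 ^ s] letters, each of the two sweeps [3 * 4 ^ s]. *)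
have r1 : reach (10 * 4 ^ s) (bset (fun x => P (x + (kk s)%:Z)) * aset P)%g; last first.
  by apply: reach_le (reachM r1 r1); lia.
rewrite (bset_conj (- (kk s)%:Z)); apply: reach_le (reachM (reach_conj _ (@reach_bset (4 ^ s) _ _)) (reach_aset Pw)).
  by rewrite abszN absz_nat /kk; move: (4 ^ s)%N => u; lia.
by move=> x; rewrite subrK => /Pw.
Qed.

Lemma reach_rots_nneg s J (M : nat) : (forall x, 0 <= J x <= M%:Z) ->
  (forall x, J x != 0 -> 0 <= x < (4 ^ s)%N%:Z) -> reach (20 * 4 ^ s * M) (rots s J).
Proof.
elim: M J => [|M IH] J JM Jw.
  rewrite muln0 (_ : rots s J = 1%g); first exact: reach1.
  apply: lamp_eq => //= t x; case: ifP => // _.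
  by rewrite (_ : J x = 0) ?mulr0//; have := JM x; lia.
have -> : rots s J = (rots s (fun x => J x - Posz (0 < J x)%R) * rots s (fun x => Posz (0 < J x)%R))%g.
  by rewrite rotsM; apply: eq_rots => x; rewrite subrK.
rewrite mulnS addnC; apply: reachM.
  apply: IH => x; first by have := JM x; case: (ltrP 0 (J x)) => /=; lia.
  by move=> h; apply: Jw; move: h; apply: contra_neq => ->.
by apply: reach_rots_ind => x h; apply: Jw; rewrite gt_eqF.
Qed.

Lemma reach_rots s J (M : nat) : (forall x, (`|J x| <= M)%N) ->
  (forall x, J x != 0 -> 0 <= x < (4 ^ s)%N%:Z) -> reach (40 * 4 ^ s * M) (rots s J).
Proof.
move=> JM Jw.
have -> : rots s J = (rots s (fun x => Order.max (J x) 0) * (rots s (fun x => Order.max (- J x) 0))^-1)%g.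
  by rewrite rotsV rotsM; apply: eq_rots => x; lia.
have -> : (40 * 4 ^ s * M = 20 * 4 ^ s * M + 20 * 4 ^ s * M)%N by lia.
apply: reachM; last apply: reachV; apply: reach_rots_nneg => x.
- by have := JM x; lia.
- by move=> h; apply: Jw; lia.
- by have := JM x; lia.
- by move=> h; apply: Jw; lia.
Qed.

(** The cursor finishes one window before moving to the next, so travel costs only [2 * n * 4 ^ s]
    in all and each window pays for its own largest rotation, not for the global one. *)
Lemma reach_windows s J (M : nat -> nat) n :
  (forall i j, (i < n)%N -> (j < 4 ^ s)%N -> (`|J (i * 4 ^ s + j)%N| <= M i)%N) ->
  (forall x, J x != 0 -> 0 <= x < (n * 4 ^ s)%N%:Z) ->
  reach (\sum_(i < n) 40 * 4 ^ s * M i + 2 * n * 4 ^ s) (rots s J).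
Proof.
move=> JM Jw; pose h := (4 ^ s)%N.
pose Jc k x : int := if 0 <= x < (k * h)%N%:Z then J x else 0.
have sweep k : (k <= n)%N ->
    reach (\sum_(i < k) 40 * h * M i + k * h) (rots s (Jc k) * shift (k * h)%N%:Z)%g.
  elim: k => [|k IH] kn.
    rewrite (_ : (_ * _)%g = 1%g); first exact: reach1.
    apply: lamp_eq => //= t x; rewrite mulr0 addr0 /Jc.
    by rewrite (_ : _ && _ = false) ?mulr0 ?if_same//; lia.
  pose Jk x : int := if 0 <= x < h%:Z then J (x + (k * h)%N%:Z) else 0.
  have -> : (rots s (Jc k.+1) * shift (k.+1 * h)%N%:Z =
     (rots s (Jc k) * shift (k * h)%N%:Z) * (rots s Jk * shift h%:Z))%g.
    have -> : shift (k.+1 * h)%N%:Z = (shift (k * h)%N%:Z * shift h%:Z)%g.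
      by rewrite shiftM; congr shift; lia.
    rewrite !mulgA; congr (_ * _)%g.
    have -> : rots s Jk = (shift (- (k * h)%N%:Z) * (rots s (fun x => Jk (x - (k * h)%N%:Z)) *
        shift (- - (k * h)%N%:Z)))%g by rewrite mulgA -rots_conj.
    rewrite opprK !mulgA -[(_ * _ * shift (- _))%g]mulgA shiftM subrr.
    have -> : shift 0 = 1%g by [].
    rewrite mulg1 rotsM; congr (_ * _)%g; apply: eq_rots => x; rewrite /Jc /Jk subrK.
    case: ifP => h1; case: ifP => h2; case: ifP => h3; rewrite ?addr0 ?add0r //; lia.
  rewrite big_ord_recr /= mulSn; set u := (\sum_(i < k) _)%N.
  rewrite (_ : (u + 40 * h * M k + (h + k * h) = (u + k * h) + (40 * h * M k + h))%N); last by lia.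
  apply: reachM; first exact: IH (ltnW kn).
  apply: reachM; last by have := @reach_shift h%:Z; rewrite absz_nat.
  apply: reach_rots => x.
    rewrite /Jk; case: ifP => // /andP[x0 xh].
    have := JM k `|x|%N kn; rewrite -[(4 ^ s)%N]/h => /(_ ltac:(lia)).
    by rewrite (_ : (k * h + `|x|)%N%:Z = x + (k * h)%N%:Z)//; lia.
  by rewrite /Jk; case: ifP => //; rewrite eqxx.
have -> : rots s J = (rots s (Jc n) * shift (n * h)%N%:Z * shift (- (n * h)%N%:Z))%g.
  rewrite -mulgA shiftM subrr mulg1; apply: eq_rots => x; rewrite /Jc.
  by case: ifP => // h1; have [//|/Jw] := eqVneq (J x) 0; rewrite h1.
have -> : (\sum_(i < n) 40 * 4 ^ s * M i + 2 * n * 4 ^ s =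
   \sum_(i < n) 40 * h * M i + n * h + n * h)%N by rewrite /h; lia.
apply: reachM; first exact: sweep.
by rewrite -shiftV; apply: reachV; have := @reach_shift (n * h)%N%:Z; rewrite absz_nat.
Qed.

(** Rotations are restored level by level, then the parities, then the cursor. Each of [aset] and
    [bset] over a range of width [2 v] costs [8 v], the final shift [v]; per level, travel costs
    [2 v] for reaching [- v] and back and at most [6 v] across the windows. Levels from [S] on have
    [kk s >= 2 v] and are empty. *)
Lemma length_bound (v S : nat) g (J : nat -> int -> int) (M : nat -> nat -> nat) :
  rng v g -> (v <= 4 ^ S)%N -> (forall s, (s < S)%N -> (4 ^ s <= v)%N) ->
  (forall s x, lh g s x = (2 * J s x)%:~R) ->
  (forall s x, lh g s x = 0 -> J s x = 0) ->
  (forall s i j, (s < S)%N -> (j < 4 ^ s)%N ->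
     (`|J s (Posz (i * 4 ^ s + j) - v%:Z)%R| <= M s i)%N) ->
  reach (17 * v + \sum_(s < S) (\sum_(i < (2 * v) %/ 4 ^ s + 1) 40 * 4 ^ s * M s i + 8 * v)) g.
Proof.
move=> [h1 h2 h3] vS Sv JE J0 JM.
pose H k := Lamp 0 (fun=> false) (fun=> false)
  (fun s x => if (s < k)%N then (2 * J s x)%:~R else 0) : lamp.
have Hk k : (k <= S)%N ->
    reach (\sum_(s < k) (\sum_(i < (2 * v) %/ 4 ^ s + 1) 40 * 4 ^ s * M s i + 8 * v)) (H k).
  elim: k => [|k IH] kS.
    by rewrite big_ord0 (_ : H 0%N = 1%g); [exact: reach1|exact: lamp_eq].
  have -> : H k.+1 = (H k * rots k (J k))%g.
    apply: lamp_eq => //= s x; rewrite sgn1// mul1r subr0 ltnS leq_eqVlt.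
    by case: (ltngtP s k) => [sk|sk|->] /=; rewrite ?addr0 ?add0r// gtn_eqF.
  rewrite big_ord_recr /=; apply: reachM; first exact/IH/ltnW.
  rewrite (rots_conj (- v%:Z)).
  pose n := ((2 * v) %/ 4 ^ k + 1)%N.
  have nv : (2 * v < n * 4 ^ k)%N by rewrite /n addn1 mulnC -ltn_divLR ?expn_gt0.
  have nv' : (n * 4 ^ k <= 3 * v)%N.
    rewrite /n mulnDl mul1n; have := leq_divM (2 * v) (4 ^ k); have := Sv k kS.
    by move: (_ %/ _ * _)%N => u; lia.
  apply: reach_le (reach_conj _ (@reach_windows k _ (M k) n _ _)).
  - rewrite abszN absz_nat -/n; move: (\sum_(i < n) _)%N => u.
    by rewrite -mulnA; move: nv'; move: (n * 4 ^ k)%N => w; lia.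
  - move=> i j iN jk; exact: JM.
  - move=> x; have [/J0 -> //|hx _] := eqVneq (lh g k (x - v%:Z)) 0.
    have lo : ~~ ((v%:Z <= x - v%:Z) || (x - v%:Z <= (kk k)%:Z - v%:Z)).
      by apply: contra_neqN hx => /h3.
    by lia.
(* After the rotations [lh], the part of [lc] still missing is exactly what [aset] followed by
   [bset] produces. *)
have gE : g = (H S * (aset (la g) * bset (lb g) * shift (pos g)))%g.
  apply: lamp_eq => [|x|x|s x].
  - by rewrite !posM /= !add0r.
  - by rewrite !laM /= !addbF subr0.
  - by rewrite !lbM /= !addbF !subr0.
  rewrite !lcM /= sgn1// mul1r mulr0 addr0 add0r !subr0 /sgn /= addbF.
  have -> : (if (s < S)%N then (2 * J s x)%:~R else 0) = lh g s x.
    case: ltnP => [_|Ss]; first by rewrite JE. apply: esym; apply: h3.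
    have : (v <= 4 ^ s)%N by apply: leq_trans vS _; rewrite leq_pexp2l.
    by rewrite /kk; move: (4 ^ s)%N => u; lia.
  by rewrite /lh subrK.
rewrite {1}gE addnC; apply: reachM; first exact: Hk.
have -> : (17 * v = 8 * v + 8 * v + v)%N by lia.
apply: reachM; last by apply: reach_le (reach_shift _); lia.
apply: reachM.
  rewrite (aset_conj (- v%:Z)); apply: reach_le (reach_conj _ (@reach_aset (2 * v) _ _)); first by lia.
  move=> x; apply: contraTT => xv; apply/negbT; have [] := h2 (x - v%:Z) _ => //; lia.
rewrite (bset_conj (- v%:Z)); apply: reach_le (reach_conj _ (@reach_bset (2 * v) _ _)); first by lia.
move=> x; apply: contraTT => xv; apply/negbT; have [] := h2 (x - v%:Z) _ => //; lia.
Qed.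

End Length.

(** * Comparison of series, l_p distances, countability *)

Section Series.
Variable R : realType.
Local Open Scope classical_set_scope.

(** Choosing an [n] for every nonzero term of [f] gives an injection, because [j] is a left inverse;
    so [f] is dominated by a subfamily of [c]. *)
Lemma nneseries_le_cover (f c : nat -> \bar R) (j : nat -> nat) :
  (forall i, 0 <= f i)%E -> (forall n, 0 <= c n)%E ->
  (forall i, f i != 0%E -> exists n, j n = i /\ (f i <= c n)%E) ->
  (\sum_(i <oo) f i <= \sum_(n <oo) c n)%E.
Proof.
move=> f0 c0 H; rewrite !nneseries_esumT//.
pose A := [set i | f i != 0%E].
have [n Hn] : exists n : nat -> nat, forall i, A i -> j (n i) = i /\ (f i <= c (n i))%E.
  have /boolp.choice[n Hn] : forall i, exists k, A i -> j k = i /\ (f i <= c k)%E.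
    move=> i; have [/H[k Hk]|Ai] := pselect (A i); first by exists k.
    by exists 0%N.
  by exists n.
rewrite (esumID A)// (_ : \esum_(i in _ `&` ~` A) f i = 0)%E; last first.
  by apply: esum1 => i [_ /negP]; rewrite negbK => /eqP.
rewrite adde0 setTI; apply: (@le_trans _ _ (\esum_(i in A) c (n i))).
  by apply: le_esum => i Ai; case: (Hn i Ai).
rewrite -(@reindex_esum _ _ _ A (n @` A) n c); last first.
  split => [i Ai|i k /set_mem Ai /set_mem Ak nik|i [k Ak <-]]; try by exists i.
    by rewrite -(Hn i Ai).1 nik (Hn k Ak).1.
  by exists k.
rewrite [leRHS](esumID (n @` A))// setTI leeDl//; exact: esum_ge0.
Qed.

Lemma nneseries_ge_finite (f : nat -> \bar R) (s : seq nat) : uniq s ->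
  (forall i, 0 <= f i)%E -> (\sum_(i <- s) f i <= \sum_(i <oo) f i)%E.
Proof.
move=> us f0; rewrite nneseries_esumT//; apply: esum_ge.
exists [set` s]; first by split => //; exact: finite_seq.
by rewrite fsbig_seq.
Qed.

Lemma nneseries_le_bound (c : nat -> R) (K : R) : (forall n, 0 <= c n) ->
  (forall n, \sum_(i < n) c i <= K) -> (\sum_(n <oo) (c n)%:E <= K%:E)%E.
Proof.
move=> c0 HK; apply: lime_le; first by apply: is_cvg_nneseries => n _ _; rewrite lee_fin.
by apply: nearW => n; rewrite sumEFin lee_fin big_mkord.
Qed.

(** Condensation: the terms with index between [2 ^ k] and [2 ^ (k + 1)] add up to at most [r ^ k],
    where [r = 2 ^ -d]. *)
Lemma p_series_bound (d : R) : 0 < d ->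
  exists K : R, forall n, \sum_(i < n) ((i.+1)%:R `^ (1 + d))^-1 <= K.
Proof.
move=> d0; pose u i : R := ((i.+1)%:R `^ (1 + d))^-1.
pose r : R := (2 `^ d)^-1.
have d2 : 1 < 2 `^ d :> R.
  by rewrite -[ltLHS](powRr0 2) /powR pnatr_eq0 /= ltr_expR ltr_pM2r// ln_gt0// ltr1n.
have r0 : 0 < r by rewrite invr_gt0 (lt_trans ltr01).
have r1 : r < 1 by rewrite invf_lt1// (lt_trans ltr01).
have u0 i : 0 <= u i by rewrite invr_ge0 powR_ge0.
have blk k : \sum_(2 ^ k <= i < 2 ^ k.+1) u i <= r ^+ k.
  apply: (@le_trans _ _ (\sum_(2 ^ k <= i < 2 ^ k.+1) ((2 ^+ k) `^ (1 + d))^-1)).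
    apply: ler_sum_nat => i /andP[ki _]; rewrite lef_pV2 ?posrE ?powR_gt0 ?exprn_gt0//.
    apply: ge0_ler_powR; rewrite ?nnegrE ?exprn_ge0//; first by rewrite addr_ge0 ?ltW.
    by rewrite -natrX ler_nat (leq_trans ki).
  rewrite sumr_const_nat expnS mul2n -addnn addnK -[leLHS]mulr_natl natrX.
  have e0 : 0 < 2 ^+ k :> R by rewrite exprn_gt0.
  have -> : (2 ^+ k) `^ (1 + d) = 2 ^+ k * (2 ^+ k) `^ d :> R.
    by rewrite powRD ?powRr1 ?ltW// (gt_eqF e0) implybT.
  rewrite invfM mulrA divff ?gt_eqF// mul1r.
  by rewrite -powR_mulrn// -powRrM mulrC powRrM powR_mulrn ?powR_ge0// exprVn.
have S k : \sum_(0 <= i < 2 ^ k) u i <= 1 + (1 - r ^+ k) / (1 - r).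
  elim: k => [|k IH].
    by rewrite expn0 big_nat1 expr0 subrr mul0r addr0 /u powR1 invr1.
  rewrite (big_cat_nat (n := 2 ^ k)) //=; last by rewrite leq_pexp2l.
  apply: (le_trans (lerD IH (blk k))).
  rewrite exprSr; set q := r ^+ k; set D := (1 - r)^-1.
  have : q * (D * (1 - r)) = q by rewrite mulVf ?mulr1// gt_eqF// subr_gt0.
  lra.
exists (1 + 1 / (1 - r)) => n.
apply: (@le_trans _ _ (\sum_(0 <= i < 2 ^ n) u i)).
  rewrite (big_cat_nat (n := n)) ?(ltnW (ltn_expl _ _))//= big_mkord lerDl.
  by apply: sumr_ge0.
apply: (le_trans (S n)); rewrite lerD2l; apply: ler_wpM2r.
  by rewrite invr_ge0 subr_ge0 ltW.
by have := exprn_ge0 n (ltW r0); lra.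
Qed.

End Series.

Section LpDist.
Variables (R : realType) (p : R) (p1 : 1 <= p).
Implicit Types a b c : nat -> R.
Local Notation dist := (lp_dist p).

Let p0 : p != 0. Proof. by rewrite gt_eqF// (lt_le_trans ltr01). Qed.

Lemma lp_distxx a : dist a a = 0%E.
Proof. by rewrite /lp_dist eseries0// => i _ _; rewrite subrr normr0 powR0. Qed.

Lemma lp_distC a b : dist a b = dist b a.
Proof. by apply: eq_eseriesr => i _; rewrite distrC. Qed.

Lemma powR_normD (x y : R) : `|x + y| `^ p <= 2 `^ p * (`|x| `^ p + `|y| `^ p).
Proof.
have p0' : 0 <= p by rewrite (le_trans _ p1).
wlog xy : x y / `|y| <= `|x| => [H|].
  have [h|/ltW h] := leP `|y| `|x|; first exact: H.
  by rewrite addrC [X in _ * X]addrC; exact: H.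
apply: (@le_trans _ _ ((2 * `|x|) `^ p)).
  apply: ge0_ler_powR; rewrite ?nnegrE ?mulr_ge0//.
  by apply: (le_trans (ler_normD _ _)); lra.
by rewrite powRM// ler_wpM2l ?powR_ge0// lerDl powR_ge0.
Qed.

Lemma lp_dist_fin_trans a b c : (dist a b < +oo)%E -> (dist b c < +oo)%E ->
  (dist a c < +oo)%E.
Proof.
move=> ab bc.
apply: (@le_lt_trans _ _ ((2 `^ p)%:E * (dist a b + dist b c))%E); last first.
  by rewrite lte_mul_pinfty// ?lee_fin ?powR_ge0// lte_add_pinfty.
have ge (x y : nat -> R) i : (0 <= (`|x i - y i| `^ p)%:E)%E by rewrite lee_fin powR_ge0.
rewrite -nneseriesD// -nneseriesZl; last by move=> i _; rewrite adde_ge0.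
apply: lee_nneseries => i _ //; rewrite -EFinD -EFinM lee_fin.
have -> : a i - c i = (a i - b i) + (b i - c i) by rewrite subrKA.
exact: powR_normD.
Qed.

End LpDist.

Section Countable.
Variable G : groupType.

Lemma generated_countable (S : seq G) : generates S -> exists e : G -> nat, injective e.
Proof.
move=> gS; pose L := S ++ [seq s^-1%g | s <- S].
have word x : exists w : seq nat, (\prod_(i <- w) nth 1%g L i)%g = x.
  have [n [w [wS wx] _]] := generates_shorter x gS.
  exists [seq index s L | s <- w]; rewrite big_map -wx.
  apply: eq_big_seq => s /wS sS; rewrite nth_index// mem_cat.
  case: sS => [->//|sS]; apply/orP; right; apply/mapP; exists s^-1%g => //.
  by rewrite invgK.
have /boolp.choice[w Hw] := word; exists (fun x => pickle (w x)) => x y.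
by move=> /(pcan_inj pickleK) wxy; rewrite -(Hw x) -(Hw y) wxy.
Qed.

End Countable.

(** * Weights along rays in coset spaces *)

Section CosetEmbedding.
Local Open Scope classical_set_scope.
Variables (R : realType) (p : R) (p1 : 1 <= p) (G : groupType).
Variables (code : bool * G -> nat) (code_inj : injective code).
Variables (H : bool -> set G) (t : bool -> G) (w : nat -> R).
Hypothesis H1 : forall b, H b 1%g.
Hypothesis HM : forall b x y, H b x -> H b y -> H b (x * y)%g.
Hypothesis HV : forall b x, H b x -> H b x^-1%g.
Hypothesis Ht : forall b i j, H b ((t b ^- i * t b ^+ j)%g) -> i = j.
Implicit Types (b : bool) (x y z g : G).

(** Equality of the left cosets of [x] and [y] modulo [H b]. *)
Let sim b x y := H b (x^-1 * y)%g.

Let sim_refl b x : sim b x x. Proof. by rewrite /sim mulVg. Qed.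

Let sim_sym b x y : sim b x y -> sim b y x.
Proof. by move=> /HV; rewrite invgM invgK. Qed.

Let sim_trans b x y z : sim b x y -> sim b y z -> sim b x z.
Proof. by move=> xy /(HM xy); rewrite mulgA mulgK. Qed.

Let sim_mul b g x y : sim b x y -> sim b (g * x)%g (g * y)%g.
Proof. by rewrite /sim invgM -mulgA mulKg. Qed.

Let rep b x : G := xget x [set y | sim b x y].

Let rep_sim b x : sim b x (rep b x).
Proof. by rewrite /rep; case: xgetP => [y _ //|/(_ x)]; case; exact: sim_refl. Qed.

Let rep_eq b x y : sim b x y -> rep b x = rep b y.
Proof.
move=> xy; rewrite /rep.
have -> : [set z | sim b y z] = [set z | sim b x z].
  apply/seteqP; split => z /=; first exact: sim_trans.
  by apply: sim_trans; exact: sim_sym.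
by rewrite /xget; case: pselect => // -[]; exists x; apply/asboolP; exact: sim_refl.
Qed.

Let rep_rep b x : rep b (rep b x) = rep b x.
Proof. by apply: rep_eq; exact/sim_sym/rep_sim. Qed.

(* The points of the index set are the canonical representatives of the cosets. *)
Let dec (i : nat) : option (bool * G) :=
  if pselect (exists bx, code bx = i /\ rep bx.1 bx.2 = bx.2) is left h
  then Some (projT1 (cid h)) else None.

Let dec_code b x : dec (code (b, rep b x)) = Some (b, rep b x).
Proof.
rewrite /dec; case: pselect => [h|]; last by case; exists (b, rep b x); rewrite /= rep_rep.
by case: (cid h) => /= bx [/code_inj-> _].
Qed.

Let decP i bx : dec i = Some bx -> i = code (bx.1, rep bx.1 bx.2).
Proof.
rewrite /dec; case: pselect => // h [<-]; case: (cid h) => -[b x] /= [ci E].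
by rewrite E.
Qed.

Definition coset_act g (i : nat) : nat :=
  if dec i is Some (b, x) then code (b, rep b (g * x)%g) else i.

Let act_code g b x : coset_act g (code (b, rep b x)) = code (b, rep b (g * x)%g).
Proof.
rewrite /coset_act dec_code; congr (code (b, _)).
by apply: rep_eq; apply: sim_mul; apply: sim_sym; exact: rep_sim.
Qed.

Lemma coset_act1 : coset_act 1%g =1 id.
Proof.
move=> i; rewrite /coset_act; case E: (dec i) => [[b x]|//].
by rewrite mul1g [RHS](decP E).
Qed.

Lemma coset_actM g h i : coset_act (g * h)%g i = coset_act g (coset_act h i).
Proof.
rewrite {1 3}/coset_act; case E: (dec i) => [[b x]|]; first by rewrite act_code mulgA.
by rewrite /coset_act E.
Qed.

(** The weight [w n] on the coset of the [n]-th point of the ray and 0 off the ray. By [Ht] the ray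
    meets each coset at most once, so the chosen [n] is the only one. *)
Let val b x : R :=
  if pselect (exists n, sim b x (t b ^+ n)%g) is left h then w (projT1 (cid h)) else 0.

Let valE b x n : sim b x (t b ^+ n)%g -> val b x = w n.
Proof.
move=> xn; rewrite /val; case: pselect => [h|[]]; last by exists n.
case: (cid h) => k /= xk; congr w; apply: (@Ht b).
exact: (sim_trans (sim_sym xk) xn).
Qed.

Let val0 b x : (forall n, ~ sim b x (t b ^+ n)%g) -> val b x = 0.
Proof. by move=> xn; rewrite /val; case: pselect => // h; have [n hn] := h; case: (xn n hn). Qed.

Let val_sim b x y : sim b x y -> val b x = val b y.
Proof.
move=> xy; have [[n xn]|xn] := pselect (exists n, sim b x (t b ^+ n)%g).
  by rewrite (valE xn) (valE (sim_trans (sim_sym xy) xn)).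
by rewrite !val0// => n h; apply: xn; exists n => //; exact: sim_trans h.
Qed.

Definition coset_fun (i : nat) : R := if dec i is Some (b, x) then val b x else 0.

Definition coset_map g (i : nat) : R := coset_fun (coset_act g^-1%g i).

Let coset_map_code g b x : coset_map g (code (b, rep b x)) = val b (g^-1 * x)%g.
Proof.
rewrite /coset_map act_code /coset_fun dec_code; apply: val_sim.
exact/sim_sym/rep_sim.
Qed.

Let coset_map_none g i : dec i = None -> coset_map g i = 0.
Proof. by move=> E; rewrite /coset_map /coset_act E /coset_fun E. Qed.

Let p0 : p != 0. Proof. by rewrite gt_eqF// (lt_le_trans ltr01). Qed.

(** When the first [N] cosets of the ray are missed by its translate under [g], the translated
    function vanishes there and the weights are seen in full. *)
Lemma coset_map_ge g b N :
  (forall n k, (n < N)%N -> ~ H b (t b ^- n * g * t b ^+ k)%g) ->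
  (\sum_(n < N) (`|w n| `^ p)%:E <= lp_dist p (coset_map g) (coset_map 1%g))%E.
Proof.
move=> gN; pose j n := code (b, rep b (t b ^+ n)%g).
have jinj : injective j.
  move=> n k /code_inj[E]; apply: (@Ht b).
  exact: (sim_trans (rep_sim b _) (eq_ind_r (fun z => sim b z _) (sim_sym (rep_sim b _)) E)).
apply: (@le_trans _ _ (\sum_(i <- map j (index_iota 0 N))
    (`|coset_map g i - coset_map 1%g i| `^ p)%:E)%E); last first.
  apply: nneseries_ge_finite; first by rewrite map_inj_uniq ?iota_uniq.
  by move=> i; rewrite lee_fin powR_ge0.
rewrite big_map big_mkord.
apply: lee_sum => n _; rewrite lee_fin /j !coset_map_code.
rewrite invg1 mul1g (@valE b (t b ^+ n)%g n); last exact: sim_refl.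
rewrite (val0 (x := (g^-1 * t b ^+ n)%g)); first by rewrite sub0r normrN.
by move=> k; rewrite /sim invgM invgK; exact: gN.
Qed.

(** [s] fixes every coset of the ray except its start. The two functions can differ only at the
    starts of the rays of [g * s] and of [g], for both values of [b]: four cosets, each with
    difference at most [w 0]. *)
Lemma coset_map_lamp g s : (forall b n, H b (t b ^- n.+1 * s * t b ^+ n.+1)%g) ->
  (lp_dist p (coset_map (g * s)%g) (coset_map g) <= (4 * `|w 0| `^ p)%:E)%E.
Proof.
move=> Hs; pose c (k : nat) : R := if (k < 4)%N then `|w 0| `^ p else 0.
apply: (@le_trans _ _ (\sum_(k <oo) (c k)%:E)%E); last first.
  apply: nneseries_le_bound => n; first by rewrite /c; case: ifP => // _; exact: powR_ge0.
  apply: (@le_trans _ _ (\sum_(0 <= i < maxn 4 n) c i)).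
    rewrite [leRHS](big_cat_nat (n := n)) ?leq_maxr//= big_mkord lerDl.
    by apply: sumr_ge0 => i _; rewrite /c; case: ifP => // _; exact: powR_ge0.
  rewrite (big_cat_nat (n := 4)) ?leq_maxl//= [X in _ + X]big_nat_cond [X in _ + X]big1 ?addr0; last first.
    by move=> i; rewrite andbT => /andP[i4 _]; rewrite /c ltnNge i4.
  by rewrite big_mkord !big_ord_recr big_ord0 /= /c /=; lra.
(* The parity of [k] selects [b], and [k < 2] the start of the ray of [g * s]. *)
pose j k := code (odd k, rep (odd k) (if (k < 2)%N then g * s else g)%g).
apply: (@nneseries_le_cover _ _ _ j) => [i|i|i]; rewrite ?lee_fin ?powR_ge0//.
  by rewrite /c; case: ifP => // _; exact: powR_ge0.
case E: (dec i) => [[b x]|]; last first.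
  by rewrite !(coset_map_none _ E) subrr normr0 powR0// eqxx.
rewrite (decP E) /= !coset_map_code => h.
have key (k : nat) z : sim b x z ->
  odd k = b -> (k < 4)%N -> z = (if (k < 2)%N then g * s else g)%g ->
  `|val b ((g * s)^-1 * x)%g - val b (g^-1 * x)%g| <= `|w 0| ->
  exists n, j n = code (b, rep b x) /\
   ((`|val b ((g * s)^-1 * x)%g - val b (g^-1 * x)%g| `^ p)%:E <= (c n)%:E)%E.
  move=> xz kb k4 zE hw; exists k; split.
    by rewrite /j kb -zE; congr (code (b, _)); apply: rep_eq; exact: sim_sym.
  by rewrite /c k4 lee_fin; apply: ge0_ler_powR; rewrite ?nnegrE// (le_trans _ p1).
have shiftE y n : sim b (y^-1 * x)%g (t b ^+ n)%g <-> sim b x (y * t b ^+ n)%g.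
  by rewrite /sim invgM invgK mulgA.
have slide n : sim b (g * t b ^+ n.+1)%g (g * s * t b ^+ n.+1)%g.
  by rewrite /sim invgM -!mulgA mulKg mulgA; exact: Hs.
have [[n xn]|xn] := pselect (exists n, sim b x (g * s * t b ^+ n)%g).
  rewrite (valE ((shiftE _ _).2 xn)) in h key *; case: n xn h key => [|n] xn h key; last first.
    have xg := sim_trans xn (sim_sym (slide n)).
    by move: h; rewrite (valE ((shiftE _ _).2 xg)) subrr normr0 powR0// eqxx.
  have [[k xk]|xk] := pselect (exists n, sim b x (g * t b ^+ n)%g).
    rewrite (valE ((shiftE _ _).2 xk)) in h key *; case: k xk h key => [|k] xk h key.
      by move: h; rewrite subrr normr0 powR0// eqxx.
    have xk' := sim_trans xk (slide k).
    by have := @Ht b _ _ (sim_trans (sim_sym ((shiftE _ _).2 xn)) ((shiftE _ _).2 xk')).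
  have v0 : val b (g^-1 * x)%g = 0 by apply: val0 => n /shiftE h'; apply: xk; exists n.
  rewrite v0 subr0 in h key *.
  by apply: (key (nat_of_bool b) (g * s)%g); rewrite ?oddb//; [move: xn; rewrite expg0 mulg1|case: (b)|case: (b)].
have v0 : val b ((g * s)^-1 * x)%g = 0 by apply: val0 => n /shiftE h'; apply: xn; exists n.
rewrite v0 sub0r normrN in h key *.
have [[k xk]|xk] := pselect (exists n, sim b x (g * t b ^+ n)%g); last first.
  by move: h; rewrite val0 ?normr0 ?powR0 ?eqxx// => n /shiftE h'; apply: xk; exists n.
case: k xk => [|k] xk; last by case: xn; exists k.+1; exact: sim_trans (slide k).
rewrite (valE ((shiftE _ _).2 xk)) in h key *.
apply: (key (2 + b)%N g); rewrite ?oddD ?oddb ?lexx//.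
  by move: xk; rewrite expg0 mulg1.
by case: (b).
Qed.

(* Right multiplication by [t b] slides the weights by one step along a ray. *)
Lemma coset_map_shift g s (K : R) : (forall b, s = t b \/ s = (t b)^-1%g) ->
  (forall n, `|w 0| `^ p + \sum_(i < n) `|w i.+1 - w i| `^ p <= K) ->
  (lp_dist p (coset_map (g * s)%g) (coset_map g) <= (2 * K)%:E)%E.
Proof.
move=> Hs HK; pose d n : R := if n is k.+1 then `|w k.+1 - w k| `^ p else `|w 0| `^ p.
have d0 n : 0 <= d n by case: n => [|n]; exact: powR_ge0.
have dK n : \sum_(i < n) d i <= K.
  case: n => [|n]; first by rewrite big_ord0 (le_trans _ (HK 0%N))// big_ord0 addr0 powR_ge0.
  by rewrite big_ord_recl; exact: HK.
pose c (k : nat) : R := d k./2.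
apply: (@le_trans _ _ (\sum_(k <oo) (c k)%:E)%E); last first.
  apply: nneseries_le_bound => n; first exact: d0.
  apply: (@le_trans _ _ (\sum_(0 <= i < n.*2) c i)).
    rewrite [leRHS](big_cat_nat (n := n)) //=; last by rewrite -addnn leq_addr.
    by rewrite big_mkord lerDl; apply: sumr_ge0 => i _; exact: d0.
  have -> : \sum_(0 <= i < n.*2) c i = 2 * \sum_(i < n) d i.
    elim: (n) => [|k IH]; first by rewrite big_ord0 big_geq// mulr0.
    rewrite doubleS !big_nat_recr//= IH big_ord_recr /= /c /=.
    by rewrite doubleK uphalf_double; lra.
  by rewrite ler_wpM2l.
(* The start of the longer of the two rays, which contains the other one. *)
pose first b := if pselect (s = t b) then g else (g * s)%g.
pose j k := code (odd k, rep (odd k) (first (odd k) * t (odd k) ^+ k./2)%g).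
apply: (@nneseries_le_cover _ _ _ j) => [i|i|i]; rewrite ?lee_fin ?powR_ge0 ?d0//.
case E: (dec i) => [[b x]|]; last first.
  by rewrite !(coset_map_none _ E) subrr normr0 powR0// eqxx.
rewrite (decP E) /= !coset_map_code => h.
have shiftE y n : sim b (y^-1 * x)%g (t b ^+ n)%g <-> sim b x (y * t b ^+ n)%g.
  by rewrite /sim invgM invgK mulgA.
have key n : sim b x (first b * t b ^+ n)%g ->
  `|val b ((g * s)^-1 * x)%g - val b (g^-1 * x)%g| `^ p <= d n ->
  exists n, j n = code (b, rep b x) /\
   ((`|val b ((g * s)^-1 * x)%g - val b (g^-1 * x)%g| `^ p)%:E <= (c n)%:E)%E.
  move=> xn hn; exists (n.*2 + b)%N; rewrite /c /j oddD odd_double oddb addFb.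
  have -> : (n.*2 + b)./2 = n by rewrite addnC half_bit_double.
  split; last by rewrite lee_fin.
  by congr (code (b, _)); apply: rep_eq; exact: sim_sym.
have vs (y z : G) n : (z = y * t b)%g -> sim b x (y * t b ^+ n)%g ->
    `|val b (z^-1 * x)%g - val b (y^-1 * x)%g| `^ p <= d n.
  move=> zE xn; rewrite (valE ((shiftE _ _).2 xn)).
  case: n xn => [|n] xn.
    rewrite val0 ?sub0r ?normrN// => k /shiftE; rewrite zE -mulgA -expgS => xk.
    by have := @Ht b _ _ (sim_trans (sim_sym ((shiftE _ _).2 xn)) ((shiftE _ _).2 xk)).
  have -> : val b (z^-1 * x)%g = w n.
    by apply: valE; apply/shiftE; rewrite zE -mulgA -expgS.
  by rewrite distrC.
have vany (y z : G) : (z = y * t b)%g -> val b (z^-1 * x)%g - val b (y^-1 * x)%g != 0 ->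
    exists n, sim b x (y * t b ^+ n)%g.
  move=> zE; apply: contra_neqP => yn; rewrite !val0 ?subrr// => n /shiftE xn; apply: yn.
    by exists n.
  by exists n.+1; rewrite expgS mulgA -zE.
have hne : val b ((g * s)^-1 * x)%g - val b (g^-1 * x)%g != 0.
  by apply: contra_neq h => ->; rewrite normr0 powR0.
move: key; rewrite /first; case: pselect => [st|nst] key.
  have zE : (g * s = g * t b)%g by rewrite st.
  have [n xn] := vany _ _ zE hne.
  by apply: (key n) => //; exact: vs.
have st : (s = (t b)^-1)%g by case: (Hs b).
have zE : (g = g * s * t b)%g by rewrite st mulgVK.
have hne' : val b (g^-1 * x)%g - val b ((g * s)^-1 * x)%g != 0 by rewrite -opprB oppr_eq0.
have [n xn] := vany _ _ zE hne'.
by apply: (key n) => //; rewrite distrC; exact: vs.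
Qed.

End CosetEmbedding.

(** * Embedding that detects the visited range *)

Section RangeEmbedding.
Local Open Scope classical_set_scope.
Variable m : nat -> nat.
Local Notation Delta := (Delta m).
Local Notation lamp := (lamp m).

Definition ray (b : bool) : Delta := if b then Dtau m else (Dtau m)^-1%g.

Definition sgz (b : bool) (n : nat) : int := if b then n%:Z else - n%:Z.

Lemma val_ray b n : Delta_val (ray b ^+ n)%g = shift m (sgz b n).
Proof.
elim: n => [|n IH]; first by rewrite expg0 valD1; case: b.
rewrite expgS valDM IH /ray; case: b {IH}.
  by rewrite -[Delta_val _]/(shift m 1) shiftM; congr shift; rewrite /sgz; lia.
rewrite valDV -[Delta_val _]/(shift m 1) shiftV shiftM; congr shift; rewrite /sgz; lia.
Qed.

Definition half_lamps (b : bool) : set Delta := [set h : Delta | [/\ pos h = 0,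
  forall x, (if b then 0 <= x else x <= 0) -> la h x = false /\ lb h x = false &
  forall s x, (if b then 0 <= x else x <= (kk s)%:Z) -> lh h s x = 0]].

Lemma half_lamps1 b : half_lamps b 1%g.
Proof.
rewrite /half_lamps /mkset valD1; split=> // s x _.
by rewrite /lh /= mulr0 subrr.
Qed.

Lemma half_lamps_lc b (h : Delta) s x : half_lamps b h ->
  (if b then 0 <= x else x <= (kk s)%:Z) ->
  lc h s x = (-1) ^+ la h x * (lb h (x - (kk s)%:Z))%:R /\
  (b -> la h x = false) /\ (~~ b -> lb h (x - (kk s)%:Z) = false).
Proof.
move=> [_ h2 h3] hx; split; first by apply/eqP; rewrite -subr_eq0; apply/eqP; exact: h3.
split; first by move=> bT; case: (h2 x); move: hx; rewrite bT.
move=> bF; case: (h2 (x - (kk s)%:Z)) => //; move: hx; rewrite (negbTE bF); lia.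
Qed.

Lemma half_lampsM b x y : half_lamps b x -> half_lamps b y -> half_lamps b (x * y)%g.
Proof.
move=> hx hy; have [x1 x2 _] := hx; have [y1 y2 _] := hy.
rewrite /half_lamps /mkset valDM; split=> [|u hu|s u hu].
- by rewrite posM x1 y1.
- by rewrite laM lbM x1 subr0; have [-> ->] := x2 _ hu; have [-> ->] := y2 _ hu.
have [ex [ex1 ex2]] := half_lamps_lc hx hu; have [ey [ey1 ey2]] := half_lamps_lc hy hu.
rewrite /lh lcM laM lbM x1 !subr0 ex ey /sgn.
case: b hx hy x2 y2 hu ex ey ex1 ex2 ey1 ey2 => hx hy x2 y2 hu ex ey ex1 ex2 ey1 ey2.
  rewrite ex1// ey1// /= !mul1r; case: (lb x _); case: (lb y _) => /=;
    by rewrite ?(expr0, expr1, mulr0, mulr1, mul1r, addr0, add0r, subrr, subr0).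
by rewrite ex2// ey2// !mulr0 addr0 subr0.
Qed.

Lemma half_lampsV b x : half_lamps b x -> half_lamps b x^-1%g.
Proof.
move=> hx; have [x1 x2 _] := hx.
rewrite /half_lamps /mkset valDV; split=> [|u hu|s u hu].
- by rewrite posV x1 oppr0.
- by rewrite laV lbV x1 addr0; exact: x2.
have [ex [ex1 ex2]] := half_lamps_lc hx hu.
rewrite /lh laV lbV -[lc _ s u]/(- (sgn x s (u + pos x) * lc x s (u + pos x))) x1 !addr0 ex /sgn.
case: b hx x2 hu ex ex1 ex2 => hx x2 hu ex ex1 ex2.
  rewrite ex1// /= !mul1r; case: (lb x _) => /=;
    by rewrite ?(expr0, expr1, mulr0, mulr1, mul1r, oppr0, opprK, subrr, subr0).
by rewrite ex2// !mulr0 !oppr0 addr0.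
Qed.

Lemma half_lamps_ray b i j : half_lamps b (ray b ^- i * ray b ^+ j)%g -> i = j.
Proof.
move=> [+ _ _]; rewrite valDM valDV !val_ray shiftV shiftM /= /sgz.
by case: b; lia.
Qed.

Lemma lh_shift z z' (g : lamp) s x : lh (shift m z * g * shift m z')%g s x = lh g s (x - z).
Proof.
rewrite /lh !lcM !laM !lbM /= !addbF mulr0 addr0 add0r sgn1// mul1r.
by congr (_ - _ * (lb g _)%:R); lia.
Qed.

Lemma half_lamps_gen b n (s : Delta) : s = Da m \/ s = Db m ->
  half_lamps b (ray b ^- n.+1 * s * ray b ^+ n.+1)%g.
Proof.
move=> sE; rewrite /half_lamps /mkset !valDM valDV val_ray shiftV.
have P0 : pos s = 0 by case: sE => ->.
have lab x : x != 0 -> la s x = false /\ lb s x = false.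
  by move=> /negbTE x0; case: sE => ->; rewrite /= x0.
have lhs t x : lh s t x = 0.
  case: sE => ->; first by rewrite /lh /= mulr0 subrr.
  by rewrite /lh /= mul1r subr_eq0 subrr.
split=> [|x hx|t x hx].
- by rewrite !posM /= P0; lia.
- rewrite !laM !lbM /= !addbF; apply: lab; apply/eqP; move: hx; rewrite /sgz.
  by case: b; lia.
- by rewrite lh_shift lhs.
Qed.

(** Otherwise each ray has a point [n < v] whose coset meets the translated ray. For [true] this
    confines [g] to the left of [n], for [false] to the right of [- n'], and together to
    [rng v.-1]. *)
Lemma rng_half_lamps v (g : Delta) : ~ rng v.-1 g -> (0 < v)%N ->
  exists b, forall n k, (n < v)%N -> ~ half_lamps b (ray b ^- n * g * ray b ^+ k)%g.
Proof.
move=> nr v0; apply: contrapT => /forallNP Hb; apply: nr.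
have P b : exists n k, (n < v)%N /\ half_lamps b (ray b ^- n * g * ray b ^+ k)%g.
  have /existsNP[n /existsNP[k]] := Hb b; rewrite not_implyE => -[nv /contrapT h].
  by exists n, k.
have [n [k [nv]]] := P true; rewrite /half_lamps /mkset !valDM valDV !val_ray shiftV /sgz.
move=> [p1 p2 p3].
have [n' [k' [nv']]] := P false; rewrite /half_lamps /mkset !valDM valDV !val_ray shiftV /sgz.
move=> [q1 q2 q3].
rewrite !posM /= in p1 q1.
split=> [|x|s x]; first by lia.
- move=> /orP[hx|hx].
    have := p2 (x - n%:Z); rewrite !laM !lbM /= !addbF opprK subrK; apply; lia.
  have := q2 (x + n'%:Z); rewrite !laM !lbM /= !addbF opprK addrK; apply; lia.
- move=> /orP[hx|hx].
    have := p3 s (x - n%:Z); rewrite lh_shift opprK subrK; apply; lia.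
  have := q3 s (x + n'%:Z); rewrite lh_shift opprK addrK; apply; lia.
Qed.

Section Weights.
Variables (R : realType) (p e : R) (p1 : 1 <= p) (e0 : 0 < e) (e1 : e <= 1).

(** Partial sums of a barely [p]-summable series: the increments stay bounded in l_p, while the
    first [N] weights have l_p norm at least a multiple of [N ^ (1 - e)]. *)
Definition weight (n : nat) : R := \sum_(k < n.+1) (k.+1%:R `^ (p^-1 + e))^-1.

Let p0 : 0 < p. Proof. by rewrite (lt_le_trans ltr01). Qed.

Let term_gt0 k : 0 < (k.+1%:R `^ (p^-1 + e))^-1 :> R.
Proof. by rewrite invr_gt0 powR_gt0. Qed.

Lemma weight_ge0 n : 0 <= weight n.
Proof. by apply: sumr_ge0 => k _; exact: ltW. Qed.

Lemma weight_mono n k : (n <= k)%N -> weight n <= weight k.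
Proof.
move=> nk; rewrite /weight -!(big_mkord xpredT (fun k => (k.+1%:R `^ (p^-1 + e))^-1)).
rewrite [leRHS](big_cat_nat (n := n.+1))//= lerDl.
by apply: sumr_ge0 => i _; exact: ltW.
Qed.

Lemma weight_ge n : n.+1%:R `^ (1 - (p^-1 + e)) <= weight n.
Proof.
have pe : 0 <= p^-1 + e by rewrite ltW// addr_gt0 ?invr_gt0.
apply: (@le_trans _ _ (\sum_(k < n.+1) (n.+1%:R `^ (p^-1 + e))^-1)).
  rewrite sumr_const card_ord -[leRHS]mulr_natl powRD; last by rewrite pnatr_eq0 implybT.
  by rewrite powRr1// powRN.
apply: ler_sum => k _; rewrite lef_pV2 ?posrE ?powR_gt0//.
by apply: ge0_ler_powR; rewrite ?nnegrE// ler_nat.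
Qed.

Lemma weight_increments : exists K : R, forall n,
  `|weight 0| `^ p + \sum_(i < n) `|weight i.+1 - weight i| `^ p <= K.
Proof.
have [|K HK] := @p_series_bound R (e * p); first by rewrite mulr_gt0.
exists K => n; apply: le_trans (HK n.+1); rewrite big_ord_recl.
have E k : ((k.+1%:R `^ (p^-1 + e))^-1) `^ p = (k.+1%:R `^ (1 + e * p))^-1 :> R.
  by rewrite -!powRN -powRrM mulNr mulrDl mulVf// gt_eqF.
rewrite {1}/weight big_ord_recr big_ord0 /= add0r ger0_norm ?(ltW (term_gt0 _))// E lerD2l.
apply: ler_sum => i _.
have -> : weight i.+1 = weight i + (i.+2%:R `^ (p^-1 + e))^-1 by rewrite /weight big_ord_recr.
rewrite addrC addKr.
by rewrite ger0_norm ?(ltW (term_gt0 _))// E.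
Qed.

Lemma weight_sum_ge N : (0 < N)%N ->
  2^-1 * (2^-1) `^ (p * (1 - e)) * N%:R `^ (p * (1 - e)) <= \sum_(n < N) `|weight n| `^ p.
Proof.
move=> N0; pose k := N./2.
have kN : (k <= N)%N by rewrite /k; lia.
have pe : 0 <= p * (1 - e) by rewrite mulr_ge0 ?subr_ge0// ltW.
apply: (@le_trans _ _ (\sum_(k <= n < N) `|weight n| `^ p)); last first.
  rewrite -(big_mkord xpredT (fun n => `|weight n| `^ p)).
  rewrite [leRHS](big_cat_nat (n := k))//= lerDr.
  by apply: sumr_ge0 => i _; exact: powR_ge0.
apply: (@le_trans _ _ (\sum_(k <= n < N) (k.+1%:R `^ (1 - (p^-1 + e))) `^ p)); last first.
  apply: ler_sum_nat => i /andP[ki _]; apply: ge0_ler_powR; rewrite ?nnegrE ?powR_ge0 ?(ltW p0)//.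
  by rewrite ger0_norm ?weight_ge0// (le_trans (weight_ge k))// weight_mono.
rewrite sumr_const_nat -[leRHS]mulr_natl -powRrM.
have -> : (1 - (p^-1 + e)) * p = p * (1 - e) - 1.
  by rewrite mulrBl mulrDl mulVf ?gt_eqF//; lra.
rewrite powRB; last by rewrite pnatr_eq0 implybT.
rewrite powRr1//; set z : R := k.+1%:R.
have z0 : 0 < z by rewrite ltr0n.
set q := p * (1 - e) in pe *.
have h1 : 2^-1 <= (N - k)%:R / z.
  rewrite ler_pdivlMr// ler_pdivrMl// /z -natrM ler_nat; rewrite /k; lia.
have h2 : (2^-1) `^ q * N%:R `^ q <= z `^ q.
  rewrite -powRM ?invr_ge0//; apply: ge0_ler_powR => //.
  - by rewrite nnegrE mulr_ge0// invr_ge0.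
  - by rewrite nnegrE ltW.
  - by rewrite ler_pdivrMl// /z -natrM ler_nat /k; lia.
have -> : (N - k)%:R * (z `^ q / z) = (N - k)%:R / z * z `^ q by rewrite mulrAC mulrA.
by rewrite -mulrA; apply: ler_pM; rewrite ?invr_ge0 ?mulr_ge0 ?powR_ge0.
Qed.

(** The sequences [psi] are provided next to [Psi] because the angle coordinates will be adjoined to
    them. *)
Lemma range_embedding : exists (psi : Delta -> nat -> R) (Psi : Delta -> Lp01 p1),
  [/\ equivariant_map Psi,
      forall x y, (`|Psi x - Psi y| `^ p)%:E = lp_dist p (psi x) (psi y),
      exists K : R, forall x s, s \in Dgens m ->
        (lp_dist p (psi (x * s)%g) (psi x) <= K%:E)%E &
      exists2 c : R, 0 < c & forall x y v, (0 < v)%N -> ~ rng v.-1 (Delta_val (x^-1 * y)%g) ->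
        c * v%:R `^ (p * (1 - e)) <= `|Psi x - Psi y| `^ p].
Proof.
have [e' e'inj] := generated_countable (generates_Dgens m).
pose code (bx : bool * Delta) : nat := ((e' bx.2).*2 + bx.1)%N.
have code_inj : injective code.
  move=> [b x] [c y]; rewrite /code /= => E.
  have bc : b = c by case: b E; case: c => //=; lia.
  by rewrite bc in E *; congr (_, _); apply: e'inj; lia.
have H1 := half_lamps1; have HM := half_lampsM; have HV := half_lampsV.
have Ht := half_lamps_ray.
pose act := coset_act code half_lamps.
pose phi := coset_fun code half_lamps ray weight.
pose psi := coset_map code half_lamps ray weight.
have [K HK] := weight_increments.
pose K' := Num.max (4 * `|weight 0| `^ p) (2 * K).
have step x s : s \in Dgens m -> (lp_dist p (psi (x * s)%g) (psi x) <= K'%:E)%E.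
  have lampK t : t = Da m \/ t = Db m -> (lp_dist p (psi (x * t)%g) (psi x) <= K'%:E)%E.
    move=> ht; apply: (@le_trans _ _ (4 * `|weight 0| `^ p)%:E).
      by apply: coset_map_lamp => // b n; exact: half_lamps_gen.
    by rewrite lee_fin le_max lexx.
  rewrite !inE => /or3P[]/eqP->; [|by apply: lampK; left|by apply: lampK; right].
  apply: (@le_trans _ _ (2 * K)%:E); last by rewrite lee_fin le_max lexx orbT.
  apply: coset_map_shift => //.
  by case; [left|right; rewrite /ray invgK].
have fin g : (lp_dist p (psi g) (psi 1%g) < +oo)%E.
  have [n gn] := generates_shorter g (generates_Dgens m).
  move: n g gn; apply: (@shorter_ind _ (Dgens m) (fun g => lp_dist p (psi g) (psi 1%g) < +oo)%E).
    by rewrite lp_distxx// ltry.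
  move=> x s xfin sS; split.
    exact: (lp_dist_fin_trans p1 (le_lt_trans (step x s sS) (ltry _)) xfin).
  have h := step (x * s^-1)%g s sS; rewrite mulgVK lp_distC in h.
  exact: (lp_dist_fin_trans p1 (le_lt_trans h (ltry _)) xfin).
have act1 : act 1%g =1 id by exact: coset_act1.
have actM g h i : act (g * h)%g i = act g (act h i) by exact: coset_actM.
have phiE : phi = psi 1%g by apply/funext => i; rewrite -[RHS]/(phi (act 1^-1%g i)) invg1 act1.
have [|Psi PsiE PsiN] := lp_equivariant_embedding p1 act1 actM (phi := phi).
  move=> g; have := fin g^-1%g; rewrite -phiE.
  by have -> : psi g^-1%g = phi \o act g by apply/funext => i; rewrite -[LHS]/(phi (act (g^-1)^-1%g i)) invgK.
exists psi, Psi; split => //; first by exists K'.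
exists (2^-1 * (2^-1) `^ (p * (1 - e))).
  by rewrite mulr_gt0 ?powR_gt0 ?invr_gt0.
move=> x y v v0 nr.
(* Equivariance reduces the estimate to pairs containing the identity, where [coset_map_ge]
   applies. *)
have inv : `|Psi x - Psi y| = `|Psi (x^-1 * y)%g - Psi 1%g|.
  have [tau [F [[t1 tM tI] PE]]] := PsiE.
  have [_ iso] := tI x.
  by rewrite !PE t1 -{1}(mulVKg x y) (tM x) iso distrC.
rewrite inv; set g := (x^-1 * y)%g.
apply: (le_trans (weight_sum_ge v0)); rewrite -lee_fin PsiN -sumEFin.
have [b Hb] := rng_half_lamps nr v0.
exact: (coset_map_ge p code_inj weight H1 HM HV Ht Hb).
Qed.

End Weights.
End RangeEmbedding.

(** * Interpolated angles of the lamps *)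

Section Angle.
Variables (R : realType) (m : nat -> nat).
Hypothesis m0 : forall s, (0 < m s)%N.
Local Notation lamp := (lamp m).
Implicit Types (g h : lamp) (s : nat) (x z : int).

Section Circle.
Variable (M : nat).
Hypothesis M0 : (0 < M)%N.
Local Notation Zl := 'Z_(4 * M).

Definition turn (y : R) : R := 2 * pi * y / (4 * M)%:R.

Let M1 : (1 < 4 * M)%N. Proof. by lia. Qed.

Lemma turnD a b : turn (a + b) = turn a + turn b.
Proof. by rewrite /turn mulrDr mulrDl. Qed.

Lemma turnN a : turn (- a) = - turn a.
Proof. by rewrite /turn mulrN mulNr. Qed.

Lemma turn_full (n : nat) : turn (n * (4 * M))%:R = pi *+ 2 *+ n.
Proof.
rewrite /turn natrM mulrA mulfK; last by rewrite pnatr_eq0 -lt0n; lia.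
by rewrite -[RHS]mulr_natr -[pi *+ 2]mulr_natl.
Qed.

Lemma trig_periodic (f : R -> R) : f = cos \/ f = sin ->
  forall a n, f (a + pi *+ 2 *+ n) = f a.
Proof. by case=> -> a n; rewrite periodicn//; [exact: cosD2pi|exact: sinD2pi]. Qed.

(** Angles are computed from representatives of residues, so identities modulo [4 * M] hold for them
    only up to full turns, that is, after applying cosine or sine. *)
Lemma trig_natZ (f : R -> R) (n : nat) r : f = cos \/ f = sin ->
  f (turn (n%:R + r)) = f (turn ((n%:R : Zl)%:R + r)).
Proof.
move=> hf; have -> : (n%:R : Zl) = (n %% (4 * M))%N :> nat by rewrite val_Zp_nat.
rewrite {1}(divn_eq n (4 * M)) natrD -addrA turnD turn_full [X in f X = _]addrC.
exact: (trig_periodic hf).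
Qed.

Lemma trig_ZD (f : R -> R) (y z : Zl) r : f = cos \/ f = sin ->
  f (turn ((y + z)%R%:R + r)) = f (turn (y%:R + (z%:R + r))).
Proof.
move=> hf; have -> : (y + z)%R = ((y + z)%N%:R : Zl).
  by rewrite natrD !natr_Zp.
by rewrite -trig_natZ// natrD addrA.
Qed.

Lemma trig_ZN (f : R -> R) (y : Zl) r : f = cos \/ f = sin ->
  f (turn ((- y)%R%:R + r)) = f (turn (- y%:R + r)).
Proof.
move=> hf; have := trig_ZD (- y) y (- y%:R + r) hf.
rewrite addNr [X in _ = X -> _](_ : _ = f (turn ((- y)%R%:R + r))); last first.
  by rewrite (addrA y%:R) subrr add0r.
by move=> <-; rewrite add0r.
Qed.

Lemma trig_Zsign (f : R -> R) (b : bool) (y : Zl) r : f = cos \/ f = sin ->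
  f (turn (((-1) ^+ b * y)%R%:R + r)) = f (turn ((-1) ^+ b * y%:R + r)).
Proof.
by move=> hf; case: b; rewrite ?expr0 ?expr1 ?mul1r ?mulN1r; [exact: trig_ZN|].
Qed.

Lemma val_Z1 : (1%R : Zl) = 1%N :> nat.
Proof. by rewrite -[1%R]/(1%:R) val_Zp_nat// modn_small. Qed.

Lemma trig_intZ (f : R -> R) (n : int) r : f = cos \/ f = sin ->
  f (turn ((n%:~R : Zl)%:R + r)) = f (turn (n%:~R + r)).
Proof.
move=> hf; case: n => n; first by rewrite -!pmulrn -trig_natZ.
rewrite NegzE !intrN trig_ZN// -!pmulrn.
set V : R := (n.+1%:R : Zl)%:R.
have := trig_natZ n.+1 (- V - n.+1%:R + r) hf; rewrite -/V => E.
have -> : - V + r = n.+1%:R + (- V - n.+1%:R + r) by lra.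
by rewrite E; congr (f (turn _)); lra.
Qed.

End Circle.

Lemma trig_lipschitz (f : R -> R) (a b : R) : f = cos \/ f = sin -> `|f a - f b| <= `|a - b|.
Proof.
move=> hf; have h : (f a - f b) ^+ 2 <= (a - b) ^+ 2.
  apply: le_trans (chord_le_sqr (a - b)); rewrite cosB.
  have := cos2Dsin2 a; have := cos2Dsin2 b.
  by have := sqr_ge0 (cos a - cos b); have := sqr_ge0 (sin a - sin b); case: hf => ->; nra.
by rewrite -(@ler_pXn2r _ 2)// ?nnegrE// !real_normK ?num_real.
Qed.

(** From [pi / 2] on the cosine is not positive and the left side is at most 1. Smaller [t] are
    doubled: this multiplies the left side by 4 and the right side by [2 * (1 + cos t) <= 4]. *)
Lemma sqr_le_chord (t : R) : `|t| <= pi -> t ^+ 2 / pi ^+ 2 <= 1 - cos t.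
Proof.
have p0 := pi_gt0 R; have [->|t0] := eqVneq t 0.
  by rewrite cos0 subrr expr2 !mul0r.
rewrite -(cos_norm t) -[t ^+ 2]real_normK ?num_real//.
have : 0 < `|t| by rewrite normr_gt0.
move: `|t| => {t0} t t0 tpi.
have [n hn] : exists n, pi / 2 <= 2 ^+ n * t.
  exists (Num.truncn (pi / 2 / t)).+1; rewrite -ler_pdivrMr//.
  by apply: (le_trans (ltW (truncnS_gt _))); rewrite -natrX ler_nat ltnW// ltn_expl.
elim: n t t0 tpi hn => [|n IH] t t0 tpi hn.
  rewrite expr0 mul1r in hn.
  have c0 : cos t <= 0.
    rewrite -(cos_pihalf R) leNgt ltr_cos -?leNgt// in_itv /=; apply/andP; split; lra.
  have : t ^+ 2 / pi ^+ 2 <= 1 by rewrite ler_pdivrMr ?exprn_gt0// mul1r; nra.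
  lra.
have [th|th] := leP (pi / 2) t.
  have c0 : cos t <= 0.
    rewrite -(cos_pihalf R) leNgt ltr_cos -?leNgt// in_itv /=; apply/andP; split; lra.
  have : t ^+ 2 / pi ^+ 2 <= 1 by rewrite ler_pdivrMr ?exprn_gt0// mul1r; nra.
  lra.
have h : (t *+ 2) ^+ 2 / pi ^+ 2 <= 1 - cos (t *+ 2).
  have tE : t *+ 2 = 2 * t by rewrite mulr_natl.
  by apply: IH; rewrite tE; [lra|lra|rewrite exprS in hn; lra].
rewrite cos_mulr2n in h; set w := (pi ^+ 2)^-1 in h *.
set u := t ^+ 2 * w; have h' : 4 * u <= 2 * (1 - cos t) * (1 + cos t) by rewrite /u; lra.
have := cos_le1 t; have := cos_geN1 t => c1 c2.
have : (1 - cos t) * (1 + cos t) <= (1 - cos t) * 2 by apply: ler_wpM2l; lra.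
lra.
Qed.

Lemma cos_le_between (t u : R) : 0 <= t <= pi -> t <= u <= pi *+ 2 - t -> cos u <= cos t.
Proof.
move=> /andP[t0 tp] /andP[tu ut]; have p0 := pi_gt0 R.
have anti v : t <= v <= pi -> cos v <= cos t.
  by move=> /andP[tv vp]; rewrite leNgt ltr_cos -?leNgt// in_itv /=; apply/andP; split; lra.
have [up|up] := leP u pi; first by apply: anti; rewrite tu.
have -> : cos u = cos (pi *+ 2 - u) by rewrite -[RHS]cosN opprB -[RHS](cosD2pi (u - pi *+ 2)) subrK.
by apply: anti; rewrite mulr2n in ut *; apply/andP; split; lra.
Qed.

Definition clamp s (y : int) : int := Order.max 0 (Order.min y (kk s)%:Z).

(* The two reflections move a vertex of the polygon by one step; the last term
   spreads that step over the [kk s] moves of the cursor between them. *)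
Definition ang g s x : R := turn (m s) ((lc g s x)%:R +
  (-1) ^+ (la g x (+) lb g (x - (kk s)%:Z)) * ((clamp s (x - pos g))%:~R / (2 * kk s)%:R)).

Let kk0 s : (0 < kk s)%N. Proof. by rewrite muln_gt0 expn_gt0. Qed.

(** The reflection takes place where the interpolating term is 0, so the reversal of its sign is not
    seen. *)
Lemma ang_a (f : R -> R) g s x : f = cos \/ f = sin ->
  f (ang (g * lamp_a m)%g s x) = f (ang g s x).
Proof.
move=> hf; have lcE : lc (g * lamp_a m)%g s x = lc g s x.
  by rewrite lcM -[lc (lamp_a m) _ _]/(0 : 'Z_(4 * m s)) mulr0 addr0.
rewrite /ang lcE laM lbM posM -[pos (lamp_a m)]/(0 : int) addr0.
rewrite -[lb (lamp_a m) _]/false -[la (lamp_a m) _]/(x - pos g == 0) addbF.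
have [->|xg] := eqVneq x (pos g); last by rewrite subr_eq0 (negbTE xg) addbF.
rewrite subrr (_ : clamp s 0 = 0) ?mul0r ?mulr0//.
by rewrite /clamp; lia.
Qed.

(** At the affected lamps the interpolating term is half a step [eps / 2]; the switch adds [eps] and
    reverses the term, and [eps - eps / 2 = eps / 2]. *)
Lemma ang_b (f : R -> R) g s x : f = cos \/ f = sin ->
  f (ang (g * lamp_b m)%g s x) = f (ang g s x).
Proof.
move=> hf; rewrite /ang lcM laM lbM posM -[pos (lamp_b m)]/(0 : int) addr0.
rewrite -[la (lamp_b m) _]/false addbF.
rewrite -[lb (lamp_b m) _]/(x - (kk s)%:Z - pos g == 0).
rewrite -[lc (lamp_b m) _ _]/((x - pos g == (kk s)%:Z)%:R : 'Z_(4 * m s)).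
have -> : (x - (kk s)%:Z - pos g == 0) = (x - pos g == (kk s)%:Z) by apply/eqP/eqP; lia.
have [xg|xg] := eqVneq (x - pos g) (kk s)%:Z; last by rewrite mulr0 addr0 addbF.
rewrite xg mulr1 trig_ZD// /sgn; set b := _ (+) _.
have -> : clamp s (kk s) = (kk s)%:Z by rewrite /clamp; lia.
have -> : la g x (+) (lb g (x - (kk s)%:Z) (+) true) = ~~ b.
  by rewrite addbA addbT.
set c : R := _ / _; have cE : c = 2^-1.
  by rewrite /c natrM invfM -pmulrn mulrCA divff ?mulr1// pnatr_eq0 -lt0n.
rewrite cE addrCA -[(-1) ^+ b in X in f (turn _ X) = _]mulr1.
rewrite trig_Zsign// val_Z1//; congr (f (turn _ _)).
by case: (b); rewrite ?expr0 ?expr1 /=; lra.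
Qed.

Lemma ang_tau g s x :
  ang (g * lamp_tau m)%g s x = turn (m s) ((lc g s x)%:R +
  (-1) ^+ (la g x (+) lb g (x - (kk s)%:Z)) * ((clamp s (x - pos g - 1))%:~R / (2 * kk s)%:R)).
Proof.
rewrite /ang lcM laM lbM posM -[lc (lamp_tau m) _ _]/(0 : 'Z_(4 * m s)) mulr0 addr0.
rewrite -[la (lamp_tau m) _]/false -[lb (lamp_tau m) _]/false !addbF.
by congr (turn _ (_ + _ * ((clamp s _)%:~R / _))); rewrite /=; lia.
Qed.

Lemma ang_tau_far g s x : ~~ (1 <= x - pos g <= (kk s)%:Z) ->
  ang (g * lamp_tau m)%g s x = ang g s x.
Proof.
move=> h; rewrite ang_tau /ang; congr (turn _ (_ + _ * ((_)%:~R / _))).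
by rewrite /clamp; lia.
Qed.

Lemma ang_tau_near (f : R -> R) g s x : f = cos \/ f = sin ->
  (4 * m s * kk s)%:R * `|f (ang (g * lamp_tau m)%g s x) - f (ang g s x)| <= pi.
Proof.
move=> hf; have p0 := pi_gt0 R.
have l0 : 0 < (4 * m s * kk s)%:R :> R by rewrite ltr0n muln_gt0 (kk0 s) muln_gt0 m0.
rewrite -ler_pdivlMl//; apply: (le_trans (trig_lipschitz _ _ hf)).
rewrite ang_tau /ang -[turn _ _ - _]/(turn _ _ + - _) -turnN -turnD opprD addrACA subrr add0r.
rewrite -mulrN -mulrDr -mulNr -mulrDl /turn !normrM normr_sign mul1r.
rewrite -rmorphN -rmorphD /= !normfV !normr_nat gtr0_norm//.
set c : R := `|(_)%:~R|; have c1 : c <= 1.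
  rewrite /c -intr_norm -[leRHS]/(1%:~R) ler_int /clamp.
  by have := kk0 s; lia.
rewrite (natrM _ (4 * m s) (kk s)) (natrM _ 2 (kk s)) !invfM.
set a := (kk s)%:R^-1; set b := (4 * m s)%:R^-1.
have a0 : 0 < a by rewrite invr_gt0 ltr0n kk0.
have b0 : 0 < b by rewrite invr_gt0 ltr0n muln_gt0 m0.
have h : 0 < pi * a * b by rewrite !mulr_gt0.
have := ler_wpM2r (ltW h) c1; lra.
Qed.

(** Left multiplication by [g] translates the sites and acts on each circle by a rotation or
    reflection, which preserves chords. The angles of the identity are not all 0 because of the
    interpolating term. *)
Lemma chord_ang g h s u : cos (ang (g * h)%g s u - ang g s u) =
  cos (ang h s (u - pos g) - ang (1%g : lamp) s (u - pos g)).
Proof.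
set x := u - pos g; set b := la g u (+) lb g (u - (kk s)%:Z).
pose r (k : lamp) y : R := (-1) ^+ (la k y (+) lb k (y - (kk s)%:Z)) *
  ((clamp s (y - pos k))%:~R / (2 * kk s)%:R).
have gE : ang g s u = turn (m s) ((lc g s u)%:R + (-1) ^+ b * r 1%g x).
  by rewrite /ang /r /= expr0 mul1r subr0.
have ghE (f : R -> R) q : f = cos \/ f = sin ->
    f (ang (g * h)%g s u + turn (m s) q) =
    f (turn (m s) ((lc g s u)%:R + (-1) ^+ b * ((lc h s x)%:R + r h x) + q)).
  move=> hf; rewrite /ang -turnD lcM /sgn -/b -/x -addrA trig_ZD// addrCA.
  rewrite trig_Zsign//; congr (f (turn _ _)).
  rewrite mulrDr addrCA -!addrA; congr (_ + (_ + (_ + _))).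
  rewrite /r laM lbM posM [RHS]mulrA -signr_addb; congr ((-1) ^+ _ * ((clamp s _)%:~R / _)).
    rewrite /b /x addbACA; congr (_ (+) (_ (+) lb h _)); lia.
  by rewrite /x; lia.
rewrite gE -turnN ghE; last by left.
have -> : (lc g s u)%:R + (-1) ^+ b * ((lc h s x)%:R + r h x) +
   - ((lc g s u)%:R + (-1) ^+ b * r 1%g x) = (-1) ^+ b * ((lc h s x)%:R + r h x - r 1%g x) :> R.
  by lra.
have -> : ang h s x - ang (1%g : lamp) s x = turn (m s) ((lc h s x)%:R + r h x - r 1%g x).
  by rewrite /ang -turnN -turnD; congr turn; rewrite /r /= mulr0n add0r.
by case: (b); rewrite ?expr0 ?expr1 ?mul1r// mulN1r turnN cosN.
Qed.

(** Of the [2 |J|] steps at most one is lost to the reflection carried by [b] and one to the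
    interpolation, hence the predecessor of [|J|]. Since [|J| <= m s], the arc is also at least that
    far from a full turn of [4 * m s] steps. *)
Lemma chord_ge h s u (J : int) : (`|J| <= m s)%N -> lh h s u = (2 * J)%:~R ->
  ((`|J|.-1)%:R / (m s)%:R) ^+ 2 <= 1 - cos (ang h s u - ang (1%g : lamp) s u).
Proof.
move=> Jm hJ; have p0 := pi_gt0 R.
have ms : 0 < (m s)%:R :> R by rewrite ltr0n.
have [J0|Jpos] := posnP `|J|.-1%N.
  by rewrite J0 mul0r expr2 mul0r subr_ge0 cos_le1.
pose eta : int := (-1) ^+ la h u * (lb h (u - (kk s)%:Z))%:R.
have hc : lc h s u = (2 * J + eta)%:~R.
  rewrite intrD -hJ /lh /eta intrM rmorph_sign.
  have -> (c : bool) : (c%:R : int)%:~R = c%:R :> 'Z_(4 * m s) by case: c.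
  by rewrite subrK.
have eta1 : `|eta| <= 1.
  by rewrite /eta normrM normr_sign mul1r; case: (lb h _).
pose r : R := (-1) ^+ (la h u (+) lb h (u - (kk s)%:Z)) *
   ((clamp s (u - pos h))%:~R / (2 * kk s)%:R) - (clamp s u)%:~R / (2 * kk s)%:R.
have r1 : `|r| <= 1.
  have half y : 0 <= ((clamp s y)%:~R / (2 * kk s)%:R : R) <= 2^-1.
    have k0 : 0 < (kk s)%:R :> R by rewrite ltr0n kk0.
    rewrite (natrM _ 2 (kk s)) divr_ge0 ?mulr_ge0 ?(ltW k0) ?ler0z//=; last by rewrite /clamp; lia.
    rewrite ler_pdivrMr ?mulr_gt0// mulrA mulVf// mul1r.
    by rewrite pmulrn ler_int /clamp; lia.
  apply: (le_trans (ler_normB _ _)); rewrite normrM normr_sign mul1r.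
  have /andP[a1 a2] := half (u - pos h); have /andP[b1 b2] := half u.
  by rewrite !ger0_norm//; lra.
have -> : cos (ang h s u - ang (1%g : lamp) s u) = cos (turn (m s) (2 * J%:~R + (eta%:~R + r))).
  have -> : ang h s u - ang (1%g : lamp) s u = turn (m s) ((lc h s u)%:R + r).
    by rewrite /ang -turnN -turnD; congr turn; rewrite /r /= mulr0n add0r expr0 mul1r subr0 addrA.
  by rewrite hc trig_intZ; [rewrite intrD intrM -addrA|exact: m0|left].
set y : R := 2 * J%:~R + _.
have ylo : 2 * (`|J|.-1)%:R <= `|y|.
  have : `|2 * J%:~R : R| <= `|y| + 2.
    rewrite (_ : 2 * J%:~R = y - (eta%:~R + r)); last by rewrite /y addrK.
    apply: (le_trans (ler_normB _ _)); rewrite lerD2l; apply: (le_trans (ler_normD _ _)).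
    have : `|eta%:~R : R| <= 1 by rewrite -intr_norm -[leRHS]/(1%:~R) ler_int.
    by lra.
  rewrite normrM normr_nat -intr_norm -abszE -pmulrn.
  have : (`|J|)%:R = (`|J|.-1)%:R + 1 :> R by rewrite natr1 prednK//; lia.
  by lra.
have yhi : `|y| <= 4 * (m s)%:R - 2 * (`|J|.-1)%:R.
  have : `|y| <= 2 * `|J|%:R + 2.
    apply: (le_trans (ler_normD _ _)); rewrite normrM normr_nat -intr_norm -abszE -pmulrn.
    rewrite lerD2l; apply: (le_trans (ler_normD _ _)).
    have : `|eta%:~R : R| <= 1 by rewrite -intr_norm -[leRHS]/(1%:~R) ler_int.
    by lra.
  have : (`|J|)%:R = (`|J|.-1)%:R + 1 :> R by rewrite natr1 prednK//; lia.
  have : (`|J|)%:R <= (m s)%:R :> R by rewrite ler_nat.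
  by lra.
pose t : R := pi * (`|J|.-1)%:R / (m s)%:R.
have J1m : (`|J|.-1)%:R <= (m s)%:R :> R by rewrite ler_nat; lia.
have tpi : 0 <= t <= pi.
  rewrite /t divr_ge0 ?mulr_ge0 ?(ltW p0)//= ler_pdivrMr// ler_pM2l//.
have -> : ((`|J|.-1)%:R / (m s)%:R) ^+ 2 = t ^+ 2 / pi ^+ 2 :> R.
  by rewrite /t -expr_div_n; congr (_ ^+ 2); rewrite mulrAC -[pi * _]mulrC mulfK ?gt_eqF.
apply: (@le_trans _ _ (1 - cos t)).
  by apply: sqr_le_chord; rewrite ger0_norm; case/andP: tpi.
rewrite lerD2l lerN2 -[cos (turn _ _)]cos_norm.
have -> : `|turn (m s) y| = pi * `|y| / (2 * (m s)%:R).
  rewrite /turn !normrM (gtr0_norm p0) normfV !normr_nat (natrM _ 4 (m s)) !invfM; lra.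
apply: cos_le_between => //; rewrite /t invfM; set a := (m s)%:R^-1.
have pa : 0 < pi * a by rewrite mulr_gt0 ?invr_gt0.
have e : pi * a * (m s)%:R = pi by rewrite mulfVK ?gt_eqF.
have h1 := ler_wpM2l (ltW pa) ylo; have h2 := ler_wpM2l (ltW pa) yhi.
by apply/andP; split; lra.
Qed.

End Angle.

(** * Discrete tori in the group *)

Section Tori.
Variables (R : realType) (m : nat -> nat).
Hypothesis m0 : forall s, (0 < m s)%N.
Hypothesis m2 : forall s, (m s ^ 2 <= 4 ^ s)%N.
Local Notation Delta := (Delta m).
Local Notation S0 := (Dgens m).
Local Notation len := (word_length R S0).

Lemma reach_len n (y : Delta) (w : lamp m) : Delta_val y = w -> reach n w -> len y <= n%:R.
Proof.
move=> yw [z zw zn]; apply: word_length_le; first exact: generates_Dgens.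
by rewrite (_ : y = z)//; apply: val_inj; change (Delta_val y = Delta_val z); rewrite yw zw.
Qed.

Lemma trig_ang_step (f : R -> R) (x t : Delta) s u : f = cos \/ f = sin -> t \in S0 ->
  (4 * m s * kk s)%:R * `|f (ang R (x * t)%g s u) - f (ang R x s u)| <= pi.
Proof.
move=> hf; rewrite !inE => /or3P[]/eqP->.
- exact: ang_tau_near.
- by rewrite valDM ang_a// subrr normr0 mulr0 pi_ge0.
- by rewrite valDM ang_b// subrr normr0 mulr0 pi_ge0.
Qed.

Lemma trig_ang_len (f : R -> R) (x y : Delta) s u : f = cos \/ f = sin ->
  (4 * m s * kk s)%:R * `|f (ang R x s u) - f (ang R y s u)| <= pi * len (x^-1 * y)%g.
Proof.
move=> hf; set l : R := (_)%:R.
have := @step_lipschitz R Delta S0 R^o (generates_Dgens m) (fun x => l * f (ang R x s u)) pi (pi_ge0 R).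
move=> /(_ _ x y); rewrite -mulrBr normrM (ger0_norm (ler0n _ _ : 0 <= l)); apply.
move=> z t tS; rewrite -mulrBr normrM (ger0_norm (ler0n _ _ : 0 <= l)).
exact: trig_ang_step.
Qed.

Section Torus.
Variable s : nat.
Local Notation n := (m s ^ 2)%N.
Local Notation Zl := 'Z_(4 * m s).
Local Notation V := 'rV[Zl]_n.
Implicit Types v w : V.

Definition coord v (x : int) : int :=
  if x is Posz k then (if insub k is Some j then (v 0 j)%:Z else 0) else 0.

Let l1 : (1 < 4 * m s)%N. Proof. by have := m0 s; lia. Qed.

Lemma coord_ord v (j : 'I_n) : coord v (j : nat)%:Z = (v 0 j)%:Z.
Proof. by rewrite /coord insubT //= => h; congr (Posz (v 0 _)); exact: val_inj. Qed.

Lemma coord_out v x : coord v x != 0 -> 0 <= x < (4 ^ s)%N%:Z.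
Proof.
case: x => [k|k] //=; case: insubP => //= j kn _ _.
by have := leq_trans kn (m2 s); lia.
Qed.

Lemma coordD v w x : (coord (v + w) x)%:~R = (coord v x)%:~R + (coord w x)%:~R :> Zl.
Proof.
case: x => [k|k] /=; last by rewrite addr0.
by case: insubP => [j _ _|_] /=; rewrite ?addr0// mxE -!pmulrn !natr_Zp.
Qed.

(** Coordinates count double steps, so [H] is not injective; what the cotype argument needs is that
    increments depend only on [w]. *)
Lemma torus_map : exists H : V -> Delta,
  (forall v, Delta_val (H v) = rots m s (coord v)) /\
  (forall v w, ((H v)^-1 * H (v + w))%g = H w).
Proof.
have /boolp.choice[H HE] : forall v, exists y : Delta, Delta_val y = rots m s (coord v).
  move=> v; have [|y yE _] := @reach_rots_nneg m s (coord v) (4 * m s) _ (@coord_out v).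
    move=> x; rewrite /coord; case: x => // k; case: insubP => //= j _ _.
    have := ltn_ord (v 0 j); rewrite [X in (_ < X)%N -> _](Zp_cast l1) => vj.
    exact: ltnW.
  by exists y.
exists H; split=> // v w; apply: val_inj.
change (Delta_val ((H v)^-1 * H (v + w))%g = Delta_val (H w)).
rewrite valDM valDV !HE rotsV rotsM; apply: lamp_eq => //= t x.
case: eqP => [->|//]; rewrite !intrM intrD rmorphN /= coordD addrA addNr add0r.
by [].
Qed.

Definition unit_vec (j : 'I_n) : V := \row_i (i == j)%:R.

Lemma subset_sums_unit (js : seq 'I_n) v : uniq js ->
  v \in subset_sums [seq unit_vec j | j <- js] ->
  forall i, v 0 i = 0 \/ (v 0 i = 1 /\ i \in js).
Proof.
elim: js v => [|j js IH] v /=; first by rewrite inE => _ /eqP-> i; left; rewrite mxE.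
move=> /andP[jjs ujs]; rewrite mem_cat => /orP[vs|/mapP[w ws ->]] i.
  by have [->|[-> ijs]] := IH v ujs vs i; [left|right; rewrite inE ijs orbT].
rewrite !mxE inE; have [ij|ij] /= := eqVneq i j.
  have [->|[_ ijs]] := IH w ujs ws i; first by right; rewrite add0r.
  by rewrite -ij ijs in jjs.
by rewrite addr0; exact: IH.
Qed.

Lemma unit_vec_mulrn j k i : (unit_vec j *+ k) 0 i = ((i == j) * k)%:R :> Zl.
Proof.
elim: k => [|k IH]; first by rewrite mulr0n muln0 mxE.
by rewrite mulrSr mxE IH /unit_vec mxE mulnS -natrD addnC.
Qed.

Lemma val_natZ k : (k < 4 * m s)%N -> (k%:R : Zl) = k :> nat.
Proof. by move=> kl; rewrite val_Zp_nat// modn_small. Qed.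

Lemma torus_step_len (y : Delta) v : Delta_val y = rots m s (coord v) ->
  v \in subset_sums [seq unit_vec j | j <- enum 'I_n] -> len y <= (20 * 4 ^ s)%:R.
Proof.
move=> yE vs; apply: reach_len yE _; rewrite -[(20 * 4 ^ s)%N]muln1.
apply: reach_rots_nneg => x; last exact: coord_out.
case: x => // k /=; case: insubP => //= j _ _.
have [->|[-> _]] := subset_sums_unit (enum_uniq _) vs j; first by [].
by rewrite (val_natZ (k := 1)).
Qed.

(** A half turn of lamp [j] negates both the cosine and the sine of its angle. Each of them,
    multiplied by [4 * m s * kk s], is Lipschitz with constant [pi], and [|cos| + |sin| >= 1]. *)
Lemma torus_half_len (y : Delta) j : Delta_val y = rots m s (coord (unit_vec j *+ m s)) ->
  (4 * m s * kk s)%:R <= pi * len y.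
Proof.
move=> yE; have ml : (m s < 4 * m s)%N by have := m0 s; lia.
set l : R := (_)%:R; set P := pi * _; set u : int := (j : nat)%:Z.
have cE : coord (unit_vec j *+ m s) u = (m s)%:Z.
  by rewrite coord_ord unit_vec_mulrn eqxx mul1n val_natZ.
pose b := ang R (1%g : lamp m) s u.
have aE : ang R y s u = b + pi.
  have lcE : lc y s u = (2 * (m s)%:Z)%:~R.
    rewrite yE -cE; set z := (2 * _)%:~R.
    by change ((if s == s then z else 0) = z); rewrite eqxx.
  rewrite /ang lcE [in LHS]yE /b /ang.
  rewrite -[lc (1%g : lamp m) s u]/(0 : Zl) /=.
  have -> : (2 * (m s)%:Z)%:~R = (2 * m s)%N%:R :> Zl by rewrite -PoszM.
  rewrite val_natZ; last by have := m0 s; lia.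
  rewrite mulr0n add0r turnD addrC; congr (_ + _).
  rewrite /turn natrM (natrM _ 4 (m s)) -[4%:R]/(4 : R).
  have : pi * ((m s)%:R / (m s)%:R) = pi :> R by rewrite divff ?mulr1// pnatr_eq0 -lt0n.
  by rewrite invfM; lra.
have H f : f = cos \/ f = sin -> f (b + pi) = - f b -> 2 * l * `|f b| <= P.
  move=> hf fE; have := @trig_ang_len f 1%g y s u hf.
  rewrite invg1 mul1g aE fE valD1 -/b opprK -/l -/P; apply: le_trans.
  have -> : `|f b + f b| = 2 * `|f b| by rewrite -mulr2n normrMn mulr_natl.
  lra.
have l0 : 0 <= l by exact: ler0n.
have h1 := H cos (or_introl erefl) (cosDpi b); have h2 := H sin (or_intror erefl) (sinDpi b).
have := cos2Dsin2 b; rewrite -[cos b ^+ 2]real_normK ?num_real// -[sin b ^+ 2]real_normK ?num_real//.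
have c0 := normr_ge0 (cos b); have s0 := normr_ge0 (sin b).
have c1 : `|cos b| <= 1 by rewrite ler_norml cos_geN1 cos_le1.
have s1 : `|sin b| <= 1 by rewrite ler_norml sin_geN1 sin_le1.
move: h1 h2 c0 s0 c1 s1; move: `|cos b| `|sin b| => c d h1 h2 c0 s0 c1 s1 e.
by nra.
Qed.

End Torus.
End Tori.

(** * Upper bound for the exponent, [p <= 2] *)

Section CotypeObstruction.
Variables (R : realType) (m : nat -> nat).
Hypothesis m0 : forall s, (0 < m s)%N.
Hypothesis m2 : forall s, (m s ^ 2 <= 4 ^ s)%N.
Local Notation Delta := (Delta m).
Local Notation S0 := (Dgens m).
Local Notation len := (word_length R S0).

Lemma powR_nat_unbounded (t K : R) : 0 < t -> exists s, K < (4 ^ s)%:R `^ t.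
Proof.
move=> t0; pose z := `|K| `^ t^-1; exists (Num.truncn z).+1.
apply: (le_lt_trans (ler_norm K)).
have -> : `|K| = z `^ t by rewrite /z -powRrM mulVf ?lt0r_neq0// powRr1.
have z0 : 0 <= z by exact: powR_ge0.
apply: gt0_ltr_powR; rewrite ?nnegrE//.
by apply: (lt_le_trans (truncnS_gt z)); rewrite ler_nat ltnW// ltn_expl.
Qed.

(** On the left of the cotype inequality all increments are half turns, on the right all are subset
    sums, of length at most [20 * 4 ^ s]. The [m ^ 2] directions cancel the factor [m ^ 2], and the
    number of points of the torus cancels as well. *)
Lemma torus_cotype (p : R) (p1 : 1 <= p) : p <= 2 -> exists2 C : R, 0 < C &
  forall (Psi : Delta -> Lp01 p1) (L a c : R), 0 <= L -> 0 <= a -> 0 <= c ->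
    (forall x y, `|Psi x - Psi y| <= L * len (x^-1 * y)%g) ->
    (forall x y, x != y -> c * (len (x^-1 * y)%g) `^ a <= `|Psi x - Psi y|) ->
  forall s, c * ((4 * m s * kk s)%:R / pi) `^ a <= C * L * (20 * 4 ^ s)%:R.
Proof.
move=> p2; have [C C0 HC] := cotype_Lp p1 p2.
have p0 : 0 < p by rewrite (lt_le_trans ltr01).
exists (C `^ p^-1); first exact: powR_gt0.
move=> Psi L a c L0 a0 c0 HL Hc s; pose n := (m s ^ 2)%N.
have [H [HE HD]] := torus_map m0 m2 s.
pose r := [seq unit_vec (s := s) (m := m) j | j <- enum 'I_n].
have rn : size r = n by rewrite size_map -cardE card_ord.
set l : R := (4 * m s * kk s)%:R; set N : R := (20 * 4 ^ s)%:R.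
have l0 : 0 < l by rewrite ltr0n /kk !muln_gt0 m0 expn_gt0.
have pi0 := pi_gt0 R.
have := HC _ (m s) r (fun x => Psi (H x)); rewrite rn => /(_ (leqnn _)) h.
pose A := (c * (l / pi) `^ a) `^ p; pose B := (L * N) `^ p.
pose T := #|{: 'rV['Z_(4 * m s)]_n}|; have T0 : 0 < T%:R :> R.
  by rewrite ltr0n; apply/card_gt0P; exists 0.
have stepE x v : (H x != H (x + v)) = (H v != 1%g).
  by rewrite -(HD x v) mulg_eq1 eqg_inv.
have lo : (m s)%:R ^+ 2 * (T%:R * A) <=
    \sum_(e <- r) \sum_x `|Psi (H (x + e *+ m s)) - Psi (H x)| `^ p.
  have -> : (m s)%:R ^+ 2 * (T%:R * A) = \sum_(j <- enum 'I_n) (T%:R * A).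
    by rewrite big_const_seq count_predT iter_addr_0 -cardE card_ord -[RHS]mulr_natl natrX.
  rewrite /r [leRHS]big_map; apply: ler_sum => j _.
  have -> : T%:R * A = \sum_(x : 'rV['Z_(4 * m s)]_n) A by rewrite sumr_const -[RHS]mulr_natl.
  apply: ler_sum => x _; rewrite distrC; apply: ge0_ler_powR.
  - exact: ltW.
  - by rewrite nnegrE mulr_ge0// powR_ge0.
  - by rewrite nnegrE.
  have half := torus_half_len R m0 (HE (unit_vec j *+ m s)).
  have neq : H x != H (x + unit_vec j *+ m s).
    rewrite stepE; apply/eqP => H1; move: half; rewrite H1 word_length1; last exact: generates_Dgens.
    by rewrite mulr0 leNgt l0.
  apply: le_trans (Hc _ _ neq); rewrite HD ler_wpM2l//.
  apply: ge0_ler_powR => //.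
  - by rewrite nnegrE divr_ge0// ltW.
  - by rewrite nnegrE; have := le_trans (ltW l0) half; rewrite pmulr_rge0.
  - by rewrite ler_pdivrMr// mulrC.
have hi : 2^-1 ^+ n * \sum_(v <- subset_sums r)
    \sum_x `|Psi (H (x + v)) - Psi (H x)| `^ p <= T%:R * B.
  rewrite exprVn ler_pdivrMl ?exprn_gt0//.
  have -> : 2 ^+ n * (T%:R * B) = \sum_(v <- subset_sums r) (T%:R * B).
    by rewrite big_const_seq count_predT iter_addr_0 size_subset_sums rn -[RHS]mulr_natl natrX.
  rewrite big_seq [leRHS]big_seq; apply: ler_sum => v vr.
  have -> : T%:R * B = \sum_(x : 'rV['Z_(4 * m s)]_n) B by rewrite sumr_const -[RHS]mulr_natl.
  apply: ler_sum => x _; rewrite distrC; apply: ge0_ler_powR.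
  - exact: ltW.
  - by rewrite nnegrE.
  - by rewrite nnegrE mulr_ge0// ler0n.
  apply: (le_trans (HL _ _)); rewrite HD ler_wpM2l//.
  exact: (torus_step_len R m0 m2 (HE v) vr).
have m20 : 0 < (m s)%:R ^+ 2 :> R by rewrite exprn_gt0// ltr0n.
have : A <= C * B.
  rewrite -(ler_pM2l T0) -(ler_pM2l m20); apply: (le_trans lo); apply: (le_trans h).
  have := ler_wpM2l (ltW (mulr_gt0 C0 m20)) hi; lra.
rewrite /A /B.
have -> : C * (L * N) `^ p = (C `^ p^-1 * (L * N)) `^ p.
  by rewrite [RHS]powRM ?powR_ge0 ?mulr_ge0 ?ler0n// -powRrM mulVf ?lt0r_neq0// powRr1// ltW.
move=> hAB; rewrite -mulrA leNgt; apply/negP => /(gt0_ltr_powR p0).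
rewrite !nnegrE !mulr_ge0 ?powR_ge0 ?ler0n// => /(_ isT isT).
by rewrite ltNge hAB.
Qed.

Lemma alpha_star_Delta_le (p : R) (p1 : 1 <= p) (theta : R) (S : seq Delta) :
  generates S -> p <= 2 -> 0 <= theta -> (forall s, (4 ^ s)%:R `^ theta <= 2 * (m s)%:R :> R) ->
  (alpha_star S (Lp01 p1) <= ((1 + theta)^-1)%:E)%E.
Proof.
move=> gS p2 th0 mth; apply: (@alpha_star_le R Delta S S0 _ gS (generates_Dgens m)).
move=> Psi L HL a c a0 c0 Hc; have [C C0 HC] := torus_cotype p1 p2.
have t1 : 0 < 1 + theta by rewrite ltr_pwDl.
rewrite leNgt; apply/negP => ha; pose t := (1 + theta) * a - 1.
have t0 : 0 < t by rewrite subr_gt0 -ltr_pdivrMl// mulr1.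
have [s] := powR_nat_unbounded (C * `|L| * 20 / c) t0; apply/negP; rewrite -leNgt.
have len0 x y : 0 <= len (x^-1 * y)%g.
  by have [n [-> _ _]] := word_lengthP R (x^-1 * y)%g (generates_Dgens m); exact: ler0n.
have := HC Psi `|L| a c (normr_ge0 _) a0 (ltW c0) _ Hc s.
move=> /(_ (fun x y => le_trans (HL x y) (ler_wpM2r (len0 x y) (ler_norm L)))).
set q : R := (4 ^ s)%:R in mth *; have q0 : 0 < q by rewrite ltr0n expn_gt0.
rewrite ler_pdivlMr// (natrM _ 20) -/q => h.
rewrite -(ler_pM2r q0) -[leRHS]mulrA; apply: le_trans (h).
rewrite [q `^ t * c]mulrC -mulrA ler_pM2l//.
have -> : q `^ t * q = (q `^ (1 + theta)) `^ a.
  by rewrite -powRrM -[X in _ * X](powRr1 (ltW q0)) -powRD ?(gt_eqF q0) ?implybT// /t subrK.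
apply: ge0_ler_powR => //; rewrite ?nnegrE ?powR_ge0 ?divr_ge0 ?ler0n ?pi_ge0//.
rewrite powRD ?(gt_eqF q0) ?implybT// (powRr1 (ltW q0)) ler_pdivlMr ?pi_gt0//.
have := ler_wpM2l (ltW q0) (mth s); rewrite -/q => h1.
(* The crude [pi <= 4] is enough: [4 * m s * kk s = 8 * q * m s] is at least
   [4 * q ^ (1 + theta)]. *)
have : q * q `^ theta * pi <= q * q `^ theta * 4.
  rewrite ler_wpM2l ?mulr_ge0 ?powR_ge0 ?(ltW q0)//; have := pihalf_lt2 R; lra.
have -> : (4 * m s * kk s)%:R = 8 * (q * (m s)%:R) :> R.
  by rewrite /kk (natrM _ (4 * m s)) (natrM _ 4) (natrM _ 2) -/q; lra.
lra.
Qed.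

End CotypeObstruction.

(** * Word length in terms of the range and the rotations *)

Lemma bernoulli (R : realType) (d : R) (n : nat) : 0 <= d -> 1 + n%:R * d <= (1 + d) ^+ n.
Proof.
move=> d0; elim: n => [|n IH]; first by rewrite mul0r addr0 expr0.
rewrite exprS -natr1; have := ler_wpM2l (addr_ge0 ler01 d0) IH.
have : 0 <= n%:R * d * d by rewrite !mulr_ge0.
by lra.
Qed.

(** The number of scales is logarithmic in [v]; Bernoulli's inequality for powers of [4 ^ e] absorbs
    it into [v ^ e]. *)
Lemma scales_le_powR (R : realType) (e : R) : 0 < e -> exists2 C : R, 0 < C &
  forall v S : nat, (0 < v)%N -> (forall s, (s < S)%N -> (4 ^ s <= v)%N) ->
  S.+1%:R <= C * v%:R `^ e.
Proof.
move=> e0; pose d : R := 4 `^ e - 1.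
have d0 : 0 < d.
  by rewrite subr_gt0 -[ltLHS](powRr0 4) /powR pnatr_eq0 /= ltr_expR ltr_pM2r// ln_gt0// ltr1n.
have id0 : 0 < d^-1 by rewrite invr_gt0.
exists (2 + d^-1); first lra.
move=> v S v0 Sv; have ve : 1 <= v%:R `^ e.
  apply: (@le_trans _ _ (1 `^ e)); first by rewrite powR1.
  by apply: ge0_ler_powR; rewrite ?nnegrE ?(ltW e0) ?ler0n ?ler1n.
case: S Sv => [|S] Sv.
  by have := ler_wpM2l (ltW id0) ve; lra.
have h : 1 + S%:R * d <= v%:R `^ e.
  apply: (le_trans (bernoulli S (ltW d0))); rewrite /d addrC subrK -powR_mulrn ?powR_ge0//.
  rewrite -powRrM mulrC powRrM powR_mulrn//.
  apply: ge0_ler_powR; rewrite ?nnegrE ?exprn_ge0 ?ler0n ?(ltW e0)//.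
  by rewrite -natrX ler_nat Sv.
have S0 : 0 <= S%:R :> R by [].
have iid : d^-1 * d = 1 by rewrite mulVf// gt_eqF.
rewrite -!natr1; have a1 := ler_wpM2l (ltW id0) h.
have : d^-1 * (S%:R * d) = S%:R by rewrite mulrCA iid mulr1.
lra.
Qed.

Section Lengths.
Variables (R : realType) (m : nat -> nat).
Hypothesis m0 : forall s, (0 < m s)%N.
Local Notation Delta := (Delta m).
Local Notation len := (word_length R (Dgens m)).

Lemma centered_double (M : nat) (J : int) : (0 < M)%N ->
  exists2 K : int, (`|K| <= M)%N & (2 * K)%:~R = (2 * J)%:~R :> 'Z_(4 * M).
Proof.
move=> M0; exists (((J + M%:Z) %% (2 * M%:Z))%Z - M%:Z).
  have h1 := modz_ge0 (J + M%:Z) (_ : 2 * M%:Z != 0).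
  have h2 := ltz_mod (J + M%:Z) (_ : 2 * M%:Z != 0).
  by lia.
have := divz_eq (J + M%:Z) (2 * M%:Z).
set q := (_ %/ _)%Z; set r := (_ %% _)%Z => E.
have -> : 2 * J = 2 * (r - M%:Z) + q * (4 * M)%N%:Z by lia.
rewrite [RHS]intrD [X in _ = _ + X]intrM -[(4 * M)%N%:Z%:~R]/((4 * M)%:R : 'Z_(4 * M)).
by rewrite pchar_Zp ?mulr0 ?addr0//; lia.
Qed.

Definition window_max (J : int -> int) (s v i : nat) : nat :=
  \max_(j < 4 ^ s) absz (J ((i * 4 ^ s + j)%N%:Z - v%:Z)%R).

(** Up to a constant, the letters that [reach_windows] spends on turning, apart from travel. *)
Definition window_sum (J : int -> int) (s v : nat) : nat :=
  \sum_(i < (2 * v) %/ 4 ^ s + 1) 4 ^ s * window_max J s v i.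

(** Each of the scales present costs at most [40 + 8 = 48] times [B], for turning and for travel.
    [B] is left free because the window sums are bounded in two ways later: by the lamp sizes alone,
    and by the angles. *)
Lemma length_le (e : R) : 0 < e -> exists2 C : R, 0 < C &
  forall (y : Delta) (v : nat), (0 < v)%N -> rng v y -> exists J : nat -> int -> int,
    [/\ forall s x, (`|J s x| <= m s)%N, forall s x, lh y s x = (2 * J s x)%:~R &
     forall B : R, v%:R <= B -> (forall s, (4 ^ s <= v)%N -> (window_sum (J s) s v)%:R <= B) ->
       len y <= C * v%:R `^ e * B].
Proof.
move=> e0; have [C C0 HC] := scales_le_powR e0; exists (48 * C); first by rewrite mulr_gt0.
move=> y v v0 yv; have [_ ev] := Delta_rng y.
have /boolp.choice[J0 HJ0] : forall sx : nat * int, exists K : int,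
    [/\ (`|K| <= m sx.1)%N, lh y sx.1 sx.2 = (2 * K)%:~R & lh y sx.1 sx.2 = 0 -> K = 0].
  move=> [s x] /=; have [h|h] := eqVneq (lh y s x) 0.
    by exists 0; split=> //; rewrite h mulr0.
  have [J hJ] := ev s x; have [K Km KJ] := centered_double J (m0 s).
  by exists K; split; [|rewrite hJ KJ|move=> h'; rewrite h' eqxx in h].
exists (fun s x => J0 (s, x)); split=> [s x|s x|B vB TB].
- by have [] := HJ0 (s, x).
- by have [] := HJ0 (s, x).
pose J s x := J0 (s, x).
have [S vS Sv] : exists2 S, (v <= 4 ^ S)%N & forall s, (s < S)%N -> (4 ^ s <= v)%N.
  have ex : exists S, (v <= 4 ^ S)%N by exists v; rewrite ltnW// ltn_expl.
  exists (ex_minn ex); first by case: ex_minnP.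
  by move=> s; case: ex_minnP => S _ mn sS; rewrite leqNgt; apply/negP => /ltnW /mn; lia.
have := @length_bound m v S y J (fun s i => window_max (J s) s v i) yv vS Sv.
move=> /(_ (fun s x => let: And3 _ h _ := HJ0 (s, x) in h)).
move=> /(_ (fun s x => let: And3 _ _ h := HJ0 (s, x) in h)) h.
apply: (@le_trans _ _ (17 * v + \sum_(s < S) (40 * window_sum (J s) s v + 8 * v))%:R).
  apply: reach_len => //; apply: reach_le (h _).
    rewrite leq_add2l; apply: leq_sum => s _; rewrite leq_add2r big_distrr /=.
    by apply: leq_sum => i _; lia.
  move=> s i j _ jl; exact: (@leq_bigmax _
     (fun j : 'I_(4 ^ s) => absz (J s ((i * 4 ^ s + j)%N%:Z - v%:Z)%R)) (Ordinal jl)).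
rewrite natrD natr_sum natrM.
have B0 : 0 <= B by rewrite (le_trans _ vB).
apply: (@le_trans _ _ (17 * B + \sum_(s < S) (48 * B))).
  apply: lerD; first by rewrite ler_wpM2l.
  apply: ler_sum => s _; rewrite natrD !natrM.
  have : (window_sum (J s) s v)%:R <= B by exact: TB (Sv s (ltn_ord s)).
  lra.
rewrite sumr_const card_ord -[_ *+ S]mulr_natl.
have := HC v S v0 Sv; rewrite -natr1 => h1; have := ler_wpM2r B0 h1; lra.
Qed.

End Lengths.

(** * Lower bound for the equivariant exponent *)

Section SharpBound.
Variables (R : realType) (m : nat -> nat).
Hypothesis m0 : forall s, (0 < m s)%N.
Local Notation Delta := (Delta m).
Local Notation len := (word_length R (Dgens m)).

Lemma exact_range (y : Delta) : y != 1%g -> exists v, [/\ (0 < v)%N, rng v y & ~ rng v.-1 y].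
Proof.
move=> y1; have [[v0 yv0] _] := Delta_rng y.
have ex : exists v, `[< rng v y >] by exists v0; exact/asboolP.
case: (ex_minnP ex) => v /asboolP yv mn; exists v.
have vpos : (0 < v)%N.
  rewrite lt0n; apply/eqP => v0'; rewrite v0' in yv; case/eqP: y1; apply: val_inj.
  by change (Delta_val y = Delta_val 1%g); rewrite (rng0 yv) valD1.
by split=> // /asboolP /mn; lia.
Qed.

Lemma window_sum_le (J : int -> int) (s v M : nat) :
  (forall x, (`|J x| <= M)%N) -> (4 ^ s <= v)%N -> (window_sum J s v <= 3 * v * M)%N.
Proof.
move=> JM sv; rewrite /window_sum.
apply: (@leq_trans (\sum_(i < (2 * v) %/ 4 ^ s + 1) 4 ^ s * M)).
  by apply: leq_sum => i _; rewrite leq_mul2l; apply/orP; right; apply/bigmax_leqP.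
rewrite sum_nat_const card_ord mulnA leq_mul2r; apply/orP; right.
rewrite mulnDl mul1n; have := leq_divM (2 * v) (4 ^ s).
by move: (_ %/ _ * _)%N => u; lia.
Qed.

Lemma powR_root_le (p c t z : R) : 1 <= p -> 0 <= c -> 0 <= t -> 0 <= z ->
  c * t `^ p <= z `^ p -> c `^ p^-1 * t <= z.
Proof.
move=> p1 c0 t0 z0; have p0 : 0 < p by rewrite (lt_le_trans ltr01).
have -> : c * t `^ p = (c `^ p^-1 * t) `^ p.
  by rewrite [RHS]powRM ?powR_ge0// -powRrM mulVf ?lt0r_neq0// powRr1.
move=> h; rewrite leNgt; apply/negP => /(gt0_ltr_powR p0).
by rewrite !nnegrE z0 mulr_ge0 ?powR_ge0// => /(_ isT isT); rewrite ltNge h.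
Qed.

Lemma powR_le_bound (p K z : R) : 1 <= p -> 0 <= z -> z `^ p <= K -> z <= Num.max 1 K.
Proof.
move=> p1 z0 zK; rewrite le_max; have [//|z1] := leP z 1; apply/orP; right.
by apply: le_trans zK; rewrite -[leLHS]powRr1// ler_powR// ltW.
Qed.

Lemma alpha_sharp_Delta_ge (p : R) (p1 : 1 <= p) (theta : R) (S : seq Delta) :
  generates S -> 0 <= theta -> (forall s, (m s)%:R <= (4 ^ s)%:R `^ theta :> R) ->
  (((1 + theta)^-1)%:E <= alpha_sharp S (Lp01 p1))%E.
Proof.
move=> gS th0 mth; have EFinI (u v : R) : (u%:E <= v%:E)%E -> u <= v by rewrite lee_fin.
have t1 : 0 < 1 + theta by rewrite ltr_pwDl.
apply: (@le_alpha R Delta S (Dgens m) _ gS (generates_Dgens m)); first by rewrite invr_gt0.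
move=> a a0 ab; have a1 : 0 < 1 + a by rewrite ltr_pwDl.
have h0 : 0 < 1 - a * (1 + theta) by rewrite subr_gt0 -ltr_pdivlMr// mul1r.
(* Solves [a * (1 + theta + e) = 1 - e]: the power of [v] in the length bound, raised to [a], equals
   the one detected by the embedding. *)
pose e := (1 - a * (1 + theta)) / (1 + a).
have e0 : 0 < e by rewrite divr_gt0.
have e1 : e <= 1.
  by rewrite ler_pdivrMr// mul1r; have := mulr_ge0 a0 (ltW t1); lra.
have ae : a * (1 + theta + e) = 1 - e.
  have : e * (1 + a) = 1 - a * (1 + theta) by rewrite divfK ?gt_eqF.
  lra.
have [psi [Psi [eqv dE [K HK] [c c0 Hc]]]] := range_embedding m p1 e0 e1.
exists Psi; split=> //; split.
  exists (Num.max 1 K) => x s sS; apply: (powR_le_bound (p1)) => //.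
  by have := HK x s sS; rewrite -dE => /EFinI.
have [C C0 HC] := @length_le R m m0 e e0.
have D0 : 0 < (3 * C) `^ a by rewrite powR_gt0 ?mulr_gt0.
exists (c `^ p^-1 / (3 * C) `^ a); first by apply: divr_gt0 => //; exact: powR_gt0.
move=> x y xy; have g1 : (x^-1 * y)%g != 1%g by rewrite mulg_eq1 eqg_inv.
have [v [v0 gv gv']] := exact_range g1.
have := Hc x y v v0 gv'; rewrite [p * _]mulrC powRrM => h.
have v1 : 1 <= v%:R :> R by rewrite ler1n.
have {}h : c `^ p^-1 * v%:R `^ (1 - e) <= `|Psi x - Psi y|.
  exact: powR_root_le p1 (ltW c0) (powR_ge0 _ _) (normr_ge0 _) h.
apply: le_trans h; rewrite -mulrA ler_pM2l ?powR_gt0// mulrC ler_pdivrMr// mulrC -ae.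
have [J [JM _ HB]] := HC _ _ v0 gv.
have vth : v%:R * v%:R `^ theta = v%:R `^ (1 + theta) :> R.
  by rewrite powRD ?pnatr_eq0 -?lt0n ?v0 ?implybT// powRr1.
have {HB} : len (x^-1 * y)%g <= C * v%:R `^ e * (3 * (v%:R * v%:R `^ theta)).
  apply: HB.
    have : 1 <= v%:R `^ theta by rewrite -[leLHS](powRr0 v%:R) ler_powR.
    by have := ler0n R v; nra.
  move=> s sv; apply: (@le_trans _ _ (3 * v * m s)%:R).
    by rewrite ler_nat; exact: window_sum_le.
  rewrite (natrM _ (3 * v)) (natrM _ 3) [leRHS]mulrA ler_wpM2l// ?mulr_ge0//.
  by apply: (le_trans (mth s)); apply: ge0_ler_powR; rewrite ?nnegrE ?ler0n ?ler_nat.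
rewrite vth => hl.
have -> : (3 * C) `^ a * v%:R `^ (a * (1 + theta + e)) = (3 * C * v%:R `^ (1 + theta + e)) `^ a.
  by rewrite [RHS]powRM ?powR_ge0 ?mulr_ge0 ?(ltW C0)// [a * _]mulrC powRrM.
apply: ge0_ler_powR => //; rewrite ?nnegrE.
- by have [n [-> _ _]] := word_lengthP R (x^-1 * y)%g (generates_Dgens m); exact: ler0n.
- by rewrite !mulr_ge0 ?powR_ge0 ?(ltW C0).
apply: (le_trans hl); rewrite [X in _ <= _ * X]powRD; last by rewrite pnatr_eq0 -lt0n v0 implybT.
lra.
Qed.

End SharpBound.

Definition lamp_size (R : realType) (theta : R) (s : nat) : nat :=
  Num.truncn ((4 ^ s)%:R `^ theta : R).

Section LampSize.
Variables (R : realType) (theta : R).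
Hypothesis th0 : 0 <= theta.
Local Notation m := (lamp_size theta).

Let ge1 s : 1 <= (4 ^ s)%:R `^ theta :> R.
Proof. by rewrite -[leLHS](powRr0 (4 ^ s)%:R) ler_powR// ler1n expn_gt0. Qed.

Lemma lamp_size_gt0 s : (0 < m s)%N.
Proof. by rewrite truncn_gt0. Qed.

Lemma lamp_size_le s : (m s)%:R <= (4 ^ s)%:R `^ theta :> R.
Proof. by rewrite truncn_le powR_ge0. Qed.

Lemma le_lamp_size s : (4 ^ s)%:R `^ theta <= 2 * (m s)%:R :> R.
Proof.
apply: (le_trans (ltW (truncnS_gt _))); rewrite -/(lamp_size theta s) -natr1.
have : 1 <= (m s)%:R :> R by rewrite ler1n lamp_size_gt0.
by lra.
Qed.

Lemma lamp_size_sqr s : theta <= 2^-1 -> (m s ^ 2 <= 4 ^ s)%N.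
Proof.
move=> th; rewrite -(ler_nat R) natrX.
apply: (@le_trans _ _ (((4 ^ s)%:R `^ theta) ^+ 2)).
  by rewrite lerXn2r ?nnegrE ?powR_ge0// lamp_size_le.
rewrite -powR_mulrn ?powR_ge0// -powRrM -[leRHS]powRr1//; apply: ler_powR.
  by rewrite ler1n expn_gt0.
lra.
Qed.

End LampSize.

(** * Adjoining the angles to the range coordinates *)

Section AngleEmbedding.
Variables (R : realType) (m : nat -> nat).
Hypothesis m0 : forall s, (0 < m s)%N.
Variables (q d : R).
Hypotheses (q1 : 1 <= q) (d0 : 0 < d).
Local Notation Delta := (Delta m).
Implicit Types (x g t : Delta) (psi : Delta -> nat -> R).

(** Either a coordinate of the range embedding, or a level, a lamp and the choice between cosine and
    sine. *)
Definition site : Type := (nat + nat * (int * bool))%type.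
HB.instance Definition _ := Countable.on site.

(** The first factor normalizes the change of an angle under a cursor step to a constant; the second
    makes the [q]-th powers summable over the [2 * kk s] coordinates moved at each of the levels. *)
Definition ang_weight s : R := (4 * m s * kk s)%:R * (4 * kk s)%:R `^ (- ((1 + d) / q)).

Definition trig (b : bool) : R -> R := if b then cos else sin.

Definition with_angles psi g (n : nat) : R :=
  match pickle_inv n : option site with
  | Some (inl k) => psi g k
  | Some (inr (s, (u, b))) => ang_weight s * trig b (ang R g s u)
  | None => 0
  end.

Let q0 : 0 < q. Proof. by rewrite (lt_le_trans ltr01). Qed.

Lemma trigP b : trig b = cos \/ trig b = sin.
Proof. by case: b; [left|right]. Qed.

Lemma with_angles_inl psi g k : with_angles psi g (pickle (inl k : site)) = psi g k.
Proof. by rewrite /with_angles pickleK_inv. Qed.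

Lemma with_angles_inr psi g s u b :
  with_angles psi g (pickle (inr (s, (u, b)) : site)) = ang_weight s * trig b (ang R g s u).
Proof. by rewrite /with_angles pickleK_inv. Qed.

Lemma ang_weight_ge0 s : 0 <= ang_weight s.
Proof. by rewrite mulr_ge0 ?powR_ge0. Qed.

Lemma with_angles_ge psi x y :
  (lp_dist q (psi x) (psi y) <= lp_dist q (with_angles psi x) (with_angles psi y))%E.
Proof.
apply: (@nneseries_le_cover _ _ _ (fun n =>
  if pickle_inv n : option site is Some (inl k) then k else 0)).
- by move=> i; rewrite lee_fin powR_ge0.
- by move=> i; rewrite lee_fin powR_ge0.
move=> k _; exists (pickle (inl k : site)); rewrite pickleK_inv; split=> //.
by rewrite !with_angles_inl.
Qed.

(** The squared chord is at least [2 z ^ 2], so the cosine or the sine differs by at least [z];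
    which one is chosen lamp by lamp. *)
Lemma with_angles_ge_sites psi x g s (r : seq int) (J : int -> int) : uniq r ->
  (forall u, (`|J u| <= m s)%N) -> (forall u, lh g s u = (2 * J u)%:~R) ->
  ((\sum_(u <- r) (ang_weight s * ((`|J u|.-1)%:R / (m s)%:R)) `^ q)%:E <=
   lp_dist q (with_angles psi (x * g)%g) (with_angles psi x))%E.
Proof.
move=> ur Jm hJ.
have big u : exists b, ((`|J u|.-1)%:R / (m s)%:R) <=
    `|trig b (ang R (x * g)%g s (u + pos x)) - trig b (ang R x s (u + pos x))|.
  have := chord_ge R m0 (Jm u) (hJ u); set z := _ / _ => hz.
  have := chord_ang R m0 x g s (u + pos x); rewrite addrK => hc.
  rewrite -{}hc -valDM cosB in hz; set A := ang R _ s _ in hz *; set B := ang R _ s _ in hz *.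
  have z0 : 0 <= z by rewrite divr_ge0.
  have [h|h] := leP z `|cos A - cos B|; first by exists true.
  exists false; rewrite leNgt; apply/negP => h'.
  have : (cos A - cos B) ^+ 2 < z ^+ 2.
    by rewrite -[ltLHS]real_normK ?num_real// ltr_pXn2r// nnegrE.
  have : (sin A - sin B) ^+ 2 < z ^+ 2.
    by rewrite -[ltLHS]real_normK ?num_real// ltr_pXn2r// nnegrE.
  have := cos2Dsin2 A; have := cos2Dsin2 B; lra.
have /boolp.choice[b hb] := big.
pose f u := pickle (inr (s, (u + pos x, b u)) : site).
have uf : uniq [seq f u | u <- r].
  rewrite map_inj_uniq// => u v /(pcan_inj (@pickleK site)) [].
  by move=> /addIr.
apply: le_trans (nneseries_ge_finite uf _); last by move=> i; rewrite lee_fin powR_ge0.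
rewrite big_map -sumEFin; apply: lee_sum => u _; rewrite lee_fin !with_angles_inr -mulrBr.
rewrite normrM ger0_norm ?ang_weight_ge0//; apply: ge0_ler_powR; rewrite ?nnegrE ?(ltW q0)//.
- by rewrite !mulr_ge0 ?ang_weight_ge0 ?invr_ge0.
- by rewrite mulr_ge0 ?ang_weight_ge0.
- by rewrite ler_wpM2l ?ang_weight_ge0.
Qed.

Lemma ang_weight_step s b x t u : t \in Dgens m ->
  (ang_weight s * `|trig b (ang R (x * t)%g s u) - trig b (ang R x s u)|) `^ q <=
  pi `^ q * ((4 * kk s)%:R `^ (1 + d))^-1.
Proof.
move=> tS; have h := trig_ang_step m0 x s u (trigP b) tS.
have -> : pi `^ q * ((4 * kk s)%:R `^ (1 + d))^-1 = (pi * (4 * kk s)%:R `^ (- ((1 + d) / q))) `^ q.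
  by rewrite [RHS]powRM ?pi_ge0 ?powR_ge0// -powRrM mulNr divfK ?gt_eqF// powRN.
apply: ge0_ler_powR; rewrite ?nnegrE ?(ltW q0)//.
- by rewrite mulr_ge0 ?ang_weight_ge0.
- by rewrite mulr_ge0 ?pi_ge0 ?powR_ge0.
- by rewrite /ang_weight mulrAC ler_wpM2r ?powR_ge0.
Qed.

Lemma with_angles_step psi (K : R) :
  (forall x t, t \in Dgens m -> (lp_dist q (psi (x * t)%g) (psi x) <= K%:E)%E) ->
  exists K' : R, forall x t, t \in Dgens m ->
    (lp_dist q (with_angles psi (x * t)%g) (with_angles psi x) <= K'%:E)%E.
Proof.
move=> HK; have [K2 HK2] := p_series_bound d0.
exists (K + pi `^ q * K2) => x t tS.
pose F n := (`|with_angles psi (x * t)%g n - with_angles psi x n| `^ q)%:E.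
pose isl n := if pickle_inv n : option site is Some (inl _) then true else false.
have F0 n : (0 <= F n)%E by rewrite lee_fin powR_ge0.
rewrite /lp_dist (eq_eseriesr (g := fun n =>
  ((if isl n then F n else 0) + (if isl n then 0 else F n))%E)); last first.
  by move=> n _; rewrite -/(F n); case: (isl n); rewrite ?adde0 ?add0e.
rewrite nneseriesD; last 2 first.
  by move=> n _; case: ifP.
  by move=> n _; case: ifP.
rewrite EFinD; apply: leeD.
  apply: le_trans (HK x t tS).
  apply: (@nneseries_le_cover _ _ _ (fun k => pickle (inl k : site))).
  - by move=> n; case: ifP.
  - by move=> n; rewrite lee_fin powR_ge0.
  move=> n; rewrite /isl; case E: (pickle_inv n) => [[k|z]|]; rewrite ?eqxx// => _.
  exists k; have nE : pickle (inl k : site) = n.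
    by have := @pickle_invK site n; rewrite E.
  by split=> //; rewrite -nE /F !with_angles_inl.
pose c n : R := pi `^ q * ((n.+1)%:R `^ (1 + d))^-1.
have c0 n : 0 <= c n by rewrite mulr_ge0 ?invr_ge0 ?powR_ge0.
apply: (@le_trans _ _ (\sum_(n <oo) (c n)%:E)%E); last first.
  apply: nneseries_le_bound => // n; rewrite -mulr_sumr ler_wpM2l ?powR_ge0//.
(* The coordinates moved at level [s] get the numbers [4 * 4 ^ s + 2 i + b] with [i < 2 * 4 ^ s].
   They lie below [4 * kk s], and distinct levels get disjoint ranges, so a single series with
   exponent [1 + d] bounds all levels. *)
pose j n := let s := (trunc_log 4 n).-1 in
  pickle (inr (s, (pos x + 1 + ((n - 4 * 4 ^ s)./2)%:Z, odd n)) : site).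
apply: (@nneseries_le_cover _ _ _ j).
- by move=> n; case: ifP.
- by move=> n; rewrite lee_fin.
move=> n; rewrite /isl; case E: (pickle_inv n) => [[k|[s [u b]]]|]; rewrite ?eqxx//; last first.
  by rewrite /F /with_angles E subrr normr0 powR0 ?(lt0r_neq0 q0)// eqxx.
have nE : pickle (inr (s, (u, b)) : site) = n by have := @pickle_invK site n; rewrite E.
rewrite -nE /F !with_angles_inr -mulrBr normrM ger0_norm ?ang_weight_ge0// => F1.
have hu : 1 <= u - pos x <= (kk s)%:Z.
  apply: contraNT F1 => hu.
  rewrite (_ : trig b _ = trig b (ang R x s u)) ?subrr ?normr0 ?mulr0 ?powR0 ?(lt0r_neq0 q0)//.
  move: tS; rewrite !inE valDM => /or3P[]/eqP->.
  - by rewrite ang_tau_far.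
  - by rewrite ang_a//; exact: trigP.
  - by rewrite ang_b//; exact: trigP.
pose i := (`|(u - pos x)%R|.-1)%N; have ik : (i < 2 * 4 ^ s)%N by rewrite /i; rewrite /kk in hu; lia.
exists (4 * 4 ^ s + i.*2 + b)%N; split.
  rewrite /j (_ : trunc_log 4 _ = s.+1).
    congr pickle; congr (inr (s, (_, _))).
      rewrite -addnA addKn /= addnC half_bit_double /i; lia.
    by rewrite !oddD odd_double; case: (odd (4 ^ s)) (b) => [][].
  apply: trunc_log_eq => //; rewrite !expnS; move: (4 ^ s)%N ik => w ik; case: (b); lia.
rewrite lee_fin; apply: (le_trans (ang_weight_step s b x u tS)).
rewrite ler_wpM2l ?powR_ge0// lef_pV2 ?posrE ?powR_gt0 ?ltr0n//; last first.
  by rewrite /kk muln_gt0 /= muln_gt0 expn_gt0.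
apply: ge0_ler_powR; rewrite ?nnegrE//; first by rewrite addr_ge0// ltW.
by rewrite ler_nat /kk; move: (4 ^ s)%N ik => w ik; case: (b); lia.
Qed.

Lemma with_angles_finite psi (K : R) :
  (forall x t, t \in Dgens m -> (lp_dist q (psi (x * t)%g) (psi x) <= K%:E)%E) ->
  forall g, (lp_dist q (with_angles psi g) (with_angles psi 1%g) < +oo)%E.
Proof.
move=> HK g; have [K' HK'] := with_angles_step HK.
have [n gn] := generates_shorter g (generates_Dgens m).
apply: (@shorter_ind _ (Dgens m)
  (fun g => (lp_dist q (with_angles psi g) (with_angles psi 1%g) < +oo)%E) _ _ n g gn).
  by rewrite lp_distxx.
move=> x t xfin tS; split.
  exact: (lp_dist_fin_trans q1 (le_lt_trans (HK' x t tS) (ltry _)) xfin).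
have h : (lp_dist q (with_angles psi (x * t^-1)%g) (with_angles psi x) < +oo)%E.
  have := HK' (x * t^-1)%g t tS; rewrite mulgVK lp_distC => h.
  exact: le_lt_trans h (ltry _).
exact: (lp_dist_fin_trans q1 h xfin).
Qed.

End AngleEmbedding.

(** * The power mean inequality *)

Section PowerMean.
Variables (R : realType) (q : R).
Hypothesis q1 : 1 < q.

(** Young's inequality for the product [t * 1]. *)
Lemma powR_tangent (t : R) : 0 <= t -> 1 + q * (t - 1) <= t `^ q.
Proof.
move=> t0; have q0 : 0 < q by rewrite (lt_trans ltr01).
have r0 : 0 < q - 1 by rewrite subr_gt0.
have := @conjugate_powR R t 1 q (q / (q - 1)) t0 ler01 q0 (divr_gt0 q0 r0).
rewrite invfM invrK mulrBr mulr1 mulVf ?gt_eqF// addrC subrK => /(_ erefl).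
rewrite powR1 mulr1 mul1r => h.
have := ler_wpM2l (ltW q0) h; rewrite mulrDr mulrCA divff ?gt_eqF// mulr1.
by rewrite mulrBr mulr1 divff ?gt_eqF//; lra.
Qed.

(** The tangent inequality at each [x i / A], with [A] the mean; in the sum the linear terms
    cancel. *)
Lemma power_mean (W : nat) (x : 'I_W -> R) : (0 < W)%N -> (forall i, 0 <= x i) ->
  (\sum_i x i) `^ q <= W%:R `^ (q - 1) * \sum_i x i `^ q.
Proof.
move=> W0 x0; have W0' : 0 < W%:R :> R by rewrite ltr0n.
have S0 : 0 <= \sum_i x i by exact: sumr_ge0.
have q0 : q != 0 by rewrite gt_eqF// (lt_trans ltr01).
have [S00|Sn0] := eqVneq (\sum_i x i) 0.
  by rewrite S00 powR0// mulr_ge0 ?powR_ge0// sumr_ge0// => i _; exact: powR_ge0.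
pose A := (\sum_i x i) / W%:R; have A0 : 0 < A by rewrite divr_gt0// lt0r Sn0.
have SA : \sum_i x i = A * W%:R by rewrite divfK ?gt_eqF.
have h : A `^ q * W%:R <= \sum_i x i `^ q.
  have -> : A `^ q * W%:R = \sum_i A `^ q * (1 + q * (x i / A - 1)).
    rewrite -mulr_sumr big_split /= sumr_const card_ord -mulr_sumr big_split /=.
    rewrite -mulr_suml SA [A * _]mulrC mulfK ?gt_eqF// sumr_const card_ord mulNrn subrr mulr0 addr0.
    by [].
  apply: ler_sum => i _; have -> : x i `^ q = A `^ q * (x i / A) `^ q.
    by rewrite -powRM ?divr_ge0 ?(ltW A0)// mulrC divfK ?gt_eqF.
  by rewrite ler_wpM2l ?powR_ge0// powR_tangent// divr_ge0// ltW.
rewrite SA powRM ?(ltW A0) ?(ltW W0')//.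
have -> : W%:R `^ q = W%:R `^ (q - 1) * W%:R :> R.
  by rewrite -{1}[q](subrK 1) [LHS]powRD ?(gt_eqF W0') ?implybT// powRr1// ltW.
by rewrite mulrCA ler_wpM2l ?powR_ge0// mulrC.
Qed.

End PowerMean.

(** * Total rotation bounded by the angles *)

Section Windows.
Variables (R : realType) (m : nat -> nat).
Hypothesis m0 : forall s, (0 < m s)%N.
Variables (q d : R).
Hypotheses (q2 : 2 < q) (d0 : 0 < d) (dq : d <= q - 2).
Local Notation Delta := (Delta m).
Local Notation D := (3 * q - 4 - 2 * d).

Let q0 : 0 < q. Proof. by move: q2; lra. Qed.
Let q1 : 1 <= q. Proof. by move: q2; lra. Qed.
Let q1' : 1 < q. Proof. by move: q2; lra. Qed.

Lemma window_max_site (J : int -> int) s v i : exists2 j, (j < 4 ^ s)%N &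
  window_max J s v i = absz (J ((i * 4 ^ s + j)%N%:Z - v%:Z)).
Proof.
have c0 : (0 < #|'I_(4 ^ s)|)%N by rewrite card_ord expn_gt0.
have [j jE] := @bigop.eq_bigmax _ (fun j : 'I_(4 ^ s) => absz (J ((i * 4 ^ s + j)%N%:Z - v%:Z))) c0.
by exists j.
Qed.

(** One lamp per window, where the maximum is attained; windows are disjoint, so the lamps are
    distinct. The factor [m s] of the weight cancels against the chord, leaving [4 * kk s] to the
    power [q - 1 - d]. *)
Lemma windows_le (psi : Delta -> nat -> R) (x g : Delta) s v (J : int -> int) :
  (forall u, (`|J u| <= m s)%N) -> (forall u, lh g s u = (2 * J u)%:~R) ->
  (((4 ^ s)%:R `^ (q - 1 - d) *
     \sum_(i < (2 * v) %/ 4 ^ s + 1) ((window_max J s v i).-1)%:R `^ q)%:E <=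
   lp_dist q (with_angles q d psi (x * g)%g) (with_angles q d psi x))%E.
Proof.
move=> Jm hJ.
have /boolp.choice[j hj] : forall i, exists j, (j < 4 ^ s)%N /\
    window_max J s v i = absz (J ((i * 4 ^ s + j)%N%:Z - v%:Z)).
  by move=> i; have [j jl jE] := window_max_site J s v i; exists j.
pose f (i : 'I_((2 * v) %/ 4 ^ s + 1)) : int := (i * 4 ^ s + j i)%N%:Z - v%:Z.
have uf : uniq [seq f i | i <- enum 'I_((2 * v) %/ 4 ^ s + 1)].
  rewrite map_inj_uniq ?enum_uniq// => i k /addIr [] ik; apply: val_inj.
  have := congr1 (fun n => n %/ 4 ^ s)%N ik.
  rewrite /= !divnMDl ?expn_gt0// (divn_small (hj i).1) (divn_small (hj k).1).
  by rewrite !addn0.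
apply: le_trans (with_angles_ge_sites m0 d q1 psi x uf Jm hJ).
rewrite lee_fin [leRHS]big_map big_enum /= mulr_sumr; apply: ler_sum => i _.
have z0 : 0 < (4 ^ s)%:R :> R by rewrite ltr0n expn_gt0.
have k0 : 0 < (4 * kk s)%:R :> R by rewrite ltr0n /kk !muln_gt0 expn_gt0.
have ms : 0 < (m s)%:R :> R by rewrite ltr0n.
rewrite (hj i).2 -/(f i); set u : R := (_.-1)%:R.
have -> : ang_weight m q d s * (u / (m s)%:R) = (4 * kk s)%:R `^ ((q - 1 - d) / q) * u.
  have -> : (q - 1 - d) / q = 1 + - ((1 + d) / q).
    by rewrite -[in LHS]addrA -opprD mulrBl divff ?gt_eqF.
  rewrite powRD ?(gt_eqF k0) ?implybT// powRr1 ?(ltW k0)// /ang_weight.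
  have -> : (4 * m s * kk s)%:R = (4 * kk s)%:R * (m s)%:R :> R by rewrite mulnAC natrM.
  have : (m s)%:R * (u / (m s)%:R) = u by rewrite mulrC divfK ?gt_eqF.
  set P := (_ `^ _); move=> h; rewrite -[X in _ = _ * _ * X]h; lra.
rewrite powRM ?powR_ge0// -powRrM divfK ?gt_eqF// ler_wpM2r ?powR_ge0//.
apply: ge0_ler_powR; rewrite ?nnegrE//; first by move: q2 dq; lra.
by rewrite ler_nat /kk; lia.
Qed.

(** Write [z = 4 ^ s] and [V = 3 v]. The power mean gives [z ^ (q - 2 - d) * T ^ q <= V ^ (q - 1) *
    N ^ q], and [m s ^ 2 <= z] gives [T ^ 2 <= V ^ 2 * z]. Raising the latter to the power
    [q - 2 - d] and multiplying eliminates [z], whence [D = 2 * (q - 2 - d) + q]. The summand [3 v]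
    pays for the predecessors in [windows_le]. *)
Lemma window_sum_le_angles (psi : Delta -> nat -> R) (x g : Delta) s v (J : int -> int) (N : R) :
  (m s ^ 2 <= 4 ^ s)%N -> (4 ^ s <= v)%N ->
  (forall u, (`|J u| <= m s)%N) -> (forall u, lh g s u = (2 * J u)%:~R) -> 0 <= N ->
  (N `^ q)%:E = lp_dist q (with_angles q d psi (x * g)%g) (with_angles q d psi x) ->
  exists T : R, [/\ 0 <= T, (window_sum J s v)%:R <= 3 * v%:R + T &
    T `^ D <= (3 * v%:R) `^ (D - 1) * N `^ q].
Proof.
move=> m2 sv Jm hJ N0 NE; have := windows_le psi x v Jm hJ.
rewrite -NE lee_fin; set W := ((2 * v) %/ 4 ^ s + 1)%N; set z : R := (4 ^ s)%:R.
pose y i : R := ((window_max J s v i).-1)%:R; rewrite -/(\sum_(i < W) y i `^ q) => hN.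
have z0 : 0 < z by rewrite ltr0n expn_gt0.
have W0 : (0 < W)%N by rewrite /W addn1.
have Wz : W%:R * z <= 3 * v%:R.
  rewrite /z -natrM -[3]/(3%:R) -natrM ler_nat /W mulnDl mul1n.
  by have := leq_divM (2 * v) (4 ^ s); move: (_ %/ _ * _)%N => u; lia.
have v0 : 0 < v%:R :> R by rewrite ltr0n (leq_trans _ sv)// expn_gt0.
pose X := \sum_(i < W) y i; have X0 : 0 <= X by exact: sumr_ge0.
exists (X * z); set T := X * z; have T0 : 0 <= T by rewrite mulr_ge0// ltW.
set V := 3 * v%:R in Wz *; have V0 : 0 < V by rewrite mulr_gt0.
split=> //.
  apply: (@le_trans _ _ (W%:R * z + X * z)); last by rewrite lerD2r.
  rewrite /window_sum natr_sum -mulrDl.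
  have -> : W%:R + X = \sum_(i < W) (1 + y i) by rewrite big_split /= sumr_const card_ord.
  rewrite mulr_suml; apply: ler_sum => i _; rewrite natrM mulrC ler_wpM2r ?(ltW z0)//.
  have : (window_max J s v i <= (window_max J s v i).-1.+1)%N by exact: leqSpred.
  by rewrite -(ler_nat R) -natr1 addrC.
have hT2 : T ^+ 2 <= V ^+ 2 * z.
  have hX : X <= W%:R * (m s)%:R.
    have -> : W%:R * (m s)%:R = \sum_(i < W) (m s)%:R :> R.
      by rewrite sumr_const card_ord mulr_natl.
    apply: ler_sum => i _; rewrite ler_nat.
    by apply: (leq_trans (leq_pred _)); apply/bigmax_leqP.
  have hT : T <= V * (m s)%:R.
    apply: (le_trans (ler_wpM2r (ltW z0) hX)).
    by rewrite mulrAC ler_wpM2r.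
  have : T ^+ 2 <= (V * (m s)%:R) ^+ 2 by rewrite lerXn2r ?nnegrE ?mulr_ge0 ?(ltW V0).
  move=> /le_trans; apply; rewrite exprMn ler_wpM2l ?exprn_ge0 ?(ltW V0)//.
  by rewrite -natrX ler_nat.
have hq : z `^ (q - 2 - d) * T `^ q <= V `^ (q - 1) * N `^ q.
  have pm := power_mean q1' W0 (fun i : 'I_W => ler0n R (window_max J s v i).-1).
  rewrite -/(y _) in pm.
  have -> : z `^ (q - 2 - d) * T `^ q = z `^ (q - 1) * z `^ (q - 1 - d) * X `^ q.
    rewrite /T powRM ?(ltW z0)// mulrCA mulrC -!powRD ?(gt_eqF z0) ?implybT//.
    by congr (_ `^ _ * _); lra.
  apply: (@le_trans _ _ (z `^ (q - 1) * z `^ (q - 1 - d) * (W%:R `^ (q - 1) * \sum_(i < W) y i `^ q))).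
    by rewrite ler_wpM2l ?mulr_ge0 ?powR_ge0.
  have -> : z `^ (q - 1) * z `^ (q - 1 - d) * (W%:R `^ (q - 1) * \sum_(i < W) y i `^ q) =
      (W%:R * z) `^ (q - 1) * (z `^ (q - 1 - d) * \sum_(i < W) y i `^ q).
    by rewrite powRM ?(ltW z0)//; lra.
  apply: ler_pM; rewrite ?mulr_ge0 ?powR_ge0//.
    by apply: sumr_ge0 => i _; exact: powR_ge0.
  apply: ge0_ler_powR; rewrite ?nnegrE ?mulr_ge0 ?(ltW z0) ?(ltW V0)//; move: q1; lra.
pose E := q - 2 - d; have E0 : 0 <= E by rewrite /E; move: dq; lra.
have [->|Tn0] := eqVneq T 0.
  by rewrite powR0 ?mulr_ge0 ?powR_ge0//; move: q2 dq; lra.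
have T0' : 0 < T by rewrite lt0r Tn0.
have -> : D = 2 * E + q by rewrite /E; lra.
have -> : 2 * E + q - 1 = 2 * E + (q - 1) by lra.
have DE (t r : R) : 0 < t -> t `^ (2 * E + r) = t `^ (2 * E) * t `^ r.
  by move=> t0; rewrite powRD ?(gt_eqF t0) ?implybT.
rewrite !DE//.
have pE (t : R) : 0 <= t -> t `^ (2 * E) = (t ^+ 2) `^ E.
  by move=> t0; rewrite powRrM powR_mulrn.
rewrite !pE ?(ltW V0)//.
have h2 : (T ^+ 2) `^ E <= (V ^+ 2) `^ E * z `^ E.
  rewrite -powRM ?exprn_ge0 ?(ltW V0) ?(ltW z0)//.
  by apply: ge0_ler_powR; rewrite ?nnegrE ?mulr_ge0 ?exprn_ge0 ?(ltW V0) ?(ltW z0).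
apply: (le_trans (ler_wpM2r (powR_ge0 T q) h2)); rewrite -!mulrA ler_wpM2l ?powR_ge0//.
Qed.

End Windows.

(** With [n = N / c], the range bound reads [v <= n ^ (1 + eta)]. Inserted into the bound for [T] it
    gives the exponent [((1 + eta) * (D - 1) + q) / D], which is at most [1 + eta + (q - 1) / D]. *)
Lemma powR_interpolation (R : realType) (q eta D c : R) :
  1 <= q -> 0 < eta -> 1 < D -> 0 < c -> exists2 K : R, 0 < K &
  forall v N T : R, 1 <= v -> 0 <= N -> 0 <= T -> c * v `^ (1 + eta)^-1 <= N ->
    T `^ D <= (3 * v) `^ (D - 1) * N `^ q ->
    [/\ 1 <= N / c, v <= (N / c) `^ (1 + eta) &
        3 * v + T <= K * (N / c) `^ (1 + eta + (q - 1) / D)].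
Proof.
move=> q1 e0 D1 c0; have q0 : 0 < q by rewrite (lt_le_trans ltr01).
 have D0 : 0 < D by rewrite (lt_trans ltr01).
pose A : R := 3 `^ (D - 1) * c `^ q; have A0 : 0 < A by rewrite mulr_gt0 ?powR_gt0.
have A0' : 0 < A^-1 `^ D^-1 by rewrite powR_gt0 ?invr_gt0.
exists (3 + (A^-1 `^ D^-1)^-1); first by rewrite addr_gt0// invr_gt0.
move=> v N T v1 N0 T0 hv hT; have e1 : 0 < 1 + eta by rewrite addr_gt0.
have v0 : 0 < v by rewrite (lt_le_trans ltr01).
have vn : v `^ (1 + eta)^-1 <= N / c by rewrite ler_pdivlMr// mulrC.
have n1 : 1 <= N / c.
  by apply: le_trans vn; rewrite -[leLHS](powRr0 v) ler_powR// invr_ge0 ltW.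
move: {vn} (N / c) n1 vn (divfK (lt0r_neq0 c0) N) => n n1 vn nN.
have n0 : 0 < n by rewrite (lt_le_trans ltr01).
have vle : v <= n `^ (1 + eta).
  have -> : v = (v `^ (1 + eta)^-1) `^ (1 + eta).
    by rewrite -powRrM mulVf ?lt0r_neq0// powRr1// ltW.
  by apply: ge0_ler_powR; rewrite ?nnegrE ?powR_ge0 ?(ltW e1) ?(ltW n0).
split=> //; set Y := 1 + eta + (q - 1) / D.
have YE : Y * D = (1 + eta) * D + (q - 1) by rewrite /Y [LHS]mulrDl divfK ?lt0r_neq0.
have YD : (1 + eta) * (D - 1) + q <= Y * D by rewrite YE; lra.
rewrite [leRHS]mulrDl; apply: lerD.
  rewrite ler_pM2l//; apply: (le_trans vle); rewrite ler_powR// lerDl.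
  by rewrite divr_ge0 ?(ltW D0)// subr_ge0.
rewrite ler_pdivlMl//; apply: (@powR_root_le R D) (ltW D1) _ T0 (powR_ge0 _ _) _.
  by rewrite invr_ge0 ltW.
rewrite ler_pdivrMl//; apply: (le_trans hT).
rewrite -nN (powRM _ (ltW n0) (ltW c0)) (powRM _ _ (ltW v0))// -powRrM.
have -> : A * n `^ (Y * D) = 3 `^ (D - 1) * n `^ (Y * D) * c `^ q by rewrite /A; lra.
rewrite [leLHS]mulrA ler_wpM2r ?powR_ge0// -[leLHS]mulrA ler_wpM2l ?powR_ge0//.
apply: (@le_trans _ _ (n `^ ((1 + eta) * (D - 1)) * n `^ q)).
  rewrite ler_wpM2r ?powR_ge0// powRrM; apply: ge0_ler_powR; rewrite ?nnegrE ?powR_ge0 ?(ltW v0)//.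
  by rewrite subr_ge0 ltW.
by rewrite -powRD ?(gt_eqF n0) ?implybT// ler_powR.
Qed.

(** * Lower bound for the exponent, [q > 2] *)

Section AngleBound.
Variables (R : realType) (m : nat -> nat).
Hypothesis m0 : forall s, (0 < m s)%N.
Hypothesis m2 : forall s, (m s ^ 2 <= 4 ^ s)%N.
Local Notation Delta := (Delta m).
Local Notation len := (word_length R (Dgens m)).

(* As eta and d tend to 0, the exponent 1 + 2 eta + (q - 1) / (3q - 4 - 2d) tends to
   the inverse of (3q - 4) / (4q - 5). *)
Lemma angle_parameters (q a : R) : 2 < q -> 0 <= a -> a < (3 * q - 4) / (4 * q - 5) ->
  exists eta d : R, [/\ 0 < eta, 0 < d, d <= q - 2, 1 < 3 * q - 4 - 2 * d &
    a * (1 + 2 * eta + (q - 1) / (3 * q - 4 - 2 * d)) <= 1].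
Proof.
move=> q2 a0; set Q := 3 * q - 4 => ab; have Q2 : 2 < Q by rewrite /Q; lra.
have Q0 : 0 < Q by lra.
have q5 : 0 < 4 * q - 5 by lra.
pose w := (q - 1) / Q; have wQ : w * Q = q - 1 by rewrite divfK ?lt0r_neq0.
have w0 : 0 <= w by rewrite divr_ge0//; lra.
have w1 : w <= 1 by rewrite ler_pdivrMr// /Q; lra.
have aw : a * (1 + w) < 1.
  have h : (1 + w) * Q = 4 * q - 5 by rewrite mulrDl wQ /Q; lra.
  by rewrite -(ltr_pM2r Q0) mul1r -mulrA h -ltr_pdivlMr.
pose eta := (1 - a * (1 + w)) / (3 * (1 + a)).
have aa : 0 < 3 * (1 + a) by lra.
have eE : eta * (3 * (1 + a)) = 1 - a * (1 + w) by rewrite divfK ?lt0r_neq0.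
have eta0 : 0 < eta by rewrite divr_gt0// subr_gt0.
have eta1 : eta <= 1 / 3.
  have ae := mulr_ge0 a0 (ltW eta0); have aw0 := mulr_ge0 a0 w0; lra.
pose d := Num.min (eta / 2) (q - 2).
have d0 : 0 < d by rewrite lt_min; apply/andP; split; lra.
have de : d <= eta / 2 by rewrite ge_min lexx.
exists eta, d; split=> //; first by rewrite ge_min lexx orbT.
  lra.
set D := Q - 2 * d; have D1 : 1 <= D by rewrite /D; lra.
have D0 : 0 < D by lra.
have wD : (q - 1) / D <= w + 2 * d.
  rewrite ler_pdivrMr// -wQ; have h := ler_wpM2l (ltW d0) D1; have h' := ler_wpM2l (ltW d0) w1.
  have -> : Q = D + 2 * d by rewrite /D subrK.
  lra.
have : a * (1 + 2 * eta + (q - 1) / D) <= a * (1 + w + 3 * eta).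
  by rewrite ler_wpM2l//; lra.
move/le_trans; apply; lra.
Qed.

Lemma alpha_star_Delta_ge (q : R) (q1 : 1 <= q) (S : seq Delta) :
  generates S -> 2 < q ->
  (((3 * q - 4) / (4 * q - 5))%:E <= alpha_star S (Lp01 q1))%E.
Proof.
move=> gS q2; set b := (_ / _).
have EFinI (u v : R) : (u%:E <= v%:E)%E -> u <= v by rewrite lee_fin.
have b0 : 0 < b by rewrite divr_gt0//; move: q2; lra.
suff H : forall a, 0 <= a -> a < b -> exists Psi : Delta -> Lp01 q1, setT Psi /\
    (exists K : R, forall x s, s \in Dgens m -> `|Psi (x * s)%g - Psi x| <= K) /\
    exists2 c : R, 0 < c &
      forall x y, x != y -> c * (len (x^-1 * y)%g) `^ a <= `|Psi x - Psi y|.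
  apply: (le_trans (@le_alpha R Delta S (Dgens m) _ gS (generates_Dgens m) setT b b0 H)).
  apply: ge_ereal_sup => _ [Psi [HL _] <-]; apply: ereal_sup_ubound; exists Psi => //.
move=> a a0 ab; have [eta [d [eta0 d0 dq D1 aY]]] := angle_parameters q2 a0 ab.
set D := 3 * q - 4 - 2 * d in D1 aY.
have q0 : 0 < q by move: q2; lra.
have e1' : 0 < 1 + eta by move: eta0; lra.
(* So that the range embedding detects [v] to the power [1 - e = (1 + eta)^-1], while the loss
   [v ^ e] in the length bound is at most [n ^ eta]. *)
pose e := 1 - (1 + eta)^-1.
have e0 : 0 < e by rewrite subr_gt0 invf_lt1//; move: eta0; lra.
have e1 : e <= 1 by rewrite gerBl invr_ge0 ltW.
have eeta : (1 + eta) * e = eta by rewrite mulrBr mulr1 mulfV ?lt0r_neq0// addrAC subrr add0r.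
have [psi [Phi [_ dE [K HK] [c c0 Hc]]]] := range_embedding m q1 e0 e1.
have [Psi PsiE] := lp_embedding q1 (with_angles_finite m0 q1 d0 HK).
have [K' HK'] := with_angles_step m0 q1 d0 HK.
exists Psi; split=> //; split.
  exists (Num.max 1 K') => x s sS; apply: (powR_le_bound (q1)) => //.
  by have := HK' x s sS; rewrite -PsiE => /EFinI.
have c10 : 0 < c `^ q^-1 by rewrite powR_gt0.
have [C C0 HC] := @length_le R m m0 e e0.
have [B B0 HB] := powR_interpolation q1 eta0 D1 c10.
have CB : 0 < (C * B) `^ a by rewrite powR_gt0 ?mulr_gt0.
exists (c `^ q^-1 / (C * B) `^ a); first by rewrite divr_gt0.
move=> x y xy; have g1 : (x^-1 * y)%g != 1%g by rewrite mulg_eq1 eqg_inv.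
have [v [v0 gv gv']] := exact_range g1.
set N := `|Psi x - Psi y|; have N0 : 0 <= N by exact: normr_ge0.
have v1 : 1 <= v%:R :> R by rewrite ler1n.
have hv : c `^ q^-1 * v%:R `^ (1 + eta)^-1 <= N.
  apply: powR_root_le (q1) (ltW c0) (powR_ge0 _ _) N0 _.
  rewrite -powRrM mulrC (_ : (1 + eta)^-1 = 1 - e); last by rewrite /e opprB [RHS]addrC subrK.
  rewrite mulrC [(1 - e) * q]mulrC; apply: (le_trans (Hc x y v v0 gv')).
  by apply: EFinI; rewrite dE PsiE; exact: with_angles_ge.
have [J [Jm Jl HJ]] := HC _ _ v0 gv.
have NE : (N `^ q)%:E = lp_dist q (with_angles q d psi (x * (x^-1 * y))%g) (with_angles q d psi x).
  by rewrite mulVKg -PsiE distrC.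
have D0 : D != 0 by rewrite gt_eqF// (lt_trans ltr01).
(* The bound for [v] alone is the instance [T = 0] of the interpolation. *)
have [n1 vn vB] : [/\ 1 <= N / c `^ q^-1, v%:R <= (N / c `^ q^-1) `^ (1 + eta) &
    v%:R <= B * (N / c `^ q^-1) `^ (1 + eta + (q - 1) / D)].
  have [|h1 h2 h3] := HB v%:R N 0 v1 N0 (lexx _) hv.
    by rewrite powR0// mulr_ge0 ?powR_ge0.
  by split=> //; apply: le_trans h3; rewrite addr0; have := ler0n R v; lra.
have := HJ _ vB; rewrite -/len => {}HJ.
set n := N / _ in n1 vn vB HJ; have n0 : 0 < n by rewrite (lt_le_trans ltr01).
have {}HJ : len (x^-1 * y)%g <= C * B * n `^ (1 + 2 * eta + (q - 1) / D).
  apply: (le_trans (HJ _)).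
    move=> s sv.
    have [T [T0 wT TD]] := window_sum_le_angles m0 q2 d0 dq (m2 s) sv (Jm s) (Jl s) N0 NE.
    by apply: (le_trans wT); have [] := HB v%:R N T v1 N0 T0 hv TD.
  have -> : 1 + 2 * eta + (q - 1) / D = eta + (1 + eta + (q - 1) / D) by lra.
  rewrite powRD ?(gt_eqF n0) ?implybT// [leRHS]mulrACA ler_wpM2r ?mulr_ge0 ?powR_ge0 ?(ltW B0)//.
  rewrite ler_wpM2l ?(ltW C0)// -eeta powRrM; apply: ge0_ler_powR; rewrite ?nnegrE ?powR_ge0 ?(ltW e0)//.
have nN : N = c `^ q^-1 * n by rewrite mulrC divfK ?lt0r_neq0.
rewrite nN -mulrA ler_pM2l// mulrC ler_pdivrMr// mulrC.
apply: (@le_trans _ _ ((C * B * n `^ (1 + 2 * eta + (q - 1) / D)) `^ a)).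
  apply: ge0_ler_powR; rewrite ?nnegrE ?mulr_ge0 ?powR_ge0 ?(ltW C0) ?(ltW B0)//.
  by have [k [-> _ _]] := word_lengthP R (x^-1 * y)%g (generates_Dgens m); exact: ler0n.
rewrite powRM ?powR_ge0 ?mulr_ge0 ?(ltW C0) ?(ltW B0)// ler_wpM2l ?(ltW CB)//.
by rewrite -powRrM mulrC -[leRHS]powRr1 ?(ltW n0)// ler_powR.
Qed.

End AngleBound.

(** * The exponents of the groups with lamps of size about [4 ^ (theta s)] *)

Lemma alpha_Delta (R : realType) (theta : R) : 0 <= theta <= 2^-1 ->
  forall S : seq (Delta (lamp_size theta)), generates S ->
  forall (p : R) (p1 : 1 <= p), p <= 2 ->
  alpha_star S (Lp01 p1) = ((1 + theta)^-1)%:E /\ alpha_sharp S (Lp01 p1) = ((1 + theta)^-1)%:E.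
Proof.
move=> /andP[th0 th2] S gS p p1 p2.
have m0 := lamp_size_gt0 th0.
have m2 s := lamp_size_sqr s th2.
have hi := alpha_star_Delta_le m0 m2 p1 gS p2 th0 (le_lamp_size th0).
have lo := alpha_sharp_Delta_ge m0 p1 gS th0 (lamp_size_le theta).
have ss := alpha_sharp_le_star S (Lp01 p1).
split; apply/le_anti/andP; split=> //.
- exact: le_trans lo ss.
- exact: le_trans ss hi.
Qed.


Theorem theorem1p4 (R : realType) :
  (forall alpha : R, 2 / 3 <= alpha <= 1 ->
    exists Delta : groupType,
      [/\ finitely_generated Delta, three_step_solvable Delta
        & forall S : seq Delta, generates S ->
          forall (p : R) (p1 : 1 <= p), p <= 2 ->
            alpha_star S (Lp01 p1) = alpha%:E /\
            alpha_sharp S (Lp01 p1) = alpha%:E]) /\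
  (exists Delta1 : groupType,
      [/\ finitely_generated Delta1, three_step_solvable Delta1
        & forall S : seq Delta1, generates S ->
          forall (q : R) (q1 : 1 <= q), 2 < q ->
            [/\ (((3 * q - 4) / (4 * q - 5))%:E <= alpha_star S (Lp01 q1))%E,
                (alpha_star S (Lp01 (le1_2 R)) < ((3 * q - 4) / (4 * q - 5))%:E)%E
              & alpha_star S (Lp01 (le1_2 R)) = (2 / 3)%:E]]).
Proof.
split.
  move=> alpha /andP[a23 a1]; have a0 : 0 < alpha by apply: lt_le_trans a23; lra.
  pose theta := alpha^-1 - 1; have aa : alpha^-1 * alpha = 1 by rewrite mulVf ?lt0r_neq0.
  have th : 0 <= theta <= 2^-1.
    have i0 : 0 < alpha^-1 by rewrite invr_gt0.
    have h1 := ler_wpM2l (ltW i0) a23; have h2 := ler_wpM2l (ltW i0) a1.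
    by apply/andP; split; rewrite /theta; lra.
  have <- : (1 + theta)^-1 = alpha by rewrite /theta addrC subrK invrK.
  exists (Delta (lamp_size theta)); split.
  - exact: finitely_generated_Delta.
  - exact: three_step_solvable_Delta.
  - by move=> S gS p p1 p2; exact: alpha_Delta.
pose theta : R := 2^-1; have th0 : 0 <= theta by rewrite invr_ge0.
have th : 0 <= theta <= 2^-1 by rewrite th0 lexx.
exists (Delta (lamp_size theta)); split.
- exact: finitely_generated_Delta.
- exact: three_step_solvable_Delta.
move=> S gS q q1 q2; have q5 : 0 < 4 * q - 5 by lra.
have -> : alpha_star S (Lp01 (le1_2 R)) = (2 / 3)%:E.
  rewrite (alpha_Delta th gS (le1_2 R) (lexx _)).1; congr EFin.
  apply: (@mulIf _ (1 + theta)); first by rewrite gt_eqF// ltr_pwDl.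
  by rewrite mulVf ?gt_eqF ?ltr_pwDl// /theta; lra.
(* After cross-multiplication the strict inequality is [8 q - 10 < 9 q - 12], that is, [q > 2]. *)
split=> //; last by rewrite lte_fin ltr_pdivlMr//; lra.
by apply: (alpha_star_Delta_ge (lamp_size_gt0 th0)) => // s; exact: lamp_size_sqr (lexx _).
Qed.
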